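(* For every real $x>-1$, $$\lim_{n\to\infty}\left[(2n)^{-\frac12-x-\left(n+\frac14\right)\ln(2n)}\prod_{k=1}^{2n}(k+x)^{(-1)^k k\ln(k+x)}\right]$$ $$=2^{-\frac14\ln 2+4\zeta'\left(-1,\frac{x+1}{2}\right)-4\zeta'\left(-1,\frac x2+1\right)}\left(\frac{\Gamma\left(\frac{x+1}{2}\right)}{\Gamma\left(\frac x2+1\right)}\right)^{-2x\ln 2}\exp\left(2\zeta''\left(-1,\tfrac x2+1\right)-2\zeta''\left(-1,\tfrac{x+1}{2}\right)+x\left(\zeta''\left(0,\tfrac{x+1}{2}\right)-\zeta''\left(0,\tfrac x2+1\right)\right)\right).$$
   Context: The limit is over positive integers $n$. $\zeta(s,a)$ denotes the Hurwitz zeta function, defined by $\zeta(s,a)=\sum_{\nu=0}^\infty(\nu+a)^{-s}$ for $\Re(s)>1$ and by analytic continuation in $s$ to $\mathbb{C}\setminus\{1\}$; $\zeta'(s,a)$ and $\zeta''(s,a)$ denote its first and second derivatives with respect to $s$. $\Gamma$ is the Gamma function and $\ln$ the natural logarithm. *)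

(* Defs.v *)
From Stdlib Require Import Reals List ClassicalEpsilon.
From Coquelicot Require Import Coquelicot.
Open Scope R_scope.

Definition Cexp (z : C) : C :=
  (exp (Re z) * cos (Im z), exp (Re z) * sin (Im z)).

(* r^s for a positive real base r and a complex exponent s, with the real
   logarithm of r. *)
Definition RCpow (r : R) (s : C) : C := Cexp (s * RtoC (ln r))%C.

Definition analytic_at (f : C -> C) (s0 : C) : Prop :=
  exists (c : nat -> C) (rho : R), 0 < rho /\
    forall s : C, Cmod (s - s0)%C < rho ->
      @is_pseries C_AbsRing C_NormedModule c (s - s0)%C (f s).

(* Since C \ {1} is connected, these two properties determine f off s = 1; its
   value at the pole s = 1 is unconstrained. *)
Definition is_hurwitz_zeta (a : R) (f : C -> C) : Prop :=
  (forall s : C, 1 < Re s ->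
     @is_series C_AbsRing C_NormedModule
       (fun nu : nat => RCpow (INR nu + a) (- s)%C) (f s)) /\
  (forall s : C, s <> RtoC 1 -> analytic_at f s).

(* zeta(s, a) for real a > 0 (the terms of the series are the intended ones only
   for positive bases), obtained by Hilbert choice: any fact about it off s = 1
   requires the existence and uniqueness of the analytic continuation. *)
Definition hurwitz_zeta (s : C) (a : R) : C :=
  epsilon (inhabits (fun _ : C => RtoC 0)) (is_hurwitz_zeta a) s.

(* C_derive is a total operator; where its argument is complex differentiable
   it is the complex derivative (is_C_derive_unique). *)
Definition hurwitz_zeta' (s : C) (a : R) : C :=
  C_derive (fun w : C => hurwitz_zeta w a) s.

Definition hurwitz_zeta'' (s : C) (a : R) : C :=
  C_derive (fun w : C => hurwitz_zeta' w a) s.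

(* Euler's integral, convergent for real z > 0. *)
Definition Gamma (z : R) : R :=
  RInt_gen (fun t : R => Rpower t (z - 1) * exp (- t))
    (at_right 0) (Rbar_locally p_infty).

(* The product of F k over m <= k <= n. *)
Definition prod_range (m n : nat) (F : nat -> R) : R :=
  fold_right Rmult 1 (map F (seq m (S n - m))).

(* Main.v *)
Require Import Defs.
From Stdlib Require Import Reals Lra Lia Factorial List Classical ClassicalEpsilon.
From Coquelicot Require Import Coquelicot.
Open Scope R_scope.

(** Put [a = (x+1)/2]. The factors [k = 2m+1] and [k = 2m+2] of the product have
[k + x = 2(m+a)] and [k + x = 2(m+a+1/2)], so the logarithm of the product is the
sum over [m < n] of [pair_log x (m+a+1/2) - pair_log x (m+a)], where
[pair_log x y = (2y - x)(ln 2 + ln y)^2]. Expanded, [pair_log] is a combination of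
[y^j (ln y)^i] with [j = 0, 1] and [i = 0, 1, 2], that is, of derivatives in [s] of
[y^(-s)] at [s = 0] and [s = -1]. Since [zeta(s,u) - zeta(s,u+1) = u^(-s)] for all
[s], the sum telescopes exactly: it equals [reg_log x a - reg_log x (a+n)], where
[reg_log x u] is the same combination of derivatives in [s] of the half-step
difference [zeta(s,u+1/2) - zeta(s,u)] ([prod_range_exp]). The first term is the
logarithm of the asserted limit ([limit_value]); what remains is the behaviour of
[reg_log x u] for large [u] ([reg_log_asymptotic]), which cancels the normalising
power of [2n] ([log_balance]).

Continuation. The regular part [g(s,u) = zeta(s,u) - 1/(s-1)] satisfies
[dg/du (s,u) = - 1 - s g(s+1,u)] and has mean zero over [1 <= u <= 2], hence
[g(s,u) = 3/2 - u + s J_u(g(s+1,.))], where [J_u h] ([neg_prim]) is the primitive of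
[-h] with mean zero over that interval. Read from right to left, this defines [g]
on [Re s > 1 - M] for each [M], with no pole to remove. The recursion is run on all
Taylor coefficients in [s] at once ([reg_coef]), and analyticity is carried by one
remainder inequality ([expands]) that passes through integrals and sums. An
identity theorem along horizontal lines makes the continuation unique
([hurwitz_unique]: off the real axis first, so that the pole is avoided) and
propagates the functional equation to every coefficient ([reg_coef_functional]).

Asymptotics. Let [A(u)] be a Taylor coefficient of the half-step difference. Then
[A(u) + A(u+1/2)] is known from the functional equation, and the recursion writes
[A(u+1/2) - A(u)] as an integral over [u, u+1/2] of coefficients belonging to
[s + 1]. Hence each [A] is explicit up to such an average ([half_diff_S_avg]).
Starting from [s = 2], where everything tends to [0], three steps give the
expansions at [s = 1, 0, -1] up to [o(1)].

Gamma. The first coefficient at [s = 0] and [ln (Gamma(u+1/2) / Gamma(u))] have the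
same increment under [u -> u+1] and the same asymptotics [ln u / 2], so they agree
([half_diff_ln_gamma_ratio]). The asymptotics of the Gamma quotient come from the
inequality [Gamma(z+1/2) <= sqrt z Gamma(z)], used at [z] and at [z + 1/2]. *)

(** * Complex power series with a remainder bound, and the identity theorem *)

Fixpoint Csum (a : nat -> C) (n : nat) : C :=
  match n with O => 0%C | S n' => (Csum a n' + a n')%C end.

Lemma Csum_ext a b n : (forall k, (k < n)%nat -> a k = b k) -> Csum a n = Csum b n.
Proof.
  induction n as [|n IH]; intros H; simpl; [reflexivity|].
  rewrite IH by (intros; apply H; lia). rewrite H by lia. reflexivity.
Qed.

Lemma Csum_plus a b n : Csum (fun k => (a k + b k)%C) n = (Csum a n + Csum b n)%C.
Proof. induction n as [|n IH]; simpl; [|rewrite IH]; ring. Qed.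

Lemma Csum_scal l a n : Csum (fun k => (l * a k)%C) n = (l * Csum a n)%C.
Proof. induction n as [|n IH]; simpl; [|rewrite IH]; ring. Qed.

Lemma Csum_zero a n : (forall k, (k < n)%nat -> a k = RtoC 0) -> Csum a n = RtoC 0.
Proof.
  induction n as [|n IH]; intros H; simpl; [reflexivity|].
  rewrite IH by (intros; apply H; lia). rewrite H by lia. ring.
Qed.

Lemma Csum_first a n : Csum a (S n) = (a O + Csum (fun k => a (S k)) n)%C.
Proof.
  induction n as [|n IH]; [simpl; ring|].
  change (Csum a (S (S n))) with (Csum a (S n) + a (S n))%C. rewrite IH. simpl. ring.
Qed.

Lemma sum_n_Csum (a : nat -> C) n : @sum_n C_AbelianMonoid a n = Csum a (S n).
Proof.
  induction n as [|n IH].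
  - rewrite sum_O. simpl. ring.
  - rewrite sum_Sn, IH. reflexivity.
Qed.

Lemma pow_n_Cpow (w : C) k : @pow_n C_Ring w k = (w ^ k)%C.
Proof. induction k as [|k IH]; simpl; [reflexivity|]. rewrite IH. reflexivity. Qed.

Lemma scal_pow_n (w a : C) k :
  @scal C_AbsRing C_NormedModule (@pow_n C_AbsRing w k) a = (a * w ^ k)%C.
Proof.
  change (pow_n w k * a = a * w ^ k)%C. rewrite (pow_n_Cpow w k). ring.
Qed.

Lemma RtoC_m1 : RtoC (-1) = (- RtoC 1)%C.
Proof. apply injective_projections; simpl; ring. Qed.

Lemma Cmod_minus_sym (a b : C) : Cmod (a - b) = Cmod (b - a).
Proof. replace (b - a)%C with (- (a - b))%C by ring. now rewrite Cmod_opp. Qed.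

Lemma filterlim_Cmod {T} (F : (T -> Prop) -> Prop) {FF : Filter F} (f : T -> C) (l : C) :
  filterlim f F (locally l) <->
  (forall eps : R, 0 < eps -> F (fun t => Cmod (f t - l) < eps)).
Proof.
  split.
  - intros H eps He.
    apply (proj1 (filterlim_locally_ball_norm (K := C_AbsRing) (U := C_NormedModule) f l)) with (eps := mkposreal eps He) in H.
    exact H.
  - intros H. 
    apply (proj2 (filterlim_locally_ball_norm (K := C_AbsRing) (U := C_NormedModule) f l)).
    intros eps. apply H, eps.
Qed.

(** A power series expansion at [0] in remainder form, for all orders at once. Unlike
    convergence of the series, the inequality passes through integrals in a
    parameter and through sums without any interchange of limits; it is
    equivalent to analyticity by [expands_pseries] and [pseries_expands]. *)
Definition expands (r B : R) (c : nat -> C) (f : C -> C) : Prop :=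
  forall n w, Cmod w <= r ->
    Cmod (f w - Csum (fun k => c k * w ^ k) n)%C <= B * (Cmod w / r) ^ n.

Lemma expands_ext r B c c' f f' :
  (forall k, c k = c' k) -> (forall w, Cmod w <= r -> f w = f' w) ->
  expands r B c f -> expands r B c' f'.
Proof.
  intros Hc Hf H n w Hw. rewrite <- Hf by assumption.
  rewrite (Csum_ext _ (fun k => (c k * w ^ k)%C)) by (intros; now rewrite Hc).
  now apply H.
Qed.

Lemma expands_B_pos r B c f : 0 < r -> expands r B c f -> 0 <= B.
Proof.
  intros Hr H. specialize (H O (RtoC 0)). rewrite Cmod_0 in H.
  specialize (H (Rlt_le _ _ Hr)). simpl in H.
  pose proof (Cmod_ge_0 (f (RtoC 0) - 0)). lra.
Qed.

Lemma expands_shrink r r' B c f :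
  0 < r' <= r -> expands r B c f -> expands r' B c f.
Proof.
  intros Hr H n w Hw.
  assert (HB : 0 <= B) by (apply (expands_B_pos r B c f); [lra|assumption]).
  eapply Rle_trans; [apply H; lra|].
  apply Rmult_le_compat_l; [assumption|]. apply pow_incr.
  pose proof (Cmod_ge_0 w). split.
  - apply Rmult_le_pos; [assumption|]. left; apply Rinv_0_lt_compat; lra.
  - apply Rmult_le_compat_l; [assumption|]. apply Rinv_le_contravar; lra.
Qed.

Lemma expands_plus r B1 B2 c1 c2 f1 f2 :
  expands r B1 c1 f1 -> expands r B2 c2 f2 ->
  expands r (B1 + B2) (fun k => c1 k + c2 k)%C (fun w => f1 w + f2 w)%C.
Proof.
  intros H1 H2 n w Hw.
  rewrite (Csum_ext _ (fun k => c1 k * w ^ k + c2 k * w ^ k)%C) by (intros; ring).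
  rewrite Csum_plus.
  replace (_ - _)%C with ((f1 w - Csum (fun k => c1 k * w ^ k) n) +
     (f2 w - Csum (fun k => c2 k * w ^ k) n))%C by ring.
  eapply Rle_trans; [apply Cmod_triangle|].
  rewrite Rmult_plus_distr_r. apply Rplus_le_compat; auto.
Qed.

Lemma expands_scal r B l c f :
  expands r B c f -> expands r (Cmod l * B) (fun k => l * c k)%C (fun w => l * f w)%C.
Proof.
  intros H n w Hw.
  rewrite (Csum_ext _ (fun k => l * (c k * w ^ k))%C) by (intros; ring).
  rewrite Csum_scal.
  replace (_ - _)%C with (l * (f w - Csum (fun k => c k * w ^ k) n))%C by ring.
  rewrite Cmod_mult, Rmult_assoc. apply Rmult_le_compat_l; [apply Cmod_ge_0|]. auto.
Qed.

Lemma expands_minus r B1 B2 c1 c2 f1 f2 :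
  expands r B1 c1 f1 -> expands r B2 c2 f2 ->
  expands r (B1 + B2) (fun k => c1 k - c2 k)%C (fun w => f1 w - f2 w)%C.
Proof.
  intros H1 H2.
  apply expands_ext with (c := fun k => (c1 k + RtoC (-1) * c2 k)%C)
                         (f := fun w => (f1 w + RtoC (-1) * f2 w)%C).
  - intros k. apply injective_projections; simpl; ring.
  - intros w _. apply injective_projections; simpl; ring.
  - replace (B1 + B2) with (B1 + Cmod (RtoC (-1)) * B2).
    + apply expands_plus; [assumption|]. now apply expands_scal.
    + rewrite Cmod_R, Rabs_left by lra. ring.
Qed.

Definition shift_coef (c : nat -> C) (k : nat) : C :=
  match k with O => 0%C | S k' => c k' end.

(** The remainder of order [n+1] of [w f(w)] is [w] times the remainder of order [n]
    of [f]. *)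
Lemma expands_mulw r B c f : 0 < r ->
  expands r B c f -> expands r (r * B) (shift_coef c) (fun w => w * f w)%C.
Proof.
  intros Hr H [|n] w Hw.
  - specialize (H O w Hw). simpl in *.
    replace (w * f w - 0)%C with (w * (f w - 0))%C by ring.
    rewrite Cmod_mult. pose proof (Cmod_ge_0 w). pose proof (Cmod_ge_0 (f w - 0)).
    rewrite Rmult_1_r in *.
    now apply Rmult_le_compat.
  - rewrite Csum_first.
    rewrite (Csum_ext _ (fun k => w * (c k * w ^ k))%C) by (intros; simpl; ring).
    rewrite Csum_scal. unfold shift_coef at 1.
    replace (_ - _)%C with (w * (f w - Csum (fun k => c k * w ^ k) n))%C by ring.
    rewrite Cmod_mult. simpl.
    replace (r * B * (Cmod w / r * (Cmod w / r) ^ n)) with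
      (Cmod w * (B * (Cmod w / r) ^ n)) by (field; lra).
    apply Rmult_le_compat_l; [apply Cmod_ge_0|]. auto.
Qed.

(** [c n * w^n] is the difference of two consecutive remainders. *)
Lemma expands_coef r B c f n : 0 < r -> expands r B c f -> Cmod (c n) * r ^ n <= 2 * B.
Proof.
  intros Hr H.
  assert (E : Cmod (RtoC r) = r) by (rewrite Cmod_R; apply Rabs_pos_eq; lra).
  pose proof (H n (RtoC r)) as H1. pose proof (H (S n) (RtoC r)) as H2.
  rewrite E in H1, H2. specialize (H1 (Rle_refl _)). specialize (H2 (Rle_refl _)).
  rewrite Rdiv_diag in H1, H2 by lra. rewrite pow1 in H1, H2.
  rewrite <- E at 1. rewrite <- Cmod_pow, <- Cmod_mult.
  replace (c n * RtoC r ^ n)%C with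
   ((f (RtoC r) - Csum (fun k => c k * RtoC r ^ k) n) +
    - (f (RtoC r) - Csum (fun k => c k * RtoC r ^ k) (S n)))%C by (simpl; ring).
  eapply Rle_trans; [apply Cmod_triangle|]. rewrite Cmod_opp. lra.
Qed.

Lemma geom_small (q B eps : R) : 0 <= q < 1 -> 0 < eps -> 
  exists N, forall n, (N <= n)%nat -> B * q ^ n < eps.
Proof.
  intros Hq He.
  assert (L : is_lim_seq (fun n => B * q ^ n) 0).
  { replace (Finite 0) with (Rbar_mult B 0) by (simpl; f_equal; ring).
    apply is_lim_seq_scal_l. apply is_lim_seq_geom. rewrite Rabs_pos_eq; lra. }
  apply is_lim_seq_spec in L. destruct (L (mkposreal eps He)) as [N HN].
  exists N. intros n Hn. specialize (HN n Hn). simpl in HN.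
  apply Rabs_def2 in HN. lra.
Qed.

Lemma expands_pseries r B c f w : 0 < r -> expands r B c f -> Cmod w < r ->
  @is_pseries C_AbsRing C_NormedModule c w (f w).
Proof.
  intros Hr H Hw. unfold is_pseries, is_series.
  apply filterlim_Cmod; [apply eventually_filter|]. intros eps He.
  destruct (geom_small (Cmod w / r) B eps) as [N HN]; [|assumption|].
  { pose proof (Cmod_ge_0 w). split.
    - apply Rdiv_le_0_compat; lra.
    - apply Rlt_div_l; lra. }
  exists N. intros n Hn.
  rewrite sum_n_Csum, Cmod_minus_sym.
  rewrite (Csum_ext _ (fun k => c k * w ^ k)%C).
  2:{ intros k _. apply scal_pow_n. }
  eapply Rle_lt_trans; [apply H; lra|]. apply HN. lia.
Qed.

Lemma Csum_geom_bound (a : nat -> C) (M q : R) n m :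
  0 <= q <= 1/2 -> (forall k, Cmod (a k) <= M * q ^ k) ->
  Cmod (Csum a (n + m) - Csum a n)%C <= 2 * M * q ^ n * (1 - (1/2) ^ m).
Proof.
  intros Hq Ha.
  assert (HM : 0 <= M).
  { specialize (Ha O). simpl in Ha. pose proof (Cmod_ge_0 (a O)). lra. }
  induction m as [|m IH].
  - rewrite Nat.add_0_r. replace (_ - _)%C with (RtoC 0) by ring.
    rewrite Cmod_0. simpl. lra.
  - rewrite Nat.add_succ_r. simpl Csum.
    replace (_ - _)%C with ((Csum a (n + m) - Csum a n) + a (n + m)%nat)%C by ring.
    eapply Rle_trans; [apply Cmod_triangle|].
    assert (Cmod (a (n + m)%nat) <= M * q ^ n * (1/2) ^ m).
    { eapply Rle_trans; [apply Ha|]. rewrite pow_add, Rmult_assoc.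
      apply Rmult_le_compat_l; [assumption|].
      apply Rmult_le_compat_l; [apply pow_le; lra|]. apply pow_incr; lra. }
    simpl. lra.
Qed.

(** Convergence at the radius [rho/2] bounds the terms there, and at half that radius
    the remainders are dominated by geometric series of ratio at most [1/2]. *)
Lemma pseries_expands (f : C -> C) (c : nat -> C) (rho : R) : 0 < rho ->
  (forall w, Cmod w < rho -> @is_pseries C_AbsRing C_NormedModule c w (f w)) ->
  exists r B, 0 < r /\ expands r B c f.
Proof.
  intros Hrho H.
  set (r0 := rho / 2). assert (Hr0 : 0 < r0) by (unfold r0; lra).
  assert (E : Cmod (RtoC r0) = r0) by (rewrite Cmod_R; apply Rabs_pos_eq; lra).
  assert (H0 := H (RtoC r0)). rewrite E in H0. specialize (H0 ltac:(unfold r0; lra)).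
  (* the terms at radius r0 are bounded, being differences of bounded partial sums *)
  assert (HM : exists M, forall k, Cmod (c k) * r0 ^ k <= M).
  { destruct (filterlim_bounded (K := C_AbsRing) (V := C_NormedModule) _
       (ex_intro _ _ H0)) as [M HM].
    exists (2 * M). intros k.
    rewrite <- E at 1. rewrite <- Cmod_pow, <- Cmod_mult.
    assert (P : forall n, Cmod (Csum (fun k => (c k * RtoC r0 ^ k)%C) n) <= M).
    { intros [|n].
      - simpl. rewrite Cmod_0. eapply Rle_trans; [|apply (HM O)]. apply norm_ge_0.
      - specialize (HM n). change (Cmod (@sum_n C_AbelianMonoid (fun k => @scal C_AbsRing C_NormedModule (@pow_n C_Ring (RtoC r0) k) (c k)) n) <= M) in HM.
        rewrite sum_n_Csum in HM.
        erewrite Csum_ext; [exact HM|].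
        intros j _. symmetry. apply scal_pow_n. }
    pose proof (P k) as P1. pose proof (P (S k)) as P2. simpl in P2.
    replace (c k * RtoC r0 ^ k)%C with
      ((Csum (fun k => c k * RtoC r0 ^ k) k + c k * RtoC r0 ^ k) + - Csum (fun k => c k * RtoC r0 ^ k) k)%C by ring.
    eapply Rle_trans; [apply Cmod_triangle|]. rewrite Cmod_opp. lra. }
  destruct HM as [M HM].
  assert (HM0 : 0 <= M).
  { specialize (HM O). pose proof (Cmod_ge_0 (c O)). simpl in HM. lra. }
  exists (r0 / 2), (2 * M). split; [lra|].
  intros n w Hw.
  assert (Hw0 := Cmod_ge_0 w).
  set (q := Cmod w / r0).
  assert (Hq : 0 <= q <= 1/2).
  { unfold q. split; [apply Rdiv_le_0_compat; lra|]. apply Rle_div_l; lra. }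
  assert (Hterm : forall k, Cmod (c k * w ^ k)%C <= M * q ^ k).
  { intros k. rewrite Cmod_mult, Cmod_pow. unfold q, Rdiv. rewrite Rpow_mult_distr.
    rewrite pow_inv.
    assert (0 < r0 ^ k) by (apply pow_lt; lra).
    replace (M * (Cmod w ^ k * / r0 ^ k)) with ((M * / r0 ^ k) * Cmod w ^ k) by ring.
    apply Rmult_le_compat_r; [apply pow_le; lra|].
    apply Rle_div_r; [lra|]. apply HM. }
  assert (Hfin : Cmod (f w - Csum (fun k => c k * w ^ k) n)%C <= 2 * M * q ^ n).
  { apply le_epsilon. intros eps He.
    assert (Hs := H w ltac:(unfold r0 in *; lra)).
    unfold is_pseries, is_series in Hs.
    apply (proj1 (filterlim_Cmod _ _ _)) with (eps := eps) in Hs; [|assumption].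
    destruct Hs as [N HN]. specialize (HN (n + N)%nat ltac:(lia)).
    rewrite sum_n_Csum in HN.
    rewrite (Csum_ext _ (fun k => c k * w ^ k)%C) in HN.
    2:{ intros k _. apply scal_pow_n. }
    replace (S (n + N)) with (n + S N)%nat in HN by lia.
    replace (_ - _)%C with
     (- (Csum (fun k => c k * w ^ k) (n + S N) - f w) +
      (Csum (fun k => c k * w ^ k) (n + S N) - Csum (fun k => c k * w ^ k) n))%C by ring.
    eapply Rle_trans; [apply Cmod_triangle|]. rewrite Cmod_opp.
    pose proof (Csum_geom_bound _ M q n (S N) Hq Hterm) as HB.
    assert (0 <= 2 * M * q ^ n) by (apply Rmult_le_pos; [lra|]; apply pow_le; lra).
    assert (0 <= (1/2) ^ S N) by (apply pow_le; lra).
    nra. }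
  eapply Rle_trans; [exact Hfin|].
  apply Rmult_le_compat_l; [lra|]. apply pow_incr. split; [lra|].
  unfold q. apply Rmult_le_compat_l; [lra|]. apply Rinv_le_contravar; lra.
Qed.

(** The geometric series at the point [s]. *)
Lemma expands_inv (s : C) : s <> RtoC 0 ->
  expands (Cmod s / 2) (2 / Cmod s) (fun k => (RtoC (-1)) ^ k / s ^ S k)%C (fun w => / (s + w))%C.
Proof.
  intros Hs n w Hw.
  assert (Hp : 0 < Cmod s) by now apply Cmod_gt_0.
  assert (Hw0 := Cmod_ge_0 w).
  assert (Hsw : Cmod s / 2 <= Cmod (s + w)%C).
  { pose proof (Cmod_triangle (s + w) (- w)) as T. rewrite Cmod_opp in T.
    replace (s + w + - w)%C with s in T by ring. lra. }
  assert (Hnz : (s + w)%C <> RtoC 0) by (apply Cmod_gt_0; lra).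
  assert (Heq : (/ (s + w) - Csum (fun k => (RtoC (-1)) ^ k / s ^ S k * w ^ k) n)%C =
     ((RtoC (-1) * w / s) ^ n / (s + w))%C).
  { induction n as [|n IH].
    - simpl. field. exact Hnz.
    - simpl Csum. 
      replace (/ (s + w) - _)%C with 
       ((/ (s + w) - Csum (fun k => (RtoC (-1)) ^ k / s ^ S k * w ^ k) n) - (RtoC (-1)) ^ n / s ^ S n * w ^ n)%C by (simpl; ring).
      rewrite IH. unfold Cdiv. rewrite Cpow_S, !Cpow_mult_l, !Cpow_inv by assumption.
      simpl. rewrite RtoC_m1. field. repeat split; try assumption. now apply Cpow_nz. }
  rewrite Heq, Cmod_div, Cmod_pow, Cmod_div, Cmod_mult by assumption.
  rewrite Cmod_R, Rabs_left by lra.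
  replace (- -1 * Cmod w / Cmod s) with (Cmod w / Cmod s) by (field; lra).
  unfold Rdiv at 1. rewrite Rmult_comm.
  apply Rmult_le_compat.
  - left. apply Rinv_0_lt_compat. lra.
  - apply pow_le. apply Rdiv_le_0_compat; lra.
  - replace (2 / Cmod s) with (/ (Cmod s / 2)) by (field; lra).
    apply Rinv_le_contravar; lra.
  - apply pow_incr. split; [apply Rdiv_le_0_compat; lra|].
    apply Rmult_le_compat_l; [lra|]. apply Rinv_le_contravar; lra.
Qed.

(** If the first [n] coefficients vanish, the remainder inequality of order [n+1] at
    the zeros [w] gives [|c n| = O(|w|)]. *)
Lemma identity_local r B c f : 0 < r -> expands r B c f ->
  (forall eps, 0 < eps -> exists w, 0 < Cmod w < eps /\ f w = RtoC 0) ->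
  (forall k, c k = RtoC 0) /\ (forall w, Cmod w < r -> f w = RtoC 0).
Proof.
  intros Hr H Hz.
  assert (HB := expands_B_pos _ _ _ _ Hr H).
  assert (Hc : forall n k, (k < n)%nat -> c k = RtoC 0).
  { induction n as [|n IH]; [lia|]. intros k Hk.
    destruct (Nat.lt_ge_cases k n) as [|Hkn]; [auto|].
    assert (k = n) by lia. subst k.
    apply Cmod_eq_0. apply Rle_antisym; [|apply Cmod_ge_0].
    apply le_epsilon. intros eps He.
    set (K := B / r ^ S n).
    assert (HK : 0 <= K) by (apply Rdiv_le_0_compat; [assumption|apply pow_lt; lra]).
    destruct (Hz (Rmin r (eps / (K + 1)))) as [w [[Hw1 Hw2] Hfw]].
    { apply Rmin_pos; [assumption|]. apply Rdiv_lt_0_compat; lra. }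
    assert (Hwr := Rlt_le_trans _ _ _ Hw2 (Rmin_l _ _)).
    assert (Hwe := Rlt_le_trans _ _ _ Hw2 (Rmin_r _ _)).
    pose proof (H (S n) w ltac:(lra)) as HH. rewrite Hfw in HH. simpl Csum in HH.
    rewrite Csum_zero in HH by (intros j Hj; rewrite IH by assumption; ring).
    replace (0 - (0 + c n * w ^ n))%C with (- (c n * w ^ n))%C in HH by ring.
    rewrite Cmod_opp, Cmod_mult, Cmod_pow in HH.
    unfold Rdiv in HH. rewrite Rpow_mult_distr in HH.
    replace (B * (Cmod w ^ S n * (/ r) ^ S n)) with (K * Cmod w * Cmod w ^ n) in HH.
    2:{ unfold K, Rdiv. rewrite pow_inv. simpl. ring. }
    apply Rmult_le_reg_r in HH; [|apply pow_lt; lra].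
    apply Rlt_div_r in Hwe; [|lra]. nra. }
  assert (Hc' : forall k, c k = RtoC 0) by (intros k; apply (Hc (S k)); lia).
  split; [assumption|]. intros w Hw.
  apply Cmod_eq_0. apply Rle_antisym; [|apply Cmod_ge_0].
  apply le_epsilon. intros eps He.
  destruct (geom_small (Cmod w / r) B eps) as [N HN]; [|assumption|].
  { pose proof (Cmod_ge_0 w). split; [apply Rdiv_le_0_compat; lra|]. apply Rlt_div_l; lra. }
  pose proof (H N w ltac:(lra)) as HH.
  rewrite Csum_zero in HH by (intros; rewrite Hc'; ring).
  replace (f w - 0)%C with (f w) in HH by ring. specialize (HN N (Nat.le_refl _)). lra.
Qed.

Definition analytic_pt (h : C -> C) (s : C) : Prop :=
  exists r B c, 0 < r /\ expands r B c (fun w => h (s + w)%C).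

(** At the supremum of the points where [h] does not vanish, the zeros to the right
    accumulate, so [h] vanishes on a disc around it. *)
Lemma identity_line (h : C -> C) (y t0 T : R) :
  (forall t, t0 < t -> analytic_pt h (t, y)) ->
  (forall t, T < t -> h (t, y) = RtoC 0) ->
  forall t, t0 < t -> h (t, y) = RtoC 0.
Proof.
  intros Han HT t Ht. apply NNPP. intros Hne.
  destruct (completeness (fun tau => t <= tau /\ h (tau, y) <> RtoC 0)) as [m [Hub Hlub]].
  { exists T. intros tau [_ Htau]. apply Rnot_lt_le. intros Hlt. apply Htau, HT, Hlt. }
  { exists t. split; [lra|assumption]. }
  assert (Htm : t <= m) by (apply Hub; split; [lra|assumption]).
  assert (Habove : forall tau, m < tau -> h (tau, y) = RtoC 0).
  { intros tau Htau. apply NNPP. intros Hn.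
    assert (tau <= m) by (apply Hub; split; [lra|assumption]). lra. }
  destruct (Han m ltac:(lra)) as [r [B [c [Hr Hexp]]]].
  destruct (identity_local r B c _ Hr Hexp) as [_ Hball].
  { intros eps He. exists (RtoC (eps / 2)).
    rewrite Cmod_R, Rabs_pos_eq by lra. split; [lra|].
    replace ((m, y) + RtoC (eps / 2))%C with (m + eps / 2, y)
      by (apply injective_projections; simpl; ring).
    apply Habove. lra. }
  assert (m <= m - r / 2); [|lra].
  apply Hlub. intros tau [_ Htau]. apply Rnot_lt_le. intros Hlt.
  apply Htau. destruct (Rlt_or_le m tau) as [|Hle]; [auto|].
  replace (tau, y) with ((m, y) + RtoC (tau - m))%C
    by (apply injective_projections; simpl; ring).
  apply Hball. rewrite Cmod_R. apply Rabs_def1; lra.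
Qed.

(** The zeros accumulate at the point along the vertical line through it, which on
    the real axis stays away from the pole. *)
Lemma identity_punctured (h : C -> C) (y t : R) :
  analytic_pt h (t, y) -> (forall y', y' <> y -> h (t, y') = RtoC 0) -> h (t, y) = RtoC 0.
Proof.
  intros [r [B [c [Hr Hexp]]]] H0.
  destruct (identity_local r B c _ Hr Hexp) as [_ Hball].
  { intros eps He. exists (0, eps / 2).
    assert (E : Cmod (0, eps / 2) = eps / 2).
    { unfold Cmod. simpl fst; simpl snd. replace (0 ^ 2 + (eps / 2) ^ 2) with ((eps / 2) ^ 2) by ring.
      apply sqrt_pow2. lra. }
    rewrite E. split; [lra|].
    replace ((t, y) + (0%R, (eps / 2)%R))%C with (t, y + eps / 2)
      by (apply injective_projections; simpl; ring).
    apply H0. lra. }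
  specialize (Hball (RtoC 0)). rewrite Cmod_0 in Hball. specialize (Hball Hr).
  replace ((t, y) + RtoC 0)%C with (t, y) in Hball by (apply injective_projections; simpl; ring).
  exact Hball.
Qed.

(** * The complex exponential and the Taylor coefficients of a power in its exponent *)

Lemma Cexp_plus a b : Cexp (a + b)%C = (Cexp a * Cexp b)%C.
Proof.
  unfold Cexp. destruct a as [a1 a2], b as [b1 b2].
  unfold Re, Im, Cplus, Cmult; simpl. rewrite exp_plus, cos_plus, sin_plus.
  f_equal; ring.
Qed.

Lemma Cmod_Cexp z : Cmod (Cexp z) = exp (Re z).
Proof.
  unfold Cexp, Cmod. simpl fst; simpl snd.
  replace ((exp (Re z) * cos (Im z)) ^ 2 + (exp (Re z) * sin (Im z)) ^ 2)
    with (exp (Re z) ^ 2 * (Rsqr (sin (Im z)) + Rsqr (cos (Im z)))) by (unfold Rsqr; ring).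
  rewrite sin2_cos2, Rmult_1_r. apply sqrt_pow2. left; apply exp_pos.
Qed.

Lemma Cexp_R (t : R) : Cexp (RtoC t) = RtoC (exp t).
Proof.
  unfold Cexp. simpl. rewrite cos_0, sin_0. apply injective_projections; simpl; ring.
Qed.

Lemma is_derive_Rminus (f g : R -> R) x a b :
  is_derive f x a -> is_derive g x b -> is_derive (fun t => f t - g t) x (a - b).
Proof. exact (is_derive_minus f g x a b). Qed.

Lemma is_derive_Rplus (f g : R -> R) x a b :
  is_derive f x a -> is_derive g x b -> is_derive (fun t => f t + g t) x (a + b).
Proof. exact (is_derive_plus f g x a b). Qed.

Lemma is_derive_continuity_pt f t l : is_derive f t l -> continuity_pt f t.
Proof.
  intros H. apply derivable_continuous_pt, ex_derive_Reals_0. now exists l.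
Qed.

Lemma is_derive_Rext (f g : R -> R) t l :
  (forall u, f u = g u) -> is_derive f t l -> is_derive g t l.
Proof. exact (is_derive_ext f g t l). Qed.

(** Differentiability of a curve in the plane, by coordinates. *)
Definition cderiv (F : R -> C) (t : R) (l : C) : Prop :=
  is_derive (fun u => Re (F u)) t (Re l) /\ is_derive (fun u => Im (F u)) t (Im l).

Lemma cderiv_plus F G t l m : cderiv F t l -> cderiv G t m ->
  cderiv (fun u => F u + G u)%C t (l + m)%C.
Proof.
  intros [H1 H2] [H3 H4]. split.
  - exact (is_derive_plus _ _ _ _ _ H1 H3).
  - exact (is_derive_plus _ _ _ _ _ H2 H4).
Qed.

Lemma cderiv_scal (z : C) F t l : cderiv F t l -> cderiv (fun u => z * F u)%C t (z * l)%C.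
Proof.
  intros [H1 H2]. split.
  - exact (is_derive_minus _ _ _ _ _ (is_derive_scal _ t (Re z) _ H1) (is_derive_scal _ t (Im z) _ H2)).
  - exact (is_derive_plus _ _ _ _ _ (is_derive_scal _ t (Re z) _ H2) (is_derive_scal _ t (Im z) _ H1)).
Qed.

Lemma cderiv_RtoC f t l : is_derive f t l -> cderiv (fun u => RtoC (f u)) t (RtoC l).
Proof. intros H. split; simpl; [exact H|]. exact (is_derive_const (V := R_NormedModule) 0 t). Qed.

Lemma cderiv_ext F G t l : (forall u, F u = G u) -> cderiv F t l -> cderiv G t l.
Proof.
  intros E [H1 H2]. split; eapply is_derive_ext; try eassumption;
  intros u; cbv beta; now rewrite E.
Qed.

Lemma cderiv_Cexp (f : R -> R) (z : C) t l : is_derive f t l ->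
  cderiv (fun u => Cexp (RtoC (f u) * z)) t (RtoC l * z * Cexp (RtoC (f t) * z))%C.
Proof.
  intros H. unfold Cexp, cderiv. destruct z as [p q]. simpl.
  assert (E : ex_derive f t) by (now exists l).
  apply is_derive_unique in H.
  split; auto_derive; auto;
  change (fun x => f x) with f; rewrite H; unfold Rminus; ring.
Qed.

(** The mean value inequality for a curve in the plane, obtained from the real mean
    value theorem for the component of the curve along its endpoint. *)
Lemma cderiv_bound (F F' : R -> C) (g g' : R -> R) (T : R) : 0 <= T ->
  (forall t, 0 <= t <= T -> cderiv F t (F' t)) ->
  (forall t, 0 <= t <= T -> is_derive g t (g' t)) ->
  (forall t, 0 <= t <= T -> Cmod (F' t) <= g' t) ->
  F 0 = RtoC 0 -> Cmod (F T) <= g T - g 0.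
Proof.
  intros HT HF Hg Hle H0.
  set (z := F T).
  destruct (MVT_gen (fun t => Cmod z * g t - (Re z * Re (F t) + Im z * Im (F t))) 0 T
    (fun t => Cmod z * g' t - (Re z * Re (F' t) + Im z * Im (F' t)))) as [c [Hc Heq]].
  - intros t Ht. rewrite Rmin_left, Rmax_right in Ht by lra.
    destruct (HF t ltac:(lra)) as [D1 D2]. pose proof (Hg t ltac:(lra)) as D3.
    apply is_derive_Rminus.
    + exact (is_derive_scal _ t _ _ D3).
    + apply is_derive_Rplus; apply is_derive_scal; eassumption.
  - intros t Ht. rewrite Rmin_left, Rmax_right in Ht by lra.
    destruct (HF t ltac:(lra)) as [D1 D2]. pose proof (Hg t ltac:(lra)) as D3.
    eapply is_derive_continuity_pt. apply is_derive_Rminus.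
    + exact (is_derive_scal _ t _ _ D3).
    + apply is_derive_Rplus; apply is_derive_scal; eassumption.
  - rewrite Rmin_left, Rmax_right in Hc by lra.
    cbv beta in Heq. rewrite H0 in Heq. fold z in Heq. simpl in Heq.
    pose proof (Cmod2_alt z) as Hz2.
    assert (Hz := Cmod_ge_0 z).
    assert (CS : Re z * Re (F' c) + Im z * Im (F' c) <= Cmod z * Cmod (F' c)).
    { rewrite <- (Cmod_conj z), <- Cmod_mult.
      eapply Rle_trans; [|apply re_le_Cmod]. eapply Rle_trans; [|apply Rle_abs].
      right. destruct z, (F' c). unfold Cconj, Re, Im; simpl. ring. }
    pose proof (Hle c Hc) as Hlc.
    assert (Cmod z * Cmod (F' c) <= Cmod z * g' c) by (apply Rmult_le_compat_l; lra).
    assert (0 <= (Cmod z * g' c - (Re z * Re (F' c) + Im z * Im (F' c))) * (T - 0)).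
    { apply Rmult_le_pos; lra. }
    rewrite <- Heq in H1.
    assert (Cmod z * Cmod z <= Cmod z * (g T - g 0)) by nra.
    destruct Hz as [Hz|Hz].
    + apply Rmult_le_reg_l with (Cmod z); lra.
    + rewrite <- Hz.
      assert (Hgm : g 0 <= g T); [|lra].
      destruct (MVT_gen g 0 T g') as [d [Hd Ed]].
      * intros t Ht. rewrite Rmin_left, Rmax_right in Ht by lra. apply Hg; lra.
      * intros t Ht. rewrite Rmin_left, Rmax_right in Ht by lra.
        eapply is_derive_continuity_pt. apply Hg; lra.
      * rewrite Rmin_left, Rmax_right in Hd by lra.
        assert (0 <= g' d) by (eapply Rle_trans; [apply Cmod_ge_0|apply Hle; lra]).
        assert (0 <= g' d * (T - 0)) by (apply Rmult_le_pos; lra). lra.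
Qed.

Lemma is_derive_pow_fact n t :
  is_derive (fun u => u ^ S n / INR (fact (S n))) t (t ^ n / INR (fact n)).
Proof.
  assert (E : INR (fact (S n)) = INR (S n) * INR (fact n)) by (rewrite fact_simpl, mult_INR; ring).
  rewrite E. set (d := INR (fact n)). assert (Hd : d <> 0) by apply INR_fact_neq_0.
  assert (Hn : INR (S n) <> 0) by (apply not_0_INR; lia).
  set (m := INR (S n)) in *.
  apply is_derive_Rext with (fun u => / (m * d) * u ^ S n); [intros; field; auto|].
  replace (t ^ n / d) with (/ (m * d) * (m * 1 * t ^ n)) by (field; auto).
  apply is_derive_scal. 
  exact (is_derive_pow (fun u => u) (S n) t 1 (is_derive_id (t : R_AbsRing))).
Qed.

Lemma cderiv_Csum (F F' : nat -> R -> C) t n :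
  (forall k, cderiv (F k) t (F' k t)) ->
  cderiv (fun u => Csum (fun k => F k u) n) t (Csum (fun k => F' k t) n).
Proof.
  intros H. induction n as [|n IH]; simpl.
  - apply (cderiv_RtoC (fun _ => 0)). exact (is_derive_const (V := R_NormedModule) 0 t).
  - apply cderiv_plus; auto.
Qed.

(** By induction on [n]: the derivative in [t] of the remainder of order [n+1] is
    [z] times the remainder of order [n]. *)
Lemma Cexp_taylor (z : C) n t : 0 <= t <= 1 ->
  Cmod (Cexp (RtoC t * z) - Csum (fun k => RtoC (t ^ k / INR (fact k)) * z ^ k) n)%C
   <= t ^ n / INR (fact n) * (Cmod z ^ n * exp (Cmod z)).
Proof.
  revert t. induction n as [|n IH]; intros t Ht.
  - simpl. replace (Cexp (RtoC t * z) - 0)%C with (Cexp (RtoC t * z)) by ring.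
    rewrite Cmod_Cexp. rewrite Rdiv_diag, !Rmult_1_l by lra.
    assert (Re (RtoC t * z) <= Cmod z).
    { replace (Re (RtoC t * z)) with (t * Re z) by (destruct z; simpl; ring).
      pose proof (re_le_Cmod z). pose proof (Rle_abs (Re z)). pose proof (Cmod_ge_0 z). nra. }
    destruct (Req_dec (Re (RtoC t * z)) (Cmod z)) as [->|]; [lra|].
    left. apply exp_increasing. lra.
  - set (F := fun t => (Cexp (RtoC t * z) - Csum (fun k => RtoC (t ^ k / INR (fact k)) * z ^ k) (S n))%C).
    set (F' := fun t => (z * (Cexp (RtoC t * z) - Csum (fun k => RtoC (t ^ k / INR (fact k)) * z ^ k) n))%C).
    set (K := Cmod z ^ S n * exp (Cmod z)).
    set (g := fun t => K * (t ^ S n / INR (fact (S n)))).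
    set (g' := fun t => K * (t ^ n / INR (fact n))).
    assert (HH : Cmod (F t) <= g t - g 0).
    { apply (cderiv_bound F F' g g'); [lra| | | |].
      - intros u Hu. unfold F, F'.
        apply cderiv_ext with (fun u => Cexp (RtoC u * z) + RtoC (-1) * (RtoC 1 + Csum (fun k => RtoC (u ^ S k / INR (fact (S k))) * z ^ S k) n))%C.
        { intros v. rewrite (Csum_first _ n).
          replace (RtoC (v ^ 0 / INR (fact 0)) * z ^ 0)%C with (RtoC 1).
          2:{ apply injective_projections; simpl; field. }
          rewrite RtoC_m1.
          ring. }
        replace (z * _)%C with (RtoC 1 * z * Cexp (RtoC u * z) + RtoC (-1) * (RtoC 0 + Csum (fun k => RtoC (u ^ k / INR (fact k)) * z ^ S k) n))%C.
        2:{ rewrite (Csum_ext (fun k => RtoC (u ^ k / INR (fact k)) * z ^ S k)%C (fun k => z * (RtoC (u ^ k / INR (fact k)) * z ^ k))%C) by (intros; simpl; ring).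
            rewrite Csum_scal.
            rewrite RtoC_m1.
            ring. }
        apply cderiv_plus.
        + apply (cderiv_Cexp (fun u => u)). exact (is_derive_id (u : R_AbsRing)).
        + apply cderiv_scal, cderiv_plus.
          * apply (cderiv_RtoC (fun _ => 1)). exact (is_derive_const (V := R_NormedModule) 1 u).
          * apply (cderiv_Csum (fun k u => RtoC (u ^ S k / INR (fact (S k))) * z ^ S k)%C (fun k u => RtoC (u ^ k / INR (fact k)) * z ^ S k)%C).
            intros k.
            apply cderiv_ext with (fun u => z ^ S k * RtoC (u ^ S k / INR (fact (S k))))%C; [intros; ring|].
            rewrite (Cmult_comm _ (z ^ S k)%C).
            apply cderiv_scal. apply (cderiv_RtoC (fun u => u ^ S k / INR (fact (S k)))).
            apply is_derive_pow_fact.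
      - intros u Hu. apply is_derive_scal, is_derive_pow_fact.
      - intros u Hu. unfold F', g', K. rewrite Cmod_mult. specialize (IH u ltac:(lra)).
        simpl. replace (Cmod z * Cmod z ^ n * exp (Cmod z) * (u ^ n / INR (fact n))) with
          (Cmod z * (u ^ n / INR (fact n) * (Cmod z ^ n * exp (Cmod z)))) by ring.
        apply Rmult_le_compat_l; [apply Cmod_ge_0|exact IH].
      - unfold F. rewrite Csum_first.
        rewrite Csum_zero.
        2:{ intros k _. apply injective_projections; simpl; unfold Rdiv; ring. }
        replace (RtoC 0 * z)%C with (RtoC 0) by ring. rewrite Cexp_R, exp_0.
        apply injective_projections; simpl; field. }
    unfold F in HH. eapply Rle_trans; [exact HH|]. unfold g. right.
    rewrite pow_i by lia. unfold K, Rdiv. ring.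
Qed.

Lemma pow_fact_le_exp x n : 0 <= x -> x ^ n / INR (fact n) <= exp x.
Proof.
  intros Hx. pose proof (exp_ge_taylor x n Hx) as H.
  assert (P : forall m, 0 <= x ^ m / INR (fact m)).
  { intros m. apply Rdiv_le_0_compat; [now apply pow_le|apply INR_fact_lt_0]. }
  destruct n as [|n]; [exact H|]. rewrite tech5 in H.
  assert (0 <= sum_f_R0 (fun k => x ^ k / INR (fact k)) n) by (apply cond_pos_sum; exact P).
  lra.
Qed.

(** The Taylor coefficient of order [k] of [w |-> y^(-(s+w))] at [w = 0]. *)
Definition pow_coef (k : nat) (s : C) (y : R) : C :=
  (RCpow y (- s) * RtoC ((- ln y) ^ k / INR (fact k)))%C.

Lemma pow_coef_0 s y : pow_coef 0 s y = RCpow y (- s)%C.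
Proof.
  unfold pow_coef. simpl. replace (RtoC (1 / 1)) with (RtoC 1) by (f_equal; field). ring.
Qed.

Lemma Cmod_RCpow y s : Cmod (RCpow y s) = exp (Re s * ln y).
Proof.
  unfold RCpow. rewrite Cmod_Cexp. f_equal. destruct s; simpl; ring.
Qed.

(** The Taylor remainder of [exp(- w ln y)], with [(r |ln y|)^n / n!] absorbed in
    [exp(r |ln y|)]. *)
Lemma pow_coef_expands r s y : 0 < r ->
  expands r (exp (- Re s * ln y + 2 * r * Rabs (ln y))) (fun k => pow_coef k s y)
    (fun w => pow_coef 0 (s + w)%C y).
Proof.
  intros Hr n w Hw.
  set (L := - ln y). set (z := (RtoC L * w)%C).
  assert (Hf : pow_coef 0 (s + w)%C y = (RCpow y (- s) * Cexp (RtoC 1 * z))%C).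
  { rewrite pow_coef_0. unfold RCpow. rewrite <- Cexp_plus. f_equal. unfold z, L.
    rewrite RtoC_opp. ring. }
  assert (Hs : Csum (fun k => pow_coef k s y * w ^ k)%C n =
    (RCpow y (- s) * Csum (fun k => RtoC (1 ^ k / INR (fact k)) * z ^ k) n)%C).
  { rewrite <- Csum_scal. apply Csum_ext. intros k _. unfold pow_coef, z.
    rewrite Cpow_mult_l, <- RtoC_pow. fold L. rewrite pow1.
    replace (RtoC (L ^ k / INR (fact k))) with (RtoC (1 / INR (fact k)) * RtoC (L ^ k))%C.
    - ring.
    - rewrite <- RtoC_mult. f_equal. field. apply INR_fact_neq_0. }
  rewrite Hf, Hs.
  replace (_ - _)%C with (RCpow y (- s) * (Cexp (RtoC 1 * z) - Csum (fun k => RtoC (1 ^ k / INR (fact k)) * z ^ k) n))%C by ring.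
  rewrite Cmod_mult, Cmod_RCpow.
  replace (Re (- s)) with (- Re s) by (destruct s; reflexivity).
  rewrite exp_plus, Rmult_assoc.
  apply Rmult_le_compat_l; [left; apply exp_pos|].
  eapply Rle_trans; [apply Cexp_taylor; lra|].
  assert (Hz : Cmod z = Rabs (ln y) * Cmod w).
  { unfold z. rewrite Cmod_mult, Cmod_R. unfold L. now rewrite Rabs_Ropp. }
  assert (Hw0 := Cmod_ge_0 w). assert (HL := Rabs_pos (ln y)).
  set (A := Rabs (ln y)) in *.
  rewrite pow1, Hz.
  replace (1 / INR (fact n) * ((A * Cmod w) ^ n * exp (A * Cmod w))) with
   ((r * A) ^ n / INR (fact n) * exp (A * Cmod w) * (Cmod w / r) ^ n).
  2:{ replace (A * Cmod w) with ((r * A) * (Cmod w / r)) by (field; lra).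
      rewrite !Rpow_mult_distr. field. apply INR_fact_neq_0. }
  apply Rmult_le_compat_r; [apply pow_le, Rdiv_le_0_compat; lra|].
  replace (2 * r * A) with (r * A + r * A) by ring. rewrite exp_plus.
  apply Rmult_le_compat.
  - apply Rdiv_le_0_compat; [apply pow_le; nra|apply INR_fact_lt_0].
  - left; apply exp_pos.
  - apply pow_fact_le_exp. nra.
  - destruct (Rle_lt_or_eq_dec (A * Cmod w) (r * A) ltac:(nra)) as [H| ->]; [|lra].
    left. now apply exp_increasing.
Qed.

Lemma cderiv_RCpow s y : 0 < y -> cderiv (fun t => RCpow t s) y (s * RCpow y (s - 1))%C.
Proof.
  intros Hy. unfold RCpow.
  apply cderiv_ext with (fun t => Cexp (RtoC (ln t) * s)); [intros; f_equal; ring|].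
  replace (s * Cexp ((s - 1) * RtoC (ln y)))%C with (RtoC (/ y) * s * Cexp (RtoC (ln y) * s))%C.
  - apply cderiv_Cexp. auto_derive; [assumption|]. field. lra.
  - replace ((s - 1) * RtoC (ln y))%C with (RtoC (ln y) * s + RtoC (- ln y))%C
      by (rewrite RtoC_opp; ring).
    rewrite Cexp_plus, Cexp_R, exp_Ropp, exp_ln by assumption. ring.
Qed.

Definition ccont (F : R -> C) (t : R) : Prop :=
  continuous (fun u => Re (F u)) t /\ continuous (fun u => Im (F u)) t.

Lemma cderiv_ccont F t l : cderiv F t l -> ccont F t.
Proof.
  intros [H1 H2]. split; apply (ex_derive_continuous (V := R_NormedModule)); eexists; eassumption.
Qed.

Lemma ccont_ext F G t : (forall u, F u = G u) -> ccont F t -> ccont G t.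
Proof.
  intros E [H1 H2]. split.
  - refine (continuous_ext _ _ t _ H1). intros u; cbv beta; now rewrite E.
  - refine (continuous_ext _ _ t _ H2). intros u; cbv beta; now rewrite E.
Qed.

Lemma ccont_plus F G t : ccont F t -> ccont G t -> ccont (fun u => F u + G u)%C t.
Proof.
  intros [H1 H2] [H3 H4]. split.
  - exact (continuous_plus (V := R_NormedModule) _ _ t H1 H3).
  - exact (continuous_plus (V := R_NormedModule) _ _ t H2 H4).
Qed.

Lemma ccont_RtoC f t : continuous f t -> ccont (fun u => RtoC (f u)) t.
Proof. intros H. split; simpl; [exact H|apply continuous_const]. Qed.

Lemma ccont_const (z : C) t : ccont (fun _ => z) t.
Proof. split; apply continuous_const. Qed.

Lemma ccont_mult F G t : ccont F t -> ccont G t -> ccont (fun u => F u * G u)%C t.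
Proof.
  intros [H1 H2] [H3 H4]. split.
  - exact (continuous_minus (V := R_NormedModule) _ _ t (continuous_mult _ _ t H1 H3) (continuous_mult _ _ t H2 H4)).
  - exact (continuous_plus (V := R_NormedModule) _ _ t (continuous_mult _ _ t H1 H4) (continuous_mult _ _ t H2 H3)).
Qed.

Lemma ccont_shift F c t : ccont F (c + t) -> ccont (fun u => F (c + u)) t.
Proof.
  intros [H1 H2].
  assert (Hc : continuous (fun u => c + u) t).
  { exact (continuous_plus (V := R_NormedModule) _ _ t (continuous_const c t) (continuous_id t)). }
  split; [exact (continuous_comp _ _ t Hc H1)|exact (continuous_comp _ _ t Hc H2)].
Qed.

Lemma ccont_Csum (F : nat -> R -> C) n t :
  (forall k, ccont (F k) t) -> ccont (fun u => Csum (fun k => F k u) n) t.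
Proof.
  intros H. induction n as [|n IH]; simpl; [apply ccont_const|]. now apply ccont_plus.
Qed.

Lemma pow_coef_ccont k s y : 0 < y -> ccont (pow_coef k s) y.
Proof.
  intros Hy. unfold pow_coef. apply ccont_mult.
  - eapply cderiv_ccont, cderiv_RCpow, Hy.
  - apply ccont_RtoC. apply (ex_derive_continuous (V := R_NormedModule)).
    auto_derive. assumption.
Qed.

(** * The zero-mean primitive *)

Definition posc (h : R -> C) : Prop := forall v, 0 < v -> ccont h v.

(** The primitive of [-h], as a function of [u], with mean zero over [1 <= u <= 2]. *)
Definition neg_primR (u : R) (h : R -> R) : R :=
  RInt (fun v => (2 - v) * h v) 1 2 - RInt h 1 u.

Definition neg_prim (u : R) (h : R -> C) : C :=
  (neg_primR u (fun v => Re (h v)), neg_primR u (fun v => Im (h v))).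

Definition CRInt (h : R -> C) (a b : R) : C :=
  (RInt (fun v => Re (h v)) a b, RInt (fun v => Im (h v)) a b).

Lemma ex_RInt_pos (h : R -> R) a b : 0 < a -> 0 < b ->
  (forall v, 0 < v -> continuous h v) -> ex_RInt h a b.
Proof.
  intros Ha Hb H. apply (ex_RInt_continuous (V := R_CompleteNormedModule)).
  intros z Hz. apply H. pose proof (Rmin_glb_lt a b 0 Ha Hb). lra.
Qed.

Lemma continuous_weight (h : R -> R) v : continuous h v -> continuous (fun v => (2 - v) * h v) v.
Proof.
  intros H. apply (continuous_mult (K := R_AbsRing) (fun v : R => 2 - v) h v); [|exact H].
  exact (continuous_minus (V := R_NormedModule) _ _ v (continuous_const 2 v) (continuous_id v)).
Qed.

Lemma ex_RInt_weight (h : R -> R) : (forall v, 0 < v -> continuous h v) ->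
  ex_RInt (fun v => (2 - v) * h v) 1 2.
Proof. intros Hh. apply ex_RInt_pos; try lra. intros; apply continuous_weight; auto. Qed.

Lemma neg_primR_plus h k u : 0 < u -> (forall v, 0 < v -> continuous h v) ->
  (forall v, 0 < v -> continuous k v) ->
  neg_primR u (fun v => h v + k v) = neg_primR u h + neg_primR u k.
Proof.
  intros Hu Hh Hk. unfold neg_primR.
  rewrite (RInt_ext _ (fun v => plus ((2 - v) * h v) ((2 - v) * k v)))
    by (intros; unfold plus; simpl; ring).
  rewrite (RInt_plus (V := R_CompleteNormedModule) (fun v => (2 - v) * h v) (fun v => (2 - v) * k v))
    by (now apply ex_RInt_weight).
  rewrite (RInt_plus (V := R_CompleteNormedModule) h k) by (apply ex_RInt_pos; auto; lra).
  unfold plus; simpl. ring.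
Qed.

Lemma neg_primR_scal l h u : 0 < u -> (forall v, 0 < v -> continuous h v) ->
  neg_primR u (fun v => l * h v) = l * neg_primR u h.
Proof.
  intros Hu Hh. unfold neg_primR.
  rewrite (RInt_ext _ (fun v => scal l ((2 - v) * h v)))
    by (intros; unfold scal; simpl; unfold mult; simpl; ring).
  rewrite (RInt_scal (V := R_CompleteNormedModule) (fun v => (2 - v) * h v))
    by (now apply ex_RInt_weight).
  rewrite (RInt_scal (V := R_CompleteNormedModule) h) by (apply ex_RInt_pos; auto; lra).
  unfold scal; simpl. unfold mult; simpl. ring.
Qed.

Lemma neg_primR_ext h k u : 0 < u -> (forall v, 0 < v -> h v = k v) -> neg_primR u h = neg_primR u k.
Proof.
  intros Hu E. unfold neg_primR.
  rewrite (RInt_ext (fun v => (2 - v) * h v) (fun v => (2 - v) * k v)), (RInt_ext h k); [reflexivity| |];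
    intros v Hv.
  - pose proof (Rmin_glb_lt 1 u 0 ltac:(lra) Hu). apply E. lra.
  - rewrite Rmin_left in Hv by lra. rewrite E by lra. reflexivity.
Qed.

Lemma RInt_abs_bound (h : R -> R) a b B : 0 < a -> 0 < b -> 
  (forall v, 0 < v -> continuous h v) ->
  (forall v, Rmin a b <= v <= Rmax a b -> Rabs (h v) <= B) ->
  Rabs (RInt h a b) <= Rabs (b - a) * B.
Proof.
  intros Ha Hb Hc.
  assert (P : forall a b, 0 < a -> a <= b -> (forall v, a <= v <= b -> Rabs (h v) <= B) ->
    Rabs (RInt h a b) <= (b - a) * B).
  { intros a' b' Ha' Hab HB. apply abs_RInt_le_const; [assumption| |assumption].
    apply ex_RInt_pos; auto; lra. }
  intros HB. destruct (Rle_or_lt a b) as [Hab|Hab].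
  - rewrite Rmin_left, Rmax_right in HB by lra. rewrite (Rabs_pos_eq (b - a)) by lra. auto.
  - rewrite Rmin_right, Rmax_left in HB by lra.
    rewrite <- opp_RInt_swap by (apply ex_RInt_pos; auto).
    unfold opp; simpl. rewrite Rabs_Ropp, Rabs_minus_sym, (Rabs_pos_eq (a - b)) by lra.
    apply P; auto; lra.
Qed.

Lemma neg_primR_bound h u alpha beta B : 0 < alpha <= 1 -> 2 <= beta -> alpha <= u <= beta ->
  (forall v, 0 < v -> continuous h v) ->
  (forall v, alpha <= v <= beta -> Rabs (h v) <= B) ->
  Rabs (neg_primR u h) <= (1 + beta) * B.
Proof.
  intros Ha Hb Hu Hc HB.
  assert (HB0 : 0 <= B).
  { specialize (HB 1 ltac:(lra)). pose proof (Rabs_pos (h 1)). lra. }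
  unfold neg_primR.
  assert (H1 : Rabs (RInt (fun v => (2 - v) * h v) 1 2) <= Rabs (2 - 1) * B).
  { apply RInt_abs_bound; try lra.
    - intros. apply continuous_weight; auto.
    - intros v Hv. rewrite Rmin_left, Rmax_right in Hv by lra.
      rewrite Rabs_mult. specialize (HB v ltac:(lra)).
      rewrite (Rabs_pos_eq (2 - v)) by lra. pose proof (Rabs_pos (h v)). nra. }
  assert (H2 : Rabs (RInt h 1 u) <= Rabs (u - 1) * B).
  { apply RInt_abs_bound; try lra; auto. intros v Hv. apply HB.
    destruct (Rle_or_lt 1 u);
      [rewrite Rmin_left, Rmax_right in Hv by lra|rewrite Rmin_right, Rmax_left in Hv by lra]; lra. }
  rewrite (Rabs_pos_eq (2 - 1)) in H1 by lra.
  assert (Rabs (u - 1) <= beta) by (apply Rabs_le; lra).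
  assert (Rabs (u - 1) * B <= beta * B) by (apply Rmult_le_compat_r; assumption).
  eapply Rle_trans; [apply Rabs_triang|]. rewrite Rabs_Ropp. lra.
Qed.

Lemma neg_primR_cont h u : 0 < u -> (forall v, 0 < v -> continuous h v) -> continuous (fun u => neg_primR u h) u.
Proof.
  intros Hu Hc. unfold neg_primR.
  apply (continuous_minus (V := R_NormedModule) (fun _ => RInt (fun v => (2 - v) * h v) 1 2) (fun u => RInt h 1 u) u);
    [apply continuous_const|].
  apply (ex_derive_continuous (V := R_NormedModule)). exists (h u).
  apply (is_derive_RInt (V := R_NormedModule) h (RInt h 1) 1 u); [|auto].
  assert (Hp : 0 < u / 2) by lra.
  exists (mkposreal _ Hp). intros y Hy. apply (RInt_correct (V := R_CompleteNormedModule)).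
  apply ex_RInt_pos; auto; try lra.
  unfold ball in Hy; simpl in Hy; unfold AbsRing_ball, abs, minus, plus, opp in Hy; simpl in Hy.
  apply Rabs_def2 in Hy. lra.
Qed.

Lemma neg_primR_diff h u u' : 0 < u -> 0 < u' -> (forall v, 0 < v -> continuous h v) ->
  neg_primR u' h - neg_primR u h = - RInt h u u'.
Proof.
  intros Hu Hu' Hc. unfold neg_primR.
  rewrite <- (RInt_Chasles (V := R_CompleteNormedModule) h 1 u u') by (apply ex_RInt_pos; auto with real).
  unfold plus; simpl. ring.
Qed.

(** Integration by parts on the weight [2 - v]. *)
Lemma neg_primR_deriv (H h : R -> R) u : 0 < u -> (forall v, 0 < v -> is_derive H v (h v)) ->
  (forall v, 0 < v -> continuous h v) -> neg_primR u h = RInt H 1 2 - H u.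
Proof.
  intros Hu HH Hc. unfold neg_primR.
  assert (HcH : forall v, 0 < v -> continuous H v).
  { intros v Hv. apply (ex_derive_continuous (V := R_NormedModule)). eexists; eauto. }
  assert (E2 : RInt h 1 u = H u - H 1).
  { apply (is_RInt_unique (V := R_CompleteNormedModule)).
    apply (is_RInt_derive (V := R_CompleteNormedModule) H h);
      intros v Hv; pose proof (Rmin_glb_lt 1 u 0 ltac:(lra) Hu); [apply HH|apply Hc]; lra. }
  assert (E1 : RInt (fun v => (2 - v) * h v - H v) 1 2 = (2 - 2) * H 2 - (2 - 1) * H 1).
  { apply (is_RInt_unique (V := R_CompleteNormedModule)).
    apply (is_RInt_derive (V := R_CompleteNormedModule) (fun v => (2 - v) * H v) (fun v => (2 - v) * h v - H v));
      intros v Hv; rewrite Rmin_left, Rmax_right in Hv by lra.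
    - replace ((2 - v) * h v - H v) with (-1 * H v + (2 - v) * h v) by ring.
      assert (D : is_derive (fun v => 2 - v) v (-1)) by (auto_derive; [trivial|ring]).
      apply (is_derive_mult (K := R_AbsRing) (fun v => 2 - v) H v (-1) (h v) D); [apply HH; lra|].
      intros; apply Rmult_comm.
    - apply (continuous_minus (V := R_NormedModule) (fun v => (2 - v) * h v) H v);
        [apply continuous_weight, Hc|apply HcH]; lra. }
  assert (E3 : RInt (fun v => (2 - v) * h v - H v) 1 2 = RInt (fun v => (2 - v) * h v) 1 2 - RInt H 1 2).
  { exact (RInt_minus (V := R_CompleteNormedModule) (fun v => (2 - v) * h v) H 1 2
      (ex_RInt_weight h Hc) (ex_RInt_pos H 1 2 ltac:(lra) ltac:(lra) HcH)). }
  rewrite E2. lra.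
Qed.

Lemma neg_prim_plus u h k : 0 < u -> posc h -> posc k -> neg_prim u (fun v => h v + k v)%C = (neg_prim u h + neg_prim u k)%C.
Proof.
  intros Hu Hh Hk. unfold neg_prim. apply injective_projections; simpl; apply neg_primR_plus; auto;
  intros v Hv; now (apply Hh || apply Hk).
Qed.

Lemma neg_prim_ext u h k : 0 < u -> (forall v, 0 < v -> h v = k v) -> neg_prim u h = neg_prim u k.
Proof.
  intros Hu E. unfold neg_prim. f_equal; apply neg_primR_ext; auto; intros v Hv; now rewrite E.
Qed.

Lemma neg_prim_scal u (l : C) h : 0 < u -> posc h -> neg_prim u (fun v => l * h v)%C = (l * neg_prim u h)%C.
Proof.
  intros Hu Hh. unfold neg_prim. destruct l as [p q].
  assert (H1 : forall v, 0 < v -> continuous (fun v => Re (h v)) v) by (intros v Hv; now apply Hh).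
  assert (H2 : forall v, 0 < v -> continuous (fun v => Im (h v)) v) by (intros v Hv; now apply Hh).
  assert (S1 : forall (l : R) g, (forall v, 0 < v -> continuous g v) -> forall v : R, 0 < v -> continuous (fun v => l * g v) v).
  { intros l g Hg v Hv. apply (continuous_scal_r (V := R_NormedModule) l g v). auto. }
  apply injective_projections; simpl fst; simpl snd.
  - rewrite <- (neg_primR_scal p), <- (neg_primR_scal q) by auto.
    replace (neg_primR u (fun v => p * Re (h v)) - neg_primR u (fun v => q * Im (h v))) with
     (neg_primR u (fun v => p * Re (h v)) + (-q) * neg_primR u (fun v => Im (h v))) by (rewrite neg_primR_scal by auto; rewrite (neg_primR_scal q) by auto; ring).
    rewrite <- (neg_primR_scal (-q)) by auto.
    rewrite <- neg_primR_plus by auto. apply neg_primR_ext; [assumption|]. intros. unfold Re, Im. ring.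
  - rewrite <- (neg_primR_scal p), <- (neg_primR_scal q) by auto.
    rewrite <- neg_primR_plus by auto. apply neg_primR_ext; [assumption|]. intros. unfold Re, Im. ring.
Qed.

Lemma posc_plus h k : posc h -> posc k -> posc (fun v => h v + k v)%C.
Proof. intros H1 H2 v Hv. apply ccont_plus; auto. Qed.

Lemma posc_scal (l : C) h : posc h -> posc (fun v => l * h v)%C.
Proof. intros H1 v Hv. apply ccont_mult; [apply ccont_const|auto]. Qed.

Lemma posc_Csum (F : nat -> R -> C) n : (forall k, posc (F k)) -> posc (fun v => Csum (fun k => F k v) n).
Proof. intros H v Hv. apply ccont_Csum. intros k; now apply H. Qed.

Lemma posc_neg_prim h : posc h -> posc (fun u => neg_prim u h).
Proof.
  intros H v Hv. split; apply neg_primR_cont; auto; intros; now apply H.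
Qed.

Lemma neg_prim_0 u : neg_prim u (fun _ => RtoC 0) = RtoC 0.
Proof.
  assert (E : neg_primR u (fun _ => 0) = 0).
  { unfold neg_primR. rewrite (RInt_ext _ (fun _ => 0)) by (intros; apply Rmult_0_r).
    rewrite !RInt_const. unfold scal; simpl. unfold mult; simpl. ring. }
  unfold neg_prim. simpl. now rewrite E.
Qed.

Lemma neg_prim_Csum u (F : nat -> R -> C) n : 0 < u -> (forall k, posc (F k)) ->
  neg_prim u (fun v => Csum (fun k => F k v) n) = Csum (fun k => neg_prim u (F k)) n.
Proof.
  intros Hu H. induction n as [|n IH]; simpl; [apply neg_prim_0|].
  rewrite neg_prim_plus; auto; [|now apply posc_Csum]. now rewrite IH.
Qed.

Lemma neg_prim_minus u h k : 0 < u -> posc h -> posc k -> neg_prim u (fun v => h v - k v)%C = (neg_prim u h - neg_prim u k)%C.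
Proof.
  intros Hu Hh Hk.
  rewrite (neg_prim_ext u _ (fun v => h v + RtoC (-1) * k v)%C); auto.
  - rewrite neg_prim_plus, neg_prim_scal; auto; [|now apply posc_scal].
    apply injective_projections; simpl; ring.
  - intros; apply injective_projections; simpl; ring.
Qed.

Lemma im_le_Cmod c : Rabs (Im c) <= Cmod c.
Proof. eapply Rle_trans; [|apply Rmax_Cmod]. apply Rmax_r. Qed.

Lemma Cmod_le_sum c : Cmod c <= Rabs (Re c) + Rabs (Im c).
Proof.
  pose proof (Cmod2_alt c) as H. pose proof (Cmod_ge_0 c).
  pose proof (Rabs_pos (Re c)). pose proof (Rabs_pos (Im c)).
  rewrite <- (pow2_abs (Re c)), <- (pow2_abs (Im c)) in H. nra.
Qed.

Lemma neg_prim_bound u h alpha beta B : 0 < alpha <= 1 -> 2 <= beta -> alpha <= u <= beta ->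
  posc h -> (forall v, alpha <= v <= beta -> Cmod (h v) <= B) ->
  Cmod (neg_prim u h) <= 2 * (1 + beta) * B.
Proof.
  intros Ha Hb Hu Hc HB. eapply Rle_trans; [apply Cmod_le_sum|]. simpl.
  assert (H1 : Rabs (neg_primR u (fun v => Re (h v))) <= (1 + beta) * B).
  { apply neg_primR_bound with alpha; auto; [intros v Hv; now apply Hc|].
    intros v Hv. eapply Rle_trans; [apply re_le_Cmod|auto]. }
  assert (H2 : Rabs (neg_primR u (fun v => Im (h v))) <= (1 + beta) * B).
  { apply neg_primR_bound with alpha; auto; [intros v Hv; now apply Hc|].
    intros v Hv. eapply Rle_trans; [apply im_le_Cmod|auto]. }
  lra.
Qed.

Lemma neg_prim_deriv (H h : R -> C) u : 0 < u -> (forall v, 0 < v -> cderiv H v (h v)) -> posc h ->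
  neg_prim u h = (CRInt H 1 2 - H u)%C.
Proof.
  intros Hu HH Hc. unfold neg_prim, CRInt. apply injective_projections; simpl.
  - apply (neg_primR_deriv (fun v => Re (H v))); auto; intros v Hv; now (apply HH || apply Hc).
  - apply (neg_primR_deriv (fun v => Im (H v))); auto; intros v Hv; now (apply HH || apply Hc).
Qed.

Lemma CRInt_deriv (H h : R -> C) : (forall v, 0 < v -> cderiv H v (h v)) -> posc h ->
  CRInt h 1 2 = (H 2 - H 1)%C.
Proof.
  intros HH Hc. unfold CRInt. apply injective_projections; simpl;
  apply (is_RInt_unique (V := R_CompleteNormedModule)).
  - apply (is_RInt_derive (V := R_CompleteNormedModule) (fun v => Re (H v)) (fun v => Re (h v)));
    intros v Hv; rewrite Rmin_left in Hv by lra; [apply HH|apply Hc]; lra.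
  - apply (is_RInt_derive (V := R_CompleteNormedModule) (fun v => Im (H v)) (fun v => Im (h v)));
    intros v Hv; rewrite Rmin_left in Hv by lra; [apply HH|apply Hc]; lra.
Qed.

(** * Normally convergent complex series and the Hurwitz series *)

(** The sum of a complex series, by coordinates; real terms visibly have a real sum. *)
Definition CSer (a : nat -> C) : C := (Series (fun n => Re (a n)), Series (fun n => Im (a n))).

Definition dominated (a : nat -> C) (M : nat -> R) : Prop :=
  ex_series M /\ forall n, Cmod (a n) <= M n.

Definition tail (M : nat -> R) (N : nat) : R := Series (fun n => M (N + n)%nat).

Lemma tail_O M : tail M 0 = Series M.
Proof. reflexivity. Qed.

Lemma tail_split M N m : ex_series M ->
  tail M N = sum_n (fun k => M (N + k)%nat) m + tail M (N + S m).
Proof.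
  intros H. unfold tail. rewrite (Series_incr_n _ (S m)).
  - simpl Nat.pred. rewrite sum_n_Reals. f_equal. apply Series_ext. intros n. f_equal. lia.
  - lia.
  - now apply ex_series_incr_n.
Qed.

Lemma tail_lim M : ex_series M -> is_lim_seq (tail M) 0.
Proof.
  intros H. apply is_lim_seq_incr_1.
  apply is_lim_seq_ext with (fun n => Series M - sum_n M n).
  - intros n. pose proof (tail_split M 0 n H) as E. simpl in E. rewrite tail_O in E.
    rewrite (sum_n_ext (fun k => M k) M) in E by reflexivity. 
    change (tail M (S n)) with (tail M (0 + S n)). simpl. lra.
  - replace (Finite 0) with (Rbar_minus (Series M) (Series M)) by (simpl; f_equal; ring).
    apply is_lim_seq_minus'; [apply is_lim_seq_const|]. exact (Series_correct _ H).
Qed.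

Lemma tail_ge0 M N : (forall n, 0 <= M n) -> ex_series M -> 0 <= tail M N.
Proof.
  intros HM H. unfold tail.
  rewrite <- (Rmult_0_l (Series (fun n : nat => M (N + n)%nat))), <- Series_scal_l.
  apply Series_le; [|now apply ex_series_incr_n]. intros n. specialize (HM (N + n)%nat). lra.
Qed.

Lemma dominated_pos a M : dominated a M -> forall n, 0 <= M n.
Proof. intros [_ H] n. eapply Rle_trans; [apply Cmod_ge_0|apply H]. Qed.

Lemma is_series_Re (a : nat -> C) (l : C) : @is_series C_AbsRing C_NormedModule a l ->
  is_series (fun n => Re (a n)) (Re l).
Proof.
  intros Hl. unfold is_series in *.
  apply filterlim_ext with (fun n => Re (@sum_n C_AbelianMonoid a n)).
  - induction x as [|n IH]; [now rewrite !sum_O|]. rewrite !sum_Sn, <- IH. reflexivity.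
  - eapply filterlim_comp; [exact Hl|]. destruct l.
    apply (continuous_fst (U := R_UniformSpace) (V := R_UniformSpace)).
Qed.

Lemma is_series_Im (a : nat -> C) (l : C) : @is_series C_AbsRing C_NormedModule a l ->
  is_series (fun n => Im (a n)) (Im l).
Proof.
  intros Hl. unfold is_series in *.
  apply filterlim_ext with (fun n => Im (@sum_n C_AbelianMonoid a n)).
  - induction x as [|n IH]; [now rewrite !sum_O|]. rewrite !sum_Sn, <- IH. reflexivity.
  - eapply filterlim_comp; [exact Hl|]. destruct l.
    apply (continuous_snd (U := R_UniformSpace) (V := R_UniformSpace)).
Qed.

Lemma dominated_series a M : dominated a M -> @is_series C_AbsRing C_NormedModule a (CSer a).
Proof.
  intros [HM H].
  destruct (@ex_series_le C_AbsRing C_CompleteNormedModule a M) as [l Hl]; [exact H|exact HM|].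
  pose proof (is_series_Re a l Hl) as H1. pose proof (is_series_Im a l Hl) as H2.
  unfold CSer. rewrite (is_series_unique _ _ H1), (is_series_unique _ _ H2).
  destruct l; exact Hl.
Qed.

Lemma Csum_tail (a : nat -> C) M N m : dominated a M ->
  Cmod (Csum a (N + m) - Csum a N)%C <= tail M N - tail M (N + m).
Proof.
  intros D. destruct D as [HM H]. induction m as [|m IH].
  - rewrite Nat.add_0_r. replace (_ - _)%C with (RtoC 0) by ring. rewrite Cmod_0. lra.
  - rewrite Nat.add_succ_r. simpl Csum.
    replace (_ - _)%C with ((Csum a (N + m) - Csum a N) + a (N + m)%nat)%C by ring.
    eapply Rle_trans; [apply Cmod_triangle|].
    pose proof (tail_split M (N + m) 0 HM) as E. rewrite sum_O, Nat.add_0_r in E.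
    replace (N + m + 1)%nat with (S (N + m)) in E by lia.
    specialize (H (N + m)%nat). lra.
Qed.

(** The bound holds between partial sums ([Csum_tail]) and passes to the limit. *)
Lemma is_series_tail (a : nat -> C) M (l : C) N : dominated a M ->
  @is_series C_AbsRing C_NormedModule a l -> Cmod (l - Csum a N)%C <= tail M N.
Proof.
  intros D Hl. apply le_epsilon. intros eps He.
  unfold is_series in Hl. apply (proj1 (filterlim_Cmod _ _ _)) with (eps := eps) in Hl; [|assumption].
  destruct Hl as [K HK]. specialize (HK (N + K)%nat ltac:(lia)).
  rewrite sum_n_Csum in HK.
  replace (S (N + K)) with (N + S K)%nat in HK by lia.
  pose proof (Csum_tail a M N (S K) D).
  pose proof (tail_ge0 M (N + S K) (dominated_pos a M D) (proj1 D)).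
  replace (l - Csum a N)%C with (- (Csum a (N + S K) - l) + (Csum a (N + S K) - Csum a N))%C by ring.
  eapply Rle_trans; [apply Cmod_triangle|]. rewrite Cmod_opp. lra.
Qed.

Lemma CSer_tail a M N : dominated a M -> Cmod (CSer a - Csum a N)%C <= tail M N.
Proof. intros D. eapply is_series_tail; [exact D|]. eapply dominated_series, D. Qed.

Lemma is_series_bound (a : nat -> C) M (l : C) : dominated a M ->
  @is_series C_AbsRing C_NormedModule a l -> Cmod l <= Series M.
Proof.
  intros D Hl. pose proof (is_series_tail a M l 0 D Hl) as H. simpl in H.
  replace (l - 0)%C with l in H by ring. exact H.
Qed.

Lemma is_series_C_unique (a : nat -> C) (l l' : C) :
  @is_series C_AbsRing C_NormedModule a l -> @is_series C_AbsRing C_NormedModule a l' -> l = l'.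
Proof.
  intros H H'. unfold is_series in *.
  exact (filterlim_locally_unique (F := eventually) _ l l' H H').
Qed.

Lemma is_series_Csum (F : nat -> nat -> C) (l : nat -> C) (w : C) n :
  (forall k, @is_series C_AbsRing C_NormedModule (fun nu => F nu k) (l k)) ->
  @is_series C_AbsRing C_NormedModule (fun nu => Csum (fun k => F nu k * w ^ k)%C n)
     (Csum (fun k => l k * w ^ k)%C n).
Proof.
  intros H. induction n as [|n IH]; simpl.
  - apply filterlim_ext with (fun _ : nat => RtoC 0); [|apply filterlim_const].
    intros m. induction m as [|m IHm]; [now rewrite sum_O|].
    rewrite sum_Sn, <- IHm. change (RtoC 0 = (RtoC 0 + RtoC 0)%C). ring.
  - apply (is_series_plus (K := C_AbsRing) (V := C_NormedModule)
      (fun nu => Csum (fun k => F nu k * w ^ k)%C n) (fun nu => F nu n * w ^ n)%C); [exact IH|].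
    apply (is_series_ext (V := C_NormedModule) (fun nu => scal (w ^ n)%C (F nu n))).
    { intros nu. change ((w ^ n * F nu n)%C = (F nu n * w ^ n)%C). ring. }
    replace (l n * w ^ n)%C with (w ^ n * l n)%C by ring.
    apply (is_series_scal (K := C_AbsRing) (V := C_NormedModule) (w ^ n)%C (fun nu => F nu n)). auto.
Qed.

(** A normally convergent series of expansions is expanded by the sums of the
    coefficients, because the remainder bounds add up. *)
Lemma CSer_expands r (B : nat -> R) (c : nat -> nat -> C) (f : nat -> C -> C) :
  0 < r -> ex_series B -> (forall nu, expands r (B nu) (c nu) (f nu)) ->
  expands r (Series B) (fun k => CSer (fun nu => c nu k)) (fun w => CSer (fun nu => f nu w)).
Proof.
  intros Hr HB H n w Hw.
  assert (Df : dominated (fun nu => f nu w) B).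
  { split; [assumption|]. intros nu. specialize (H nu O w Hw). simpl in H.
    replace (f nu w - 0)%C with (f nu w) in H by ring. lra. }
  assert (Dc : forall k, dominated (fun nu => c nu k) (fun nu => 2 / r ^ k * B nu)).
  { intros k. split; [apply ex_series_scal_l with (c := 2 / r ^ k) (a := B); assumption|].
    intros nu. pose proof (expands_coef r (B nu) (c nu) (f nu) k Hr (H nu)) as E.
    assert (0 < r ^ k) by now apply pow_lt.
    replace (2 / r ^ k * B nu) with (2 * B nu / r ^ k) by (field; lra).
    now apply Rle_div_r. }
  assert (Hs : @is_series C_AbsRing C_NormedModule
     (fun nu => (f nu w - Csum (fun k => c nu k * w ^ k) n)%C)
     (CSer (fun nu => f nu w) - Csum (fun k => CSer (fun nu => c nu k) * w ^ k) n)%C).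
  { apply (is_series_minus (K := C_AbsRing) (V := C_NormedModule) (fun nu => f nu w) (fun nu => Csum (fun k => c nu k * w ^ k)%C n)).
    - eapply dominated_series, Df.
    - apply is_series_Csum. intros k. eapply dominated_series, (Dc k). }
  rewrite Rmult_comm, <- Series_scal_l.
  eapply is_series_bound; [|exact Hs]. split.
  - apply ex_series_scal_l with (c := (Cmod w / r) ^ n) (a := B); assumption.
  - intros nu. rewrite Rmult_comm. now apply H.
Qed.

Lemma Series_CVU_cont (f : nat -> R -> R) (M : nat -> R) (t : R) (d : posreal) :
  ex_series M -> (forall n, 0 <= M n) ->
  (forall n v, Boule t d v -> continuous (f n) v /\ Rabs (f n v) <= M n) ->
  continuous (fun v => Series (fun n => f n v)) t.
Proof.
  intros HM HM0 Hf. apply continuity_pt_filterlim.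
  apply (CVU_continuity (fun n v => sum_n (fun k => f k v) n) _ t d).
  - intros eps He.
    pose proof (tail_lim M HM) as L. apply is_lim_seq_spec in L.
    destruct (L (mkposreal eps He)) as [N HN]. exists N. intros n y Hn Hy.
    specialize (HN (S n) ltac:(lia)). simpl in HN. rewrite Rminus_0_r in HN.
    assert (D : forall k, Cmod (RtoC (f k y)) <= M k).
    { intros k. rewrite Cmod_R. now apply Hf. }
    pose proof (CSer_tail (fun k => RtoC (f k y)) M (S n) (conj HM D)) as T.
    rewrite <- sum_n_Csum in T.
    assert (E : @sum_n C_AbelianMonoid (fun k => RtoC (f k y)) n = RtoC (sum_n (fun k => f k y) n)).
    { clear. induction n as [|n IH]; [now rewrite !sum_O|]. rewrite !sum_Sn, IH.
      change (RtoC (sum_n (fun k => f k y) n) + RtoC (f (S n) y) = RtoC (sum_n (fun k => f k y) n + f (S n) y))%C.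
      now rewrite RtoC_plus. }
    rewrite E in T.
    eapply Rle_lt_trans; [|apply Rabs_def2 in HN; apply HN].
    eapply Rle_trans; [|exact T].
    eapply Rle_trans; [|apply re_le_Cmod]. right. unfold CSer. simpl.
    reflexivity.
  - intros n y Hy. apply continuity_pt_filterlim.
    induction n as [|n IH].
    + apply continuous_ext with (f O); [intros; now rewrite sum_O|]. now apply Hf.
    + apply continuous_ext with (fun v => plus (sum_n (fun k => f k v) n) (f (S n) v));
        [intros; now rewrite sum_Sn|].
      apply (continuous_plus (V := R_NormedModule)); [exact IH|]. now apply Hf.
  - unfold Boule. rewrite Rminus_diag, Rabs_R0. apply cond_pos.
Qed.

Lemma CSer_ccont (F : nat -> R -> C) M t (d : posreal) :
  ex_series M ->
  (forall n v, Boule t d v -> ccont (F n) v /\ Cmod (F n v) <= M n) ->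
  ccont (fun v => CSer (fun n => F n v)) t.
Proof.
  intros HM HF.
  assert (HM0 : forall n, 0 <= M n).
  { intros n. eapply Rle_trans; [apply Cmod_ge_0|]. apply (HF n t).
    unfold Boule. rewrite Rminus_diag, Rabs_R0. apply cond_pos. }
  split.
  - apply (Series_CVU_cont (fun n v => Re (F n v)) M t d); auto.
    intros n v Hv. destruct (HF n v Hv) as [[H1 H2] H3]. split; [assumption|].
    eapply Rle_trans; [apply re_le_Cmod|assumption].
  - apply (Series_CVU_cont (fun n v => Im (F n v)) M t d); auto.
    intros n v Hv. destruct (HF n v Hv) as [[H1 H2] H3]. split; [assumption|].
    eapply Rle_trans; [apply im_le_Cmod|assumption].
Qed.

Lemma lim_ln_INR : is_lim_seq (fun n => ln (INR (S n))) p_infty.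
Proof.
  apply (is_lim_seq_incr_1 (fun n => ln (INR n))).
  apply (is_lim_comp_seq ln INR p_infty p_infty).
  - apply is_lim_ln_p.
  - exists O. intros; discriminate.
  - apply is_lim_seq_INR.
Qed.

Lemma lim_exp_neg (q : R) (x : nat -> R) : 0 < q -> is_lim_seq x p_infty ->
  is_lim_seq (fun n => exp (- q * x n)) 0.
Proof.
  intros Hq Hx.
  apply (is_lim_comp_seq exp (fun n => - q * x n) m_infty 0).
  - apply is_lim_exp_m.
  - exists O. intros; discriminate.
  - replace m_infty with (Rbar_mult (- q) p_infty).
    + apply is_lim_seq_scal_l, Hx.
    + simpl. case Rle_dec; intros; [exfalso; lra|reflexivity].
Qed.

(** Comparison with the telescoping series of [n^(1-p) / (p-1)]. *)
Lemma ex_series_zeta (p : R) : 1 < p -> ex_series (fun n => exp (- p * ln (INR (S n)))).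
Proof.
  intros Hp. apply ex_series_incr_1.
  set (T := fun x => exp (- (p - 1) * ln x)).
  assert (Hlim : is_series (fun n => / (p - 1) * (T (INR (S n)) - T (INR (S (S n))))) (/ (p - 1) * T 1)).
  { apply (is_series_scal_l (K := R_AbsRing) (V := R_NormedModule) (/ (p - 1)) (fun n => T (INR (S n)) - T (INR (S (S n))))).
    assert (L : is_lim_seq (fun n => T 1 - T (INR (S (S n)))) (T 1)).
    { replace (Finite (T 1)) with (Rbar_minus (T 1) 0) by (simpl; f_equal; ring).
      apply is_lim_seq_minus'; [apply is_lim_seq_const|].
      apply (is_lim_seq_incr_1 (fun n => T (INR (S n)))).
      unfold T. apply lim_exp_neg; [lra|apply lim_ln_INR]. }
    refine (filterlim_ext _ _ _ L).
    intros n. induction n as [|n IH]; [now rewrite sum_O|].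
    rewrite sum_Sn, <- IH. unfold plus; simpl. ring. }
  apply (@ex_series_le R_AbsRing R_CompleteNormedModule _ (fun n => / (p - 1) * (T (INR (S n)) - T (INR (S (S n)))))).
  2:{ eexists. exact Hlim. }
  intros n. change (Rabs (exp (- p * ln (INR (S (S n))))) <= / (p - 1) * (T (INR (S n)) - T (INR (S (S n))))).
  rewrite Rabs_pos_eq by (left; apply exp_pos).
  set (a := INR (S n)). set (b := INR (S (S n))).
  assert (Ha : 0 < a) by (apply lt_0_INR; lia).
  assert (Hb : b = a + 1) by (unfold b; rewrite S_INR; reflexivity).
  destruct (MVT_gen T a b (fun x => - (p - 1) * exp (- p * ln x))) as [c [Hc E]].
  - intros x Hx. rewrite Rmin_left in Hx by lra. unfold T. auto_derive; [lra|].
    replace (- p * ln x) with (- (p - 1) * ln x + - ln x) by ring.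
    rewrite exp_plus, exp_Ropp, exp_ln by lra. field. lra.
  - intros x Hx. rewrite Rmin_left in Hx by lra. unfold T.
    apply derivable_continuous_pt, ex_derive_Reals_0. auto_derive. lra.
  - rewrite Rmin_left, Rmax_right in Hc by lra.
    replace (T a - T b) with ((p - 1) * exp (- p * ln c)) by (rewrite Hb in *; lra).
    rewrite <- Rmult_assoc, Rinv_l, Rmult_1_l by lra.
    destruct (Rle_lt_or_eq_dec (- p * ln b) (- p * ln c)) as [H|H].
    + assert (ln c <= ln b); [|nra]. destruct (Req_dec b c) as [->|]; [lra|].
      left. apply ln_increasing; lra.
    + left. now apply exp_increasing.
    + right. now rewrite H.
Qed.

(** The Taylor coefficients in [s] of the Hurwitz series, for [Re s > 1]. *)
Definition series_coef (k : nat) (s : C) (u : R) : C := CSer (fun nu => pow_coef k s (INR nu + u)).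

(** With this radius, [Re s - 2 rad s = (Re s + 1) / 2] still exceeds [1]. *)
Definition rad (s : C) : R := (Re s - 1) / 4.

(** Bounds the terms of the Hurwitz series and their expansions at [s] of radius
    [rad s], uniformly for [al <= u <= be]; the term of index [0] is apart because
    [ln u] may be negative there. *)
Definition majorant (s : C) (al be : R) (nu : nat) : R :=
  match nu with
  | O => exp ((Rabs (Re s) + 2 * rad s) * (Rabs (ln al) + Rabs (ln be)))
  | S m => exp (- ((Re s + 1) / 2) * ln (INR (S m)))
  end.

Lemma ex_series_majorant s al be : 1 < Re s -> ex_series (majorant s al be).
Proof.
  intros Hs. apply ex_series_incr_1. apply ex_series_zeta. lra.
Qed.

Lemma exp_le_mono a b : a <= b -> exp a <= exp b.
Proof. intros [H| ->]; [left; now apply exp_increasing|apply Rle_refl]. Qed.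

Lemma ln_le_mono a b : 0 < a -> a <= b -> ln a <= ln b.
Proof. intros Ha [H| ->]; [left; now apply ln_increasing|apply Rle_refl]. Qed.

Lemma majorant_bound s al be u nu : 1 < Re s -> 0 < al -> al <= u <= be ->
  exp (- Re s * ln (INR nu + u) + 2 * rad s * Rabs (ln (INR nu + u))) <= majorant s al be nu.
Proof.
  intros Hs Ha Hu. destruct nu as [|m].
  - simpl. rewrite Rplus_0_l. apply exp_le_mono.
    assert (HL : Rabs (ln u) <= Rabs (ln al) + Rabs (ln be)).
    { pose proof (ln_le_mono al u Ha ltac:(lra)). pose proof (ln_le_mono u be ltac:(lra) ltac:(lra)).
      apply Rabs_le. pose proof (Rle_abs (- ln al)). rewrite Rabs_Ropp in *.
      pose proof (Rle_abs (ln be)). pose proof (Rabs_pos (ln al)). pose proof (Rabs_pos (ln be)). lra. }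
    assert (- Re s * ln u <= Rabs (Re s) * Rabs (ln u)).
    { rewrite <- Rabs_mult. replace (- Re s * ln u) with (- (Re s * ln u)) by ring.
      rewrite <- Rabs_Ropp. apply Rle_abs. }
    assert (0 < rad s) by (unfold rad; lra).
    pose proof (Rabs_pos (Re s)). nra.
  - apply exp_le_mono.
    assert (H1 : 1 <= INR (S m)) by (rewrite S_INR; pose proof (pos_INR m); lra).
    assert (H2 : 0 <= ln (INR (S m))) by (rewrite <- ln_1; apply ln_le_mono; lra).
    assert (H3 : ln (INR (S m)) <= ln (INR (S m) + u)) by (apply ln_le_mono; lra).
    rewrite Rabs_pos_eq by lra. unfold rad.
    replace (- Re s * ln (INR (S m) + u) + 2 * ((Re s - 1) / 4) * ln (INR (S m) + u))
      with (- ((Re s + 1) / 2) * ln (INR (S m) + u)) by field.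
    nra.
Qed.

Lemma expands_mono r B B' c f : 0 < r -> B <= B' -> expands r B c f -> expands r B' c f.
Proof.
  intros Hr HB H n w Hw. eapply Rle_trans; [now apply H|].
  apply Rmult_le_compat_r; [|assumption]. apply pow_le, Rdiv_le_0_compat; [apply Cmod_ge_0|assumption].
Qed.

Lemma pow_coef_expands_majorant s al be u nu : 1 < Re s -> 0 < al -> al <= u <= be ->
  expands (rad s) (majorant s al be nu) (fun k => pow_coef k s (INR nu + u)) (fun w => pow_coef 0 (s + w)%C (INR nu + u)).
Proof.
  intros Hs Ha Hu. assert (Hr : 0 < rad s) by (unfold rad; lra).
  eapply expands_mono; [assumption| |now apply pow_coef_expands]. now apply majorant_bound.
Qed.

Lemma series_coef_expands s al be u : 1 < Re s -> 0 < al -> al <= u <= be ->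
  expands (rad s) (Series (majorant s al be)) (fun k => series_coef k s u) (fun w => series_coef 0 (s + w)%C u).
Proof.
  intros Hs Ha Hu. unfold series_coef.
  apply (CSer_expands (rad s) (majorant s al be) (fun nu k => pow_coef k s (INR nu + u)) (fun nu w => pow_coef 0 (s + w)%C (INR nu + u))).
  - unfold rad; lra.
  - now apply ex_series_majorant.
  - intros nu. now apply pow_coef_expands_majorant.
Qed.

Lemma pow_coef_dominated s k al be u : 1 < Re s -> 0 < al -> al <= u <= be ->
  dominated (fun nu => pow_coef k s (INR nu + u)) (fun nu => 2 / rad s ^ k * majorant s al be nu).
Proof.
  intros Hs Ha Hu. assert (Hr : 0 < rad s) by (unfold rad; lra).
  split.
  - apply ex_series_scal_l with (c := 2 / rad s ^ k) (a := majorant s al be). now apply ex_series_majorant.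
  - intros nu. pose proof (expands_coef _ _ _ _ k Hr (pow_coef_expands_majorant s al be u nu Hs Ha Hu)).
    assert (0 < rad s ^ k) by now apply pow_lt.
    replace (2 / rad s ^ k * majorant s al be nu) with (2 * majorant s al be nu / rad s ^ k) by (field; lra).
    now apply Rle_div_r.
Qed.

Lemma series_coef_posc s k : 1 < Re s -> posc (series_coef k s).
Proof.
  intros Hs u Hu. assert (Hd : 0 < u / 2) by lra.
  apply (CSer_ccont (fun nu v => pow_coef k s (INR nu + v)) (fun nu => 2 / rad s ^ k * majorant s (u / 2) (2 * u) nu) u (mkposreal _ Hd)).
  - apply (pow_coef_dominated s k (u / 2) (2 * u) u); lra.
  - intros n v Hv. unfold Boule in Hv. simpl in Hv. apply Rabs_def2 in Hv. split.
    + apply ccont_shift, pow_coef_ccont. pose proof (pos_INR n). lra.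
    + apply (pow_coef_dominated s k (u / 2) (2 * u) v); lra.
Qed.

(** * Continuation to the left, one unit strip at a time *)

Lemma Cmod_small_zero (z : C) (t : nat -> R) :
  (forall n, Cmod z <= t n) -> is_lim_seq t 0 -> z = RtoC 0.
Proof.
  intros H Ht. apply Cmod_eq_0. apply Rle_antisym; [|apply Cmod_ge_0].
  apply (is_lim_seq_le (fun _ => Cmod z) t (Cmod z) 0 H); [apply is_lim_seq_const|exact Ht].
Qed.

Lemma cderiv_shift F c t l : cderiv F (c + t) l -> cderiv (fun u => F (c + u)) t l.
Proof.
  intros [H1 H2].
  assert (D : is_derive (fun u : R => c + u) t 1) by (auto_derive; [trivial|ring]).
  split.
  - replace (Re l) with (scal 1 (Re l)) by (unfold scal; simpl; unfold mult; simpl; ring).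
    exact (is_derive_comp (V := R_NormedModule) (fun u => Re (F u)) (fun u => c + u) t _ _ H1 D).
  - replace (Im l) with (scal 1 (Im l)) by (unfold scal; simpl; unfold mult; simpl; ring).
    exact (is_derive_comp (V := R_NormedModule) (fun u => Im (F u)) (fun u => c + u) t _ _ H2 D).
Qed.

Lemma posc_pow_coef_shift k s c : 0 <= c -> posc (fun v => pow_coef k s (c + v)).
Proof. intros Hc v Hv. apply ccont_shift, pow_coef_ccont. lra. Qed.

Lemma Re_neq_nonzero (z : C) : Re z <> 0 -> z <> RtoC 0.
Proof. intros H E. apply H. now rewrite E. Qed.

(** [s y^(-s-1)] has the primitive [- y^(-s)], and the mean of [y^(-s)] over a unit
    interval is a difference of values of [y^(1-s) / (1-s)]. *)
Lemma neg_prim_pow_coef (s : C) u nu : 1 < Re s -> 0 < u ->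
  (s * neg_prim u (fun v => pow_coef 0 (s + 1) (INR nu + v)))%C =
  (pow_coef 0 s (INR nu + u) - (RCpow (INR (S (S nu))) (1 - s) - RCpow (INR (S nu)) (1 - s)) / (1 - s))%C.
Proof.
  intros Hs Hu.
  assert (Hnu := pos_INR nu).
  assert (H1s : (1 - s)%C <> RtoC 0) by (apply Re_neq_nonzero; destruct s; simpl in *; lra).
  rewrite <- neg_prim_scal by (auto using posc_pow_coef_shift).
  rewrite (neg_prim_deriv (fun v => RtoC (-1) * pow_coef 0 s (INR nu + v))%C); [|assumption| |apply posc_scal, posc_pow_coef_shift, Hnu].
  2:{ intros v Hv.
      replace (s * pow_coef 0 (s + 1) (INR nu + v))%C with (RtoC (-1) * (- s * RCpow (INR nu + v) (- s - 1)))%C.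
      2:{ rewrite pow_coef_0. replace (- (s + 1))%C with (- s - 1)%C by ring.
          rewrite RtoC_m1. ring. }
      apply cderiv_scal. apply (cderiv_shift (pow_coef 0 s)).
      apply cderiv_ext with (fun t => RCpow t (- s)); [intros; now rewrite pow_coef_0|].
      apply cderiv_RCpow. lra. }
  assert (E : CRInt (fun v => RtoC (-1) * pow_coef 0 s (INR nu + v))%C 1 2 =
    (- (RCpow (INR (S (S nu))) (1 - s) - RCpow (INR (S nu)) (1 - s)) / (1 - s))%C).
  { rewrite (CRInt_deriv (fun v => RtoC (-1) / (1 - s) * RCpow (INR nu + v) (1 - s))%C).
    - rewrite !S_INR. replace (INR nu + 1 + 1) with (INR nu + 2) by ring.
      rewrite RtoC_m1. field. exact H1s.
    - intros v Hv.
      replace (RtoC (-1) * pow_coef 0 s (INR nu + v))%C with (RtoC (-1) / (1 - s) * ((1 - s) * RCpow (INR nu + v) (1 - s - 1)))%C.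
      2:{ rewrite pow_coef_0. replace (1 - s - 1)%C with (- s)%C by ring. field. exact H1s. }
      apply cderiv_scal. apply (cderiv_shift (fun t => RCpow t (1 - s))). apply cderiv_RCpow. lra.
    - apply posc_scal, posc_pow_coef_shift, Hnu. }
  rewrite E.
  rewrite RtoC_m1.
  field. exact H1s.
Qed.

Lemma Csum_telescope (p : nat -> C) n : Csum (fun k => p (S k) - p k)%C n = (p n - p O)%C.
Proof. induction n as [|n IH]; simpl; [ring|rewrite IH; ring]. Qed.

(** Summing [neg_prim_pow_coef] over the terms: the means telescope to [1/(s-1)]. *)
Lemma series_coef_recursion (s : C) u : 1 < Re s -> 0 < u ->
  series_coef 0 s u = (/ (s - 1) + s * neg_prim u (series_coef 0 (s + 1)))%C.
Proof.
  intros Hs Hu.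
  assert (H1s : (1 - s)%C <> RtoC 0) by (apply Re_neq_nonzero; destruct s; simpl in *; lra).
  assert (Hs1 : (s - 1)%C <> RtoC 0) by (apply Re_neq_nonzero; destruct s; simpl in *; lra).
  assert (Hs' : 1 < Re (s + 1)) by (destruct s; simpl in *; lra).
  set (al := Rmin 1 u). set (be := Rmax 2 u).
  assert (Ha : 0 < al <= 1) by (unfold al; split; [apply Rmin_glb_lt; lra|apply Rmin_l]).
  assert (Hb : 2 <= be) by apply Rmax_l.
  assert (Hu' : al <= u <= be) by (split; [apply Rmin_r|apply Rmax_r]).
  set (M := fun nu => 2 / rad s ^ 0 * majorant s al be nu).
  set (M' := fun nu => 2 / rad (s + 1) ^ 0 * majorant (s + 1) al be nu).
  assert (D : dominated (fun nu => pow_coef 0 s (INR nu + u)) M) by (apply pow_coef_dominated; lra).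
  assert (D' : forall v, al <= v <= be -> dominated (fun nu => pow_coef 0 (s + 1) (INR nu + v)) M')
    by (intros; apply pow_coef_dominated; lra).
  set (p := fun n => RCpow (INR (S n)) (1 - s)).
  assert (EN : forall N, (s * neg_prim u (fun v => Csum (fun nu => pow_coef 0 (s + 1) (INR nu + v)) N))%C =
    (Csum (fun nu => pow_coef 0 s (INR nu + u)) N - (p N - 1) / (1 - s))%C).
  { intros N. rewrite (neg_prim_Csum u (fun nu v => pow_coef 0 (s + 1) (INR nu + v))); [|assumption|].
    2:{ intros k. apply posc_pow_coef_shift, pos_INR. }
    rewrite <- Csum_scal.
    rewrite (Csum_ext _ (fun nu => pow_coef 0 s (INR nu + u) + RtoC (-1) / (1 - s) * (p (S nu) - p nu))%C).
    2:{ intros nu _. rewrite neg_prim_pow_coef by assumption. unfold p.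
        rewrite RtoC_m1. field. exact H1s. }
    rewrite Csum_plus, Csum_scal, Csum_telescope.
    replace (p O) with (RtoC 1).
    2:{ unfold p. simpl INR. unfold RCpow. rewrite ln_1.
        replace ((1 - s) * RtoC 0)%C with (RtoC 0) by ring. rewrite Cexp_R, exp_0. reflexivity. }
    rewrite RtoC_m1. field. exact H1s. }
  set (x := (series_coef 0 s u - (/ (s - 1) + s * neg_prim u (series_coef 0 (s + 1))))%C).
  assert (Hx : x = RtoC 0).
  { apply (Cmod_small_zero x (fun N => tail M N + (Cmod (p N) * / Cmod (1 - s)%C + Cmod s * (2 * (1 + be) * tail M' N)))).
    - intros N.
      replace x with ((series_coef 0 s u - Csum (fun nu => pow_coef 0 s (INR nu + u)) N) +
        (p N / (1 - s) + - (s * neg_prim u (fun v => series_coef 0 (s + 1) v - Csum (fun nu => pow_coef 0 (s + 1) (INR nu + v)) N))))%C.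
      + eapply Rle_trans; [apply Cmod_triangle|]. apply Rplus_le_compat.
        * apply (CSer_tail _ M N D).
        * eapply Rle_trans; [apply Cmod_triangle|]. apply Rplus_le_compat.
          -- rewrite Cmod_div by exact H1s. lra.
          -- rewrite Cmod_opp, Cmod_mult. apply Rmult_le_compat_l; [apply Cmod_ge_0|].
             apply neg_prim_bound with al; auto.
             ++ apply (posc_plus _ (fun v => - _)%C); [now apply series_coef_posc|].
                intros v Hv. apply ccont_ext with (fun v => RtoC (-1) * Csum (fun nu => pow_coef 0 (s + 1) (INR nu + v)) N)%C.
                { intros; apply injective_projections; simpl; ring. }
                apply ccont_mult; [apply ccont_const|].
                apply ccont_Csum. intros k. apply (posc_pow_coef_shift 0 (s + 1) (INR k)); [apply pos_INR|assumption].
             ++ intros v Hv. apply (CSer_tail _ M' N (D' v Hv)).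
      + rewrite neg_prim_minus; [|assumption|now apply series_coef_posc|].
        2:{ apply posc_Csum. intros k. apply posc_pow_coef_shift, pos_INR. }
        replace (s * (neg_prim u (series_coef 0 (s + 1)) - neg_prim u (fun v => Csum (fun nu => pow_coef 0 (s + 1) (INR nu + v)) N)))%C
          with (s * neg_prim u (series_coef 0 (s + 1)) - (s * neg_prim u (fun v => Csum (fun nu => pow_coef 0 (s + 1) (INR nu + v)) N)))%C by ring.
        rewrite EN. unfold x. field. split; assumption.
    - replace (Finite 0) with (Finite (0 + (0 * / Cmod (1 - s)%C + Cmod s * (2 * (1 + be) * 0)))) by (f_equal; ring).
      apply is_lim_seq_plus'; [apply tail_lim, D|].
      apply is_lim_seq_plus'.
      + apply (is_lim_seq_scal_r _ (/ Cmod (1 - s)%C) 0).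
        apply is_lim_seq_ext with (fun N => exp (- (Re s - 1) * ln (INR (S N)))).
        * intros N. unfold p. rewrite Cmod_RCpow. f_equal. destruct s; simpl. ring.
        * apply lim_exp_neg; [lra|apply lim_ln_INR].
      + apply (is_lim_seq_scal_l _ (Cmod s) (2 * (1 + be) * 0)).
        apply (is_lim_seq_scal_l _ (2 * (1 + be)) 0). apply tail_lim.
        apply (D' u Hu'). }
  replace (series_coef 0 s u) with (x + (/ (s - 1) + s * neg_prim u (series_coef 0 (s + 1))))%C by (unfold x; ring).
  rewrite Hx. ring.
Qed.

(** The Taylor coefficients at [s] of [zeta(s,u) - 1/(s-1)]. Level [0] is given by the
    series for [Re s > 1]; level [M+1] is computed from level [M] at [s+1], by
    [g(s,u) = 3/2 - u + s J_u(g(s+1,.))] expanded in powers of [w] with [s + w] in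
    place of [s]. Level [M] is meaningful for [Re s > 1 - M]. *)
Fixpoint reg_coef (M k : nat) (s : C) (u : R) {struct M} : C :=
  match M with
  | O => (series_coef k s u - RtoC (-1) ^ k / (s - 1) ^ S k)%C
  | S M' =>
      match k with
      | O => (RtoC (3 / 2 - u) + s * neg_prim u (reg_coef M' 0 (s + 1)%C))%C
      | S k' => (s * neg_prim u (reg_coef M' k (s + 1)%C) + neg_prim u (reg_coef M' k' (s + 1)%C))%C
      end
  end.

Lemma posc_const z : posc (fun _ => z).
Proof. intros v _. apply ccont_const. Qed.

Lemma posc_affine a : posc (fun u => RtoC (a - u)).
Proof.
  intros v _. apply ccont_RtoC.
  exact (continuous_minus (V := R_NormedModule) _ _ v (continuous_const a v) (continuous_id v)).
Qed.

Lemma Re_plus1 s : Re (s + 1)%C = Re s + 1.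
Proof. reflexivity. Qed.

Lemma reg_coef_posc M : forall k s, 1 - INR M < Re s -> posc (reg_coef M k s).
Proof.
  induction M as [|M IH]; intros k s Hs.
  - simpl in *. apply (posc_plus (series_coef k s) (fun _ => - _)%C); [apply series_coef_posc; lra|apply posc_const].
  - rewrite S_INR in Hs.
    assert (P : forall k, posc (fun u => neg_prim u (reg_coef M k (s + 1)%C))).
    { intros j. apply posc_neg_prim, IH. rewrite Re_plus1. lra. }
    destruct k as [|k]; simpl.
    + apply posc_plus; [apply posc_affine|]. apply posc_scal, P.
    + apply posc_plus; [|apply P]. apply posc_scal, P.
Qed.

Lemma expands_const r a : 0 < r ->
  expands r (Cmod a) (fun k => match k with O => a | S _ => RtoC 0 end) (fun _ => a).
Proof.
  intros Hr [|n] w Hw.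
  - simpl. replace (a - 0)%C with a by ring. lra.
  - rewrite Csum_first. rewrite Csum_zero by (intros; ring). simpl.
    replace (a - (a * 1 + 0))%C with (RtoC 0) by ring. rewrite Cmod_0.
    apply Rmult_le_pos; [apply Cmod_ge_0|]. apply (pow_le _ (S n)). apply Rdiv_le_0_compat; [apply Cmod_ge_0|assumption].
Qed.

(** The remainder inequality at [s+1] holds uniformly for [v] between [al] and [be],
    so it survives the operator [neg_prim]. *)
Lemma reg_coef_expands M : forall s al be, 1 - INR M < Re s -> 0 < al <= 1 -> 2 <= be ->
  exists r B, 0 < r /\ forall u, al <= u <= be ->
    expands r B (fun k => reg_coef M k s u) (fun w => reg_coef M 0 (s + w)%C u).
Proof.
  induction M as [|M IH]; intros s al be Hs Ha Hb.
  - simpl in Hs.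
    assert (Hs1 : (s - 1)%C <> RtoC 0) by (apply Re_neq_nonzero; destruct s; simpl in *; lra).
    assert (Hp : 0 < Cmod (s - 1)) by now apply Cmod_gt_0.
    assert (Hr : 0 < rad s) by (unfold rad; lra).
    exists (Rmin (rad s) (Cmod (s - 1)%C / 2)), (Series (majorant s al be) + 2 / Cmod (s - 1)%C).
    assert (Hr' : 0 < Rmin (rad s) (Cmod (s - 1)%C / 2)) by (apply Rmin_glb_lt; lra).
    split; [assumption|]. intros u Hu.
    apply expands_ext with (c := fun k => (series_coef k s u - RtoC (-1) ^ k / (s - 1) ^ S k)%C)
      (f := fun w => (series_coef 0 (s + w) u - / (s - 1 + w))%C).
    + reflexivity.
    + intros w _. simpl. unfold Cdiv. rewrite Cmult_1_l, Cmult_1_r. replace (s + w - 1)%C with (s - 1 + w)%C by ring. reflexivity.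
    + apply expands_minus.
      * eapply expands_shrink; [split; [exact Hr'|apply Rmin_l]|]. apply series_coef_expands; lra.
      * eapply expands_shrink; [split; [exact Hr'|apply Rmin_r]|]. now apply expands_inv.
  - rewrite S_INR in Hs.
    destruct (IH (s + 1)%C al be) as [r0 [B [Hr0 HB]]]; [rewrite Re_plus1; lra|assumption|assumption|].
    set (d := Re s + INR M). assert (Hd : 0 < d) by (unfold d; lra).
    set (r := Rmin r0 (d / 2)).
    assert (Hr : 0 < r) by (apply Rmin_glb_lt; lra).
    set (K := 2 * (1 + be) * B).
    exists r, (3 / 2 + be + (Cmod s * K + r * K)). split; [assumption|]. intros u Hu.
    assert (HJ : expands r K (fun k => neg_prim u (reg_coef M k (s + 1)%C)) (fun w => neg_prim u (reg_coef M 0 (s + 1 + w)%C))).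
    { intros n w Hw.
      assert (Hw' : 1 - INR M < Re (s + 1 + w)).
      { pose proof (re_le_Cmod w) as R1. pose proof (Rle_abs (- Re w)) as R2. rewrite Rabs_Ropp in R2.
        pose proof (Rmin_r r0 (d / 2)). fold r in H.
        replace (Re (s + 1 + w)) with (Re s + 1 + Re w) by (destruct s, w; reflexivity). unfold d in *. lra. }
      rewrite (Csum_ext _ (fun k => w ^ k * neg_prim u (reg_coef M k (s + 1)%C))%C) by (intros; ring).
      rewrite (Csum_ext _ (fun k => neg_prim u (fun v => w ^ k * reg_coef M k (s + 1)%C v)%C)).
      2:{ intros k _. rewrite neg_prim_scal; [reflexivity|lra|]. apply reg_coef_posc. rewrite Re_plus1. lra. }
      assert (P : forall k, posc (fun v => w ^ k * reg_coef M k (s + 1)%C v)%C).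
      { intros k. apply posc_scal, reg_coef_posc. rewrite Re_plus1. lra. }
      rewrite <- (neg_prim_Csum u (fun k v => w ^ k * reg_coef M k (s + 1)%C v)%C) by (auto; lra).
      rewrite <- neg_prim_minus by (auto using reg_coef_posc, posc_Csum; lra).
      unfold K. rewrite Rmult_assoc.
      apply neg_prim_bound with al; auto.
      - intros v Hv. apply (ccont_plus _ (fun v => - _)%C); [now apply reg_coef_posc|].
        apply ccont_ext with (fun v => RtoC (-1) * Csum (fun k => w ^ k * reg_coef M k (s + 1) v) n)%C.
        { intros; apply injective_projections; simpl; ring. }
        apply ccont_mult; [apply ccont_const|]. now apply posc_Csum.
      - intros v Hv. rewrite (Csum_ext _ (fun k => reg_coef M k (s + 1) v * w ^ k)%C) by (intros; ring).
        apply (expands_shrink r0 r B _ _ (conj Hr (Rmin_l _ _)) (HB v Hv)). exact Hw. }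
    apply (expands_mono r (Cmod (RtoC (3 / 2 - u)) + (Cmod s * K + r * K))); [assumption| |].
    { apply Rplus_le_compat_r. rewrite Cmod_R. apply Rabs_le. lra. }
    eapply expands_ext; [| |apply expands_plus; [apply (expands_const r (RtoC (3 / 2 - u)) Hr)|
      apply expands_plus; [apply expands_scal, HJ|apply expands_mulw; [exact Hr|exact HJ]]]].
    + intros [|k]; unfold shift_coef; simpl; ring.
    + intros w Hw. cbv beta. simpl. replace (s + w + 1)%C with (s + 1 + w)%C by ring. ring.
Qed.

Lemma reg_coef_expands_pt M s u : 1 - INR M < Re s -> 0 < u ->
  exists r B, 0 < r /\ expands r B (fun k => reg_coef M k s u) (fun w => reg_coef M 0 (s + w)%C u).
Proof.
  intros Hs Hu.
  destruct (reg_coef_expands M s (Rmin 1 u) (Rmax 2 u) Hs) as [r [B [Hr HB]]].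
  - split; [apply Rmin_glb_lt; lra|apply Rmin_l].
  - apply Rmax_l.
  - exists r, B. split; [assumption|]. apply HB. split; [apply Rmin_r|apply Rmax_r].
Qed.

Lemma neg_prim_1 u : 0 < u -> neg_prim u (fun _ => RtoC 1) = RtoC (3 / 2 - u).
Proof.
  intros Hu. rewrite (neg_prim_deriv (fun v => RtoC v)); [|assumption| |apply posc_const].
  - rewrite (CRInt_deriv (fun v => RtoC (v ^ 2 / 2))).
    + apply injective_projections; simpl; field.
    + intros v Hv. apply (cderiv_RtoC (fun v => v ^ 2 / 2)). auto_derive; [trivial|field].
    + intros v _. apply ccont_RtoC. apply continuous_id.
  - intros v Hv. apply (cderiv_RtoC (fun v => v)). exact (is_derive_id (v : R_AbsRing)).
Qed.

(** For [Re s > 1] this is the recursion satisfied by the series; subtracting the pole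
    [1/s] of [zeta(s+1,.)] contributes exactly [u - 3/2]. *)
Lemma reg_coef_step M : forall s u, 1 - INR M < Re s -> 0 < u -> reg_coef (S M) 0 s u = reg_coef M 0 s u.
Proof.
  induction M as [|M IH]; intros s u Hs Hu.
  - simpl in Hs.
    assert (Hs0 : s <> RtoC 0) by (apply Re_neq_nonzero; lra).
    assert (Hs1 : (s - 1)%C <> RtoC 0) by (apply Re_neq_nonzero; destruct s; simpl in *; lra).
    change (reg_coef 1 0 s u) with (RtoC (3 / 2 - u) + s * neg_prim u (fun v => (series_coef 0 (s + 1) v - RtoC (-1) ^ 0 / (s + 1 - 1) ^ 1)%C))%C.
    change (reg_coef 0 0 s u) with (series_coef 0 s u - RtoC (-1) ^ 0 / (s - 1) ^ 1)%C.
    rewrite neg_prim_minus; [|assumption|apply series_coef_posc; rewrite Re_plus1; lra|apply posc_const].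
    rewrite (neg_prim_ext u (fun _ => RtoC (-1) ^ 0 / (s + 1 - 1) ^ 1)%C (fun _ => / s * RtoC 1)%C); [|assumption|].
    2:{ intros. replace (s + 1 - 1)%C with s by ring. simpl. field. exact Hs0. }
    rewrite neg_prim_scal, neg_prim_1 by (auto using posc_const).
    rewrite (series_coef_recursion s u) by (auto; lra). simpl. field. repeat split; assumption.
  - rewrite S_INR in Hs.
    change (RtoC (3 / 2 - u) + s * neg_prim u (reg_coef (S M) 0 (s + 1)%C) = RtoC (3 / 2 - u) + s * neg_prim u (reg_coef M 0 (s + 1)%C))%C.
    do 2 f_equal. apply neg_prim_ext; [assumption|]. intros v Hv. apply IH; [rewrite Re_plus1; lra|assumption].
Qed.

Lemma reg_coef_le M M' s u : (M <= M')%nat -> 1 - INR M < Re s -> 0 < u -> reg_coef M' 0 s u = reg_coef M 0 s u.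
Proof.
  intros HM Hs Hu. induction HM as [|M' HM IH]; [reflexivity|].
  rewrite reg_coef_step; [exact IH| |assumption]. apply le_INR in HM. lra.
Qed.

Lemma series_coef_shift s u : 1 < Re s -> 0 < u -> series_coef 0 s u = (pow_coef 0 s u + series_coef 0 s (u + 1))%C.
Proof.
  intros Hs Hu.
  assert (D : forall v, u <= v <= u + 1 -> dominated (fun nu => pow_coef 0 s (INR nu + v)) (fun nu => 2 / rad s ^ 0 * majorant s u (u + 1) nu))
    by (intros v Hv; apply pow_coef_dominated; [exact Hs|exact Hu|exact Hv]).
  apply (is_series_C_unique (fun nu => pow_coef 0 s (INR nu + u))).
  - eapply dominated_series, D. lra.
  - replace (pow_coef 0 s u) with (pow_coef 0 s (INR 0 + u)) by (simpl; now rewrite Rplus_0_l).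
    rewrite Cplus_comm.
    apply (is_series_decr_1 (K := C_AbsRing) (V := C_NormedModule) (fun nu => pow_coef 0 s (INR nu + u))).
    change (@is_series C_AbsRing C_NormedModule (fun k => pow_coef 0 s (INR (S k) + u)) (series_coef 0 s (u + 1) + pow_coef 0 s (INR 0 + u) + - pow_coef 0 s (INR 0 + u))%C).
    replace (series_coef 0 s (u + 1) + pow_coef 0 s (INR 0 + u) + - pow_coef 0 s (INR 0 + u))%C with (series_coef 0 s (u + 1)) by ring.
    apply (is_series_ext (V := C_NormedModule) (fun nu => pow_coef 0 s (INR nu + (u + 1)))).
    + intros n. rewrite S_INR. f_equal. ring.
    + eapply dominated_series, D. lra.
Qed.

(** The identity for [k = 0] is a shift of the series for [Re s > 1]. It extends to
    the half plane by the identity theorem, and the local form of that theorem then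
    gives every Taylor coefficient. *)
Lemma reg_coef_functional M k s u : 1 - INR M < Re s -> 0 < u ->
  (reg_coef M k s u - reg_coef M k s (u + 1) = pow_coef k s u)%C.
Proof.
  intros Hs Hu.
  set (h := fun z => (reg_coef M 0 z u - reg_coef M 0 z (u + 1) - pow_coef 0 z u)%C).
  assert (Hexp : forall z, 1 - INR M < Re z -> exists r B, 0 < r /\
    expands r B (fun j => reg_coef M j z u - reg_coef M j z (u + 1) - pow_coef j z u)%C (fun w => h (z + w)%C)).
  { intros z Hz.
    destruct (reg_coef_expands_pt M z u Hz Hu) as [r1 [B1 [Hr1 H1]]].
    destruct (reg_coef_expands_pt M z (u + 1) Hz ltac:(lra)) as [r2 [B2 [Hr2 H2]]].
    set (r := Rmin r1 r2). assert (Hr : 0 < r) by (apply Rmin_glb_lt; assumption).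
    eexists r, _. split; [assumption|]. unfold h.
    apply expands_minus; [apply expands_minus|].
    - eapply expands_shrink; [|exact H1]. split; [assumption|apply Rmin_l].
    - eapply expands_shrink; [|exact H2]. split; [assumption|apply Rmin_r].
    - now apply pow_coef_expands. }
  assert (H0 : forall z, 1 - INR M < Re z -> h z = RtoC 0).
  { intros [t y] Hz. apply (identity_line h y (1 - INR M) 1); [| |exact Hz].
    - intros t' Ht'. destruct (Hexp (t', y) Ht') as [r [B [Hr HB]]].
      exists r, B. eexists. split; [assumption|exact HB].
    - intros t' Ht'. unfold h.
      rewrite !(reg_coef_le 0 M) by (auto with arith; simpl; lra).
      change (reg_coef 0 0 (t', y) u) with (series_coef 0 (t', y) u - RtoC (-1) ^ 0 / ((t', y) - 1) ^ 1)%C.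
      change (reg_coef 0 0 (t', y) (u + 1)) with (series_coef 0 (t', y) (u + 1) - RtoC (-1) ^ 0 / ((t', y) - 1) ^ 1)%C.
      rewrite (series_coef_shift _ u) by (auto; simpl; lra). ring. }
  destruct (Hexp s Hs) as [r [B [Hr HB]]].
  destruct (identity_local r B _ _ Hr HB) as [Hc _].
  - intros eps He. exists (RtoC (eps / 2)). rewrite Cmod_R, Rabs_pos_eq by lra.
    split; [lra|]. apply H0. replace (Re (s + RtoC (eps / 2))) with (Re s + eps / 2) by reflexivity. lra.
  - specialize (Hc k). simpl in Hc.
    replace (reg_coef M k s u - reg_coef M k s (u + 1))%C with ((reg_coef M k s u - reg_coef M k s (u + 1) - pow_coef k s u) + pow_coef k s u)%C by ring.
    rewrite Hc. ring.
Qed.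

Lemma Im_pow_coef k t y : Im (pow_coef k (RtoC t) y) = 0.
Proof.
  unfold pow_coef, RCpow. replace (- RtoC t * RtoC (ln y))%C with (RtoC (- t * ln y)).
  - rewrite Cexp_R. simpl. ring.
  - rewrite RtoC_mult, RtoC_opp. reflexivity.
Qed.

Lemma neg_prim_real u h : (forall v, 0 < v -> Im (h v) = 0) -> 0 < u -> Im (neg_prim u h) = 0.
Proof.
  intros H Hu. simpl. rewrite (neg_primR_ext _ (fun _ => 0)) by auto.
  pose proof (f_equal snd (neg_prim_0 u)) as E. exact E.
Qed.

Lemma reg_coef_real M : forall k t u, 0 < u -> Im (reg_coef M k (RtoC t) u) = 0.
Proof.
  induction M as [|M IH]; intros k t u Hu.
  - simpl.
    assert (E1 : Im (series_coef k (RtoC t) u) = 0).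
    { change (Series (fun n => Im (pow_coef k (RtoC t) (INR n + u))) = 0). rewrite (Series_ext _ (fun n => 0 * 0)).
      - rewrite Series_scal_l. ring.
      - intros n. rewrite Im_pow_coef. ring. }
    assert (E2 : (RtoC (-1) ^ k / (RtoC t - 1) ^ S k)%C = (RtoC ((-1) ^ k) * / RtoC ((t - 1) ^ S k))%C).
    { rewrite !RtoC_pow, RtoC_minus. reflexivity. }
    change (Im (series_coef k (RtoC t) u - RtoC (-1) ^ k / (RtoC t - 1) ^ S k)%C = 0).
    rewrite E2. 
    replace (Im (series_coef k (RtoC t) u - RtoC ((-1) ^ k) * / RtoC ((t - 1) ^ S k))%C) with
      (Im (series_coef k (RtoC t) u) - Im (RtoC ((-1) ^ k) * / RtoC ((t - 1) ^ S k))%C) by reflexivity.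
    rewrite E1. simpl. unfold Rdiv. ring.
  - assert (P : forall k, Im (neg_prim u (reg_coef M k (RtoC t + 1)%C)) = 0).
    { intros j. apply neg_prim_real; [|assumption]. intros v Hv. rewrite <- RtoC_plus. now apply IH. }
    destruct k as [|k]; simpl reg_coef.
    + pose proof (P O) as P0. destruct (neg_prim u (reg_coef M 0 (RtoC t + 1)%C)). simpl in *. rewrite P0. ring.
    + pose proof (P (S k)) as P1. pose proof (P k) as P2.
      destruct (neg_prim u (reg_coef M (S k) (RtoC t + 1)%C)), (neg_prim u (reg_coef M k (RtoC t + 1)%C)). simpl in *. rewrite P1, P2. ring.
Qed.

(** * The Hurwitz zeta function and its derivatives at real points *)

(** A level that is meaningful at [s]. *)
Definition level (s : C) : nat := BinInt.Z.to_nat (up (1 - Re s)).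

Lemma level_spec s : 1 - INR (level s) < Re s.
Proof.
  unfold level. destruct (archimed (1 - Re s)) as [H _].
  destruct (BinInt.Z.le_gt_cases 0 (up (1 - Re s))) as [Hz|Hz].
  - rewrite INR_IZR_INZ, Znat.Z2Nat.id by assumption. lra.
  - apply IZR_lt in Hz. pose proof (pos_INR (BinInt.Z.to_nat (up (1 - Re s)))). lra.
Qed.

Definition Zeta (u : R) (s : C) : C := (/ (s - 1) + reg_coef (level s) 0 s u)%C.

Lemma Zeta_eq M u s : 1 - INR M < Re s -> 0 < u -> Zeta u s = (/ (s - 1) + reg_coef M 0 s u)%C.
Proof.
  intros Hs Hu. unfold Zeta. f_equal.
  rewrite <- (reg_coef_le (level s) (Nat.max M (level s))), <- (reg_coef_le M (Nat.max M (level s))); auto using level_spec; lia.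
Qed.

(** The Taylor coefficients at [s] of the Hurwitz zeta function itself. *)
Definition Zeta_coef (M k : nat) (s : C) (u : R) : C := (RtoC (-1) ^ k / (s - 1) ^ S k + reg_coef M k s u)%C.

Lemma Zeta_expands M u s : 1 - INR M < Re s -> 0 < u -> s <> RtoC 1 ->
  exists r B, 0 < r /\ expands r B (fun k => Zeta_coef M k s u) (fun w => Zeta u (s + w)%C).
Proof.
  intros Hs Hu H1.
  assert (Hs1 : (s - 1)%C <> RtoC 0).
  { intros E. apply H1. replace s with ((s - 1) + 1)%C by ring. rewrite E. ring. }
  assert (Hp : 0 < Cmod (s - 1)) by now apply Cmod_gt_0.
  destruct (reg_coef_expands_pt M s u Hs Hu) as [r1 [B1 [Hr1 HB]]].
  set (d := Re s - (1 - INR M)). assert (Hd : 0 < d) by (unfold d; lra).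
  set (r := Rmin r1 (Rmin (Cmod (s - 1)%C / 2) (d / 2))).
  assert (Hr : 0 < r) by (repeat apply Rmin_glb_lt; lra).
  assert (Hle1 : r <= r1) by apply Rmin_l.
  assert (Hle2 : r <= Cmod (s - 1)%C / 2) by (eapply Rle_trans; [apply Rmin_r|apply Rmin_l]).
  assert (Hle3 : r <= d / 2) by (eapply Rle_trans; [apply Rmin_r|apply Rmin_r]).
  eexists r, _. split; [assumption|].
  eapply expands_ext; [| |apply expands_plus;
    [eapply expands_shrink; [|apply (expands_inv (s - 1)%C Hs1)]; split; assumption|
     eapply expands_shrink; [|exact HB]; split; assumption]].
  - intros k. reflexivity.
  - intros w Hw. rewrite (Zeta_eq M); [|  |assumption].
    + replace (s + w - 1)%C with (s - 1 + w)%C by ring. reflexivity.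
    + pose proof (re_le_Cmod w) as R1. pose proof (Rle_abs (- Re w)) as R2. rewrite Rabs_Ropp in R2.
      replace (Re (s + w)) with (Re s + Re w) by (destruct s, w; reflexivity). unfold d in *. lra.
Qed.

Lemma Zeta_hurwitz a : 0 < a -> is_hurwitz_zeta a (Zeta a).
Proof.
  intros Ha. split.
  - intros s Hs.
    assert (Hs1 : (s - 1)%C <> RtoC 0) by (apply Re_neq_nonzero; destruct s; simpl in *; lra).
    rewrite (Zeta_eq 0) by (simpl; lra).
    replace (/ (s - 1) + reg_coef 0 0 s a)%C with (series_coef 0 s a).
    2:{ simpl. field. exact Hs1. }
    apply (is_series_ext (V := C_NormedModule) (fun nu => pow_coef 0 s (INR nu + a))).
    + intros nu. apply pow_coef_0.
    + eapply dominated_series. apply (pow_coef_dominated s 0 a a); lra.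
  - intros s Hs.
    destruct (Zeta_expands (level s) a s (level_spec s) Ha Hs) as [r [B [Hr HB]]].
    exists (fun k => Zeta_coef (level s) k s a), r. split; [assumption|].
    intros z Hz. replace (Zeta a z) with (Zeta a (s + (z - s))%C) by (f_equal; ring).
    apply (expands_pseries r B _ (fun w => Zeta a (s + w)%C)); assumption.
Qed.

Lemma analytic_at_pt f s : analytic_at f s -> analytic_pt f s.
Proof.
  intros [a [rho [Hrho H]]].
  destruct (pseries_expands (fun w => f (s + w)%C) a rho Hrho) as [r [B [Hr HB]]].
  - intros w Hw. specialize (H (s + w)%C). replace (s + w - s)%C with w in H by ring. auto.
  - exists r, B, a. split; assumption.
Qed.

Lemma analytic_pt_minus f g s : analytic_pt f s -> analytic_pt g s ->
  analytic_pt (fun z => f z - g z)%C s.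
Proof.
  intros [r1 [B1 [c1 [Hr1 H1]]]] [r2 [B2 [c2 [Hr2 H2]]]].
  set (r := Rmin r1 r2). assert (Hr : 0 < r) by (apply Rmin_glb_lt; assumption).
  eexists r, _, _. split; [assumption|].
  apply expands_minus.
  - eapply expands_shrink; [|exact H1]. split; [assumption|apply Rmin_l].
  - eapply expands_shrink; [|exact H2]. split; [assumption|apply Rmin_r].
Qed.

(** On the lines [Im s = y] with [y <> 0] the difference is analytic everywhere and
    vanishes far to the right; the real points other than [1] follow by vertical
    approach. *)
Lemma hurwitz_unique a f g : is_hurwitz_zeta a f -> is_hurwitz_zeta a g ->
  forall s, s <> RtoC 1 -> f s = g s.
Proof.
  intros [Sf Af] [Sg Ag].
  set (h := fun z => (f z - g z)%C).
  assert (Ah : forall s, s <> RtoC 1 -> analytic_pt h s).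
  { intros s Hs. apply analytic_pt_minus; apply analytic_at_pt; auto. }
  assert (H1 : forall s, 1 < Re s -> h s = RtoC 0).
  { intros s Hs. unfold h. rewrite (is_series_C_unique _ _ _ (Sf s Hs) (Sg s Hs)). ring. }
  assert (H2 : forall t y, y <> 0 -> h (t, y) = RtoC 0).
  { intros t y Hy. apply (identity_line h y (t - 1) 1); [| |lra].
    - intros t' _. apply Ah. intros E. apply Hy. now injection E.
    - intros t' Ht'. apply H1. exact Ht'. }
  assert (H3 : forall s, s <> RtoC 1 -> h s = RtoC 0).
  { intros [t y] Hs. destruct (Req_dec y 0) as [->|Hy]; [|auto].
    apply identity_punctured; [auto|]. intros y' Hy'. auto. }
  intros s Hs. replace (f s) with (h s + g s)%C by (unfold h; ring). rewrite H3 by assumption. ring.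
Qed.

Lemma hurwitz_zeta_eq a s : 0 < a -> s <> RtoC 1 -> hurwitz_zeta s a = Zeta a s.
Proof.
  intros Ha Hs. apply (hurwitz_unique a); [| |assumption].
  - unfold hurwitz_zeta. apply epsilon_spec. exists (Zeta a). now apply Zeta_hurwitz.
  - now apply Zeta_hurwitz.
Qed.

(** [C_derive] is computed along the real direction, so only the restriction of [f]
    to the real axis matters. *)
Lemma C_derive_real (f : C -> C) (G : R -> R) (t l : R) :
  locally t (fun x => f (RtoC x) = RtoC (G x)) -> is_derive G t l ->
  C_derive f (RtoC t) = RtoC l.
Proof.
  intros Hloc HG.
  assert (Ht := locally_singleton _ _ Hloc).
  assert (Hq : forall x, x <> t -> f (RtoC x) = RtoC (G x) ->
    ((f (x, 0) - f (RtoC t)) / ((x, 0) - RtoC t))%C = RtoC ((G x - G t) / (x - t))).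
  { intros x Hx E. change (x, 0) with (RtoC x). rewrite E, Ht.
    rewrite <- !RtoC_minus. rewrite <- RtoC_div by lra. reflexivity. }
  assert (L : is_lim (fun x => (G x - G t) / (x - t)) t l).
  { apply is_derive_Reals in HG. apply is_lim_spec. intros eps.
    destruct (HG eps (cond_pos eps)) as [d Hd]. exists d. refine (fun (x : R) Hx Hne => _).
    change (Rabs (x - t) < d) in Hx. change (Rabs ((G x - G t) / (x - t) - l) < eps).
    specialize (Hd (x - t) ltac:(lra)).
    replace (t + (x - t)) with x in Hd by ring. apply Hd.
    exact Hx. }
  apply injective_projections.
  - change (real (Lim (fun x : R => fst ((f (x, 0) - f (RtoC t)) / ((x, 0) - RtoC t))%C) t) = l).
    erewrite (is_lim_unique _ t l); [reflexivity|].
    eapply is_lim_ext_loc; [|exact L].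
    destruct Hloc as [d Hd]. exists d. refine (fun (x : R) Hx Hne => _).
    exact (eq_sym (f_equal fst (Hq x Hne (Hd x Hx)))).
  - change (real (Lim (fun x : R => snd ((f (x, 0) - f (RtoC t)) / ((x, 0) - RtoC t))%C) t) = 0).
    erewrite (is_lim_unique _ t 0); [reflexivity|].
    eapply is_lim_ext_loc; [|apply (is_lim_const 0)].
    destruct Hloc as [d Hd]. exists d. refine (fun (x : R) Hx Hne => _).
    exact (eq_sym (f_equal snd (Hq x Hne (Hd x Hx)))).
Qed.

Lemma expands_PSeries r B (a : nat -> C) (f : C -> C) : 0 < r -> expands r B a f ->
  Rbar_lt 0 (CV_radius (fun k => Re (a k))) /\
  forall x, Rabs x < r -> Re (f (RtoC x)) = PSeries (fun k => Re (a k)) x.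
Proof.
  intros Hr H.
  assert (P : forall x, Rabs x < r -> is_pseries (fun k => Re (a k)) x (Re (f (RtoC x)))).
  { intros x Hx.
    pose proof (expands_pseries r B a f (RtoC x) Hr H) as Hs. rewrite Cmod_R in Hs.
    specialize (Hs Hx). unfold is_pseries in *. apply is_series_Re in Hs.
    refine (is_series_ext _ _ _ _ Hs). intros k. rewrite scal_pow_n.
    rewrite pow_n_pow, <- RtoC_pow. unfold scal; simpl; unfold mult; simpl.
    destruct (a k); simpl. ring. }
  split.
  - apply Rbar_lt_le_trans with (r / 2); [simpl; lra|].
    apply Rbar_not_lt_le. intros Hlt.
    assert (E : Rabs (r / 2) = r / 2) by (apply Rabs_pos_eq; lra).
    rewrite <- E in Hlt.
    apply (CV_disk_outside _ _ Hlt).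
    assert (Hx : Rabs (r / 2) < r) by lra.
    specialize (P _ Hx).
    apply is_lim_seq_ext with (fun k => scal (pow_n (r / 2) k) (Re (a k))).
    { intros k. rewrite pow_n_pow. unfold scal; simpl; unfold mult; simpl. ring. }
    apply ex_series_lim_0. eexists; exact P.
  - intros x Hx. symmetry. apply is_pseries_unique, P, Hx.
Qed.

Lemma Zeta_real u t : 0 < u -> t <> 1 -> Zeta u (RtoC t) = RtoC (Re (Zeta u (RtoC t))).
Proof.
  intros Hu Ht.
  assert (E : Im (Zeta u (RtoC t)) = 0).
  { unfold Zeta. pose proof (reg_coef_real (level (RtoC t)) 0 t u Hu) as E.
    rewrite <- RtoC_minus, <- RtoC_inv by lra.
    change (0 + Im (reg_coef (level (RtoC t)) 0 (RtoC t) u) = 0). rewrite E. ring. }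
  apply injective_projections; [reflexivity|exact E].
Qed.

Lemma is_derive_PSeries_shift (a : nat -> R) t0 t : Rbar_lt (Rabs (t - t0)) (CV_radius a) ->
  is_derive (fun t => PSeries a (t - t0)) t (PSeries (PS_derive a) (t - t0)).
Proof.
  intros H.
  assert (D : is_derive (fun t : R => t - t0) t 1) by (auto_derive; [trivial|ring]).
  pose proof (is_derive_comp (V := R_NormedModule) (PSeries a) (fun t => t - t0) t _ _ (is_derive_PSeries a _ H) D) as HH.
  replace (PSeries (PS_derive a) (t - t0)) with (scal 1 (PSeries (PS_derive a) (t - t0)))
    by (unfold scal; simpl; unfold mult; simpl; ring).
  exact HH.
Qed.

(** Near a real point [t0 < 1] the restriction to the real axis is a real power
    series in [t - t0], which is differentiated termwise twice. *)
Lemma hurwitz_derivs M t0 u : 1 - INR M < t0 -> 0 < u -> t0 < 1 ->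
  hurwitz_zeta' (RtoC t0) u = RtoC (Re (Zeta_coef M 1 (RtoC t0) u)) /\
  hurwitz_zeta'' (RtoC t0) u = RtoC (2 * Re (Zeta_coef M 2 (RtoC t0) u)).
Proof.
  intros Ht0 Hu Ht1.
  assert (Hne : RtoC t0 <> RtoC 1) by (intros E; injection E; lra).
  destruct (Zeta_expands M u (RtoC t0) Ht0 Hu Hne) as [r [B [Hr HB]]].
  destruct (expands_PSeries r B _ _ Hr HB) as [Hrad HP].
  set (a := fun k => Re (Zeta_coef M k (RtoC t0) u)) in *.
  assert (Hd : exists d, 0 < d /\ d <= r /\ d <= 1 - t0 /\ forall x, Rabs x < d -> Rbar_lt (Rabs x) (CV_radius a)).
  { destruct (CV_radius a) as [ra| |]; simpl in Hrad; [| |contradiction].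
    - exists (Rmin ra (Rmin r (1 - t0))). repeat split.
      + repeat apply Rmin_glb_lt; lra.
      + eapply Rle_trans; [apply Rmin_r|apply Rmin_l].
      + eapply Rle_trans; [apply Rmin_r|apply Rmin_r].
      + intros x Hx. simpl. eapply Rlt_le_trans; [exact Hx|apply Rmin_l].
    - exists (Rmin r (1 - t0)). repeat split.
      + repeat apply Rmin_glb_lt; lra.
      + apply Rmin_l.
      + apply Rmin_r. }
  destruct Hd as [d [Hd0 [Hdr [Hd1 HdCV]]]].
  assert (Hz : forall t, Rabs (t - t0) < d -> hurwitz_zeta (RtoC t) u = RtoC (PSeries a (t - t0))).
  { intros t Ht. pose proof (Rle_abs (t - t0)).
    assert (t <> 1) by lra.
    rewrite hurwitz_zeta_eq; [|assumption|intros E; injection E; lra].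
    rewrite Zeta_real by assumption. f_equal. rewrite <- HP by lra.
    do 2 f_equal. apply injective_projections; simpl; ring. }
  assert (Hz' : forall t, Rabs (t - t0) < d -> hurwitz_zeta' (RtoC t) u = RtoC (PSeries (PS_derive a) (t - t0))).
  { intros t Ht. unfold hurwitz_zeta'.
    apply (C_derive_real _ (fun t => PSeries a (t - t0))).
    - assert (Hp : 0 < d - Rabs (t - t0)) by lra.
      exists (mkposreal _ Hp). intros x Hx. apply Hz.
      change (Rabs (x - t) < d - Rabs (t - t0)) in Hx.
      replace (x - t0) with ((x - t) + (t - t0)) by ring.
      eapply Rle_lt_trans; [apply Rabs_triang|]. lra.
    - apply is_derive_PSeries_shift. auto. }
  assert (H0 : Rabs (t0 - t0) < d) by (rewrite Rminus_diag, Rabs_R0; assumption).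
  split.
  - rewrite Hz' by assumption. f_equal. rewrite Rminus_diag, PSeries_0.
    unfold PS_derive. change (INR 1 * a 1%nat = a 1%nat). simpl INR. ring.
  - unfold hurwitz_zeta''.
    rewrite (C_derive_real _ (fun t => PSeries (PS_derive a) (t - t0)) t0 (PSeries (PS_derive (PS_derive a)) (t0 - t0))).
    + f_equal. rewrite Rminus_diag, PSeries_0. unfold PS_derive.
      change (INR 1 * (INR 2 * a 2%nat) = 2 * a 2%nat). simpl INR. ring.
    + exists (mkposreal _ Hd0). intros x Hx. apply Hz'. exact Hx.
    + apply is_derive_PSeries_shift. rewrite CV_radius_derive. auto.
Qed.

(** * Functions vanishing at infinity and the half-step difference *)

(** Convergence to [0] at infinity; only values at positive arguments matter. *)
Definition vanish (f : R -> R) : Prop :=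
  forall eps, 0 < eps -> exists U, 0 < U /\ forall u, U < u -> Rabs (f u) <= eps.

Lemma vanish_plus f g : vanish f -> vanish g -> vanish (fun u => f u + g u).
Proof.
  intros Hf Hg eps He.
  destruct (Hf (eps / 2) ltac:(lra)) as [U [HU HfU]].
  destruct (Hg (eps / 2) ltac:(lra)) as [V [HV HgV]].
  exists (Rmax U V). split; [eapply Rlt_le_trans; [exact HU|apply Rmax_l]|].
  intros u Hu. pose proof (Rmax_l U V). pose proof (Rmax_r U V).
  specialize (HfU u ltac:(lra)). specialize (HgV u ltac:(lra)).
  eapply Rle_trans; [apply Rabs_triang|]. lra.
Qed.

Lemma vanish_ext f g : (forall u, 0 < u -> f u = g u) -> vanish f -> vanish g.
Proof.
  intros E Hf eps He. destruct (Hf eps He) as [U [HU H]]. exists U. split; [assumption|].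
  intros u Hu. rewrite <- E by lra. auto.
Qed.

Lemma vanish_scal l f : vanish f -> vanish (fun u => l * f u).
Proof.
  intros Hf eps He. assert (Hl := Rabs_pos l).
  destruct (Hf (eps / (Rabs l + 1))) as [U [HU H]].
  { apply Rdiv_lt_0_compat; lra. }
  exists U. split; [assumption|]. intros u Hu. specialize (H u Hu).
  rewrite Rabs_mult. apply Rle_div_r in H; [|lra].
  pose proof (Rabs_pos (f u)). nra.
Qed.

Lemma vanish_le f g : (forall u, 1 <= u -> Rabs (f u) <= g u) -> vanish g -> vanish f.
Proof.
  intros H Hg eps He. destruct (Hg eps He) as [U [HU HgU]].
  exists (Rmax 1 U). pose proof (Rmax_l 1 U). pose proof (Rmax_r 1 U). split; [lra|].
  intros u Hu. specialize (H u ltac:(lra)). specialize (HgU u ltac:(lra)).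
  pose proof (Rle_abs (g u)). lra.
Qed.

Lemma vanish_shift f : vanish f -> vanish (fun u => f (u + 1 / 2)).
Proof.
  intros H eps He. destruct (H eps He) as [U [HU HfU]]. exists U. split; [assumption|].
  intros u Hu. apply HfU. lra.
Qed.

Lemma is_lim_vanish f : is_lim f p_infty 0 -> vanish f.
Proof.
  intros H eps He. apply is_lim_spec in H. destruct (H (mkposreal eps He)) as [U HU].
  exists (Rmax 1 U). pose proof (Rmax_l 1 U). pose proof (Rmax_r 1 U). split; [lra|].
  intros u Hu. specialize (HU u ltac:(lra)). simpl in HU. rewrite Rminus_0_r in HU. lra.
Qed.

Lemma vanish_inv : vanish (fun u => / u).
Proof.
  intros eps He. exists (/ eps). assert (0 < / eps) by now apply Rinv_0_lt_compat.
  split; [assumption|]. intros u Hu. rewrite Rabs_pos_eq.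
  - rewrite <- (Rinv_inv eps). apply Rinv_le_contravar; lra.
  - left. apply Rinv_0_lt_compat. lra.
Qed.

Lemma vanish_ln_div : vanish (fun u => ln u / u).
Proof. apply is_lim_vanish, is_lim_div_ln_p. Qed.

(** Oscillation over an interval of length [1/2] tending to [0] at infinity. *)
Definition slow (g : R -> R) : Prop :=
  forall eps, 0 < eps -> exists U, 0 < U /\
    forall u v, U < u -> u <= v <= u + 1 / 2 -> Rabs (g v - g u) <= eps.

Lemma slow_of_vanish g h : vanish h ->
  (forall u v, 1 <= u -> u <= v <= u + 1 / 2 -> Rabs (g v - g u) <= h u) -> slow g.
Proof.
  intros Hh H eps He. destruct (Hh eps He) as [U [HU HhU]].
  exists (Rmax 1 U). pose proof (Rmax_l 1 U). pose proof (Rmax_r 1 U). split; [lra|].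
  intros u v Hu Hv. specialize (H u v ltac:(lra) Hv). specialize (HhU u ltac:(lra)).
  pose proof (Rle_abs (h u)). lra.
Qed.

Lemma ln_increment u v : 0 < u -> u <= v -> 0 <= ln v - ln u <= (v - u) / u.
Proof.
  intros Hu Hv. pose proof (ln_le_mono u v Hu Hv) as H1. split; [lra|].
  replace (ln v) with (ln u + ln (v / u)).
  - assert (Hq : 0 < v / u) by (apply Rdiv_lt_0_compat; lra).
    pose proof (exp_ineq1_le (ln (v / u))) as H. rewrite exp_ln in H by assumption.
    replace ((v - u) / u) with (v / u - 1) by (field; lra). lra.
  - rewrite <- ln_mult; [f_equal; field; lra|lra|apply Rdiv_lt_0_compat; lra].
Qed.

Lemma ln_increment_half u v : 1 <= u -> u <= v <= u + 1 / 2 -> 0 <= ln v - ln u <= / u.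
Proof.
  intros Hu Hv. pose proof (ln_increment u v ltac:(lra) ltac:(lra)) as [H1 H2].
  split; [assumption|]. eapply Rle_trans; [exact H2|].
  unfold Rdiv. assert (0 < / u) by (apply Rinv_0_lt_compat; lra). nra.
Qed.

Lemma slow_ln : slow ln.
Proof.
  apply (slow_of_vanish _ (fun u => / u) vanish_inv). intros u v Hu Hv.
  pose proof (ln_increment_half u v Hu Hv). rewrite Rabs_pos_eq; lra.
Qed.

Lemma slow_ln2 : slow (fun u => ln u ^ 2).
Proof.
  apply (slow_of_vanish _ (fun u => 2 * (ln u / u) + / u)).
  - apply vanish_plus; [apply vanish_scal, vanish_ln_div|apply vanish_inv].
  - intros u v Hu Hv. pose proof (ln_increment_half u v Hu Hv) as [H1 H2].
    assert (H3 : 0 <= ln u) by (rewrite <- ln_1; apply ln_le_mono; lra).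
    assert (H4 : 0 < / u <= 1).
    { split; [apply Rinv_0_lt_compat; lra|]. rewrite <- Rinv_1. apply Rinv_le_contravar; lra. }
    replace (ln v ^ 2 - ln u ^ 2) with ((ln v - ln u) * (2 * ln u + (ln v - ln u))) by ring.
    rewrite Rabs_pos_eq by nra.
    unfold Rdiv. nra.
Qed.

Lemma slow_scal l f : slow f -> slow (fun u => l * f u).
Proof.
  intros Hf eps He. assert (Hl := Rabs_pos l).
  destruct (Hf (eps / (Rabs l + 1))) as [U [HU H]]; [apply Rdiv_lt_0_compat; lra|].
  exists U. split; [assumption|]. intros u v Hu Hv. specialize (H u v Hu Hv).
  replace (l * f v - l * f u) with (l * (f v - f u)) by ring.
  rewrite Rabs_mult. apply Rle_div_r in H; [|lra].
  pose proof (Rabs_pos (f v - f u)). nra.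
Qed.

Lemma slow_const a : slow (fun _ => a).
Proof.
  intros eps He. exists 1. split; [lra|]. intros. rewrite Rminus_diag, Rabs_R0. lra.
Qed.

Definition pcont (f : R -> R) : Prop := forall v, 0 < v -> continuous f v.

Definition half_int (f : R -> R) (u : R) : R := RInt f u (u + 1 / 2).

(** The average of [f] over the half step is as close to [g u] as [f] is to [g],
    up to the oscillation of [g]. *)
Lemma vanish_half_int f g : pcont f -> vanish (fun u => f u - g u) -> slow g ->
  vanish (fun u => half_int f u - 1 / 2 * g u).
Proof.
  intros Hc Hv Hs eps He.
  destruct (Hv eps He) as [U [HU HUf]]. destruct (Hs eps He) as [V [HV HVg]].
  exists (Rmax U V). pose proof (Rmax_l U V). pose proof (Rmax_r U V). split; [lra|].
  intros u Hu. unfold half_int.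
  assert (E : RInt f u (u + 1 / 2) - 1 / 2 * g u = RInt (fun v => f v - g u) u (u + 1 / 2)).
  { rewrite (RInt_minus (V := R_CompleteNormedModule) f (fun _ => g u)).
    - rewrite RInt_const. unfold minus, plus, opp, scal; simpl. unfold mult; simpl. field.
    - apply ex_RInt_pos; auto; lra.
    - apply ex_RInt_const. }
  rewrite E.
  eapply Rle_trans; [apply (RInt_abs_bound _ u (u + 1 / 2) (2 * eps))|].
  - lra.
  - lra.
  - intros v Hv0. apply (continuous_minus (V := R_NormedModule) f (fun _ => g u)); [auto|apply continuous_const].
  - intros v Hvu. rewrite Rmin_left, Rmax_right in Hvu by lra.
    replace (f v - g u) with ((f v - g v) + (g v - g u)) by ring.
    eapply Rle_trans; [apply Rabs_triang|].
    specialize (HUf v ltac:(lra)). specialize (HVg u v ltac:(lra) Hvu). lra.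
  - replace (u + 1 / 2 - u) with (1 / 2) by ring. rewrite Rabs_pos_eq; lra.
Qed.

Definition reg_coefR (M k : nat) (t u : R) : R := Re (reg_coef M k (RtoC t) u).
(** The Taylor coefficient of order [k] at [t] of [zeta(s,u+1/2) - zeta(s,u)], in which
    the poles cancel. *)
Definition half_diff (M k : nat) (t u : R) : R := reg_coefR M k t (u + 1 / 2) - reg_coefR M k t u.
Definition pow_coefR (k : nat) (t u : R) : R := Re (pow_coef k (RtoC t) u).

Lemma pow_coefR_eq k t u : pow_coefR k t u = exp (- t * ln u) * ((- ln u) ^ k / INR (fact k)).
Proof.
  unfold pow_coefR, pow_coef, RCpow. replace (- RtoC t * RtoC (ln u))%C with (RtoC (- t * ln u)).
  - rewrite Cexp_R, <- RtoC_mult. reflexivity.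
  - rewrite RtoC_mult, RtoC_opp. reflexivity.
Qed.

Lemma reg_coefR_pcont M k t : 1 - INR M < t -> pcont (reg_coefR M k t).
Proof. intros H v Hv. apply (reg_coef_posc M k (RtoC t) H v Hv). Qed.

Lemma continuous_shift_half f v : 0 < v -> pcont f -> continuous (fun u => f (u + 1 / 2)) v.
Proof.
  intros Hv Hf. apply (continuous_comp (fun u => u + 1 / 2) f).
  - exact (continuous_plus (V := R_NormedModule) _ _ v (continuous_id v) (continuous_const (1 / 2) v)).
  - apply Hf. lra.
Qed.

Lemma half_diff_pcont M k t : 1 - INR M < t -> pcont (half_diff M k t).
Proof.
  intros H v Hv. unfold half_diff.
  apply (continuous_minus (V := R_NormedModule) (fun u => reg_coefR M k t (u + 1 / 2)) (reg_coefR M k t)).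
  - apply continuous_shift_half; [assumption|now apply reg_coefR_pcont].
  - now apply reg_coefR_pcont.
Qed.

Lemma half_diff_functional M k t u : 1 - INR M < t -> 0 < u -> half_diff M k t (u + 1 / 2) + half_diff M k t u = - pow_coefR k t u.
Proof.
  intros Ht Hu. unfold half_diff. replace (u + 1 / 2 + 1 / 2) with (u + 1) by field.
  pose proof (f_equal Re (reg_coef_functional M k (RtoC t) u Ht Hu)) as H.
  change (Re (reg_coef M k (RtoC t) u) - Re (reg_coef M k (RtoC t) (u + 1)) = pow_coefR k t u) in H.
  unfold reg_coefR. lra.
Qed.

Lemma half_diff_increment M k t u : 1 - INR M < t -> 0 < u -> 
  half_diff M k t u - half_diff M k t (u + 1) = pow_coefR k t (u + 1 / 2) - pow_coefR k t u.
Proof.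
  intros Ht Hu. pose proof (half_diff_functional M k t u Ht Hu) as H1.
  pose proof (half_diff_functional M k t (u + 1 / 2) Ht ltac:(lra)) as H2.
  replace (u + 1 / 2 + 1 / 2) with (u + 1) in H2 by field. lra.
Qed.

Lemma half_int_diff f u : 0 < u -> pcont f ->
  half_int f (u + 1 / 2) - half_int f u = half_int (fun v => f (v + 1 / 2) - f v) u.
Proof.
  intros Hu Hf.
  assert (H1 : half_int f (u + 1 / 2) = half_int (fun v => f (v + 1 / 2)) u).
  { unfold half_int.
    pose proof (RInt_comp_lin (V := R_CompleteNormedModule) f 1 (1 / 2) u (u + 1 / 2)) as H.
    rewrite !Rmult_1_l in H. rewrite <- H by (apply ex_RInt_pos; auto; lra).
    apply RInt_ext. intros v _. change (1 * f (1 * v + 1 / 2) = f (v + 1 / 2)).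
    now rewrite !Rmult_1_l. }
  rewrite H1. unfold half_int. symmetry.
  apply (RInt_minus (V := R_CompleteNormedModule) (fun v => f (v + 1 / 2)) f); apply ex_RInt_pos; auto; try lra.
  intros v Hv. now apply continuous_shift_half.
Qed.

Lemma half_int_ext f g u : 0 < u -> (forall v, 0 < v -> f v = g v) -> half_int f u = half_int g u.
Proof.
  intros Hu E. apply RInt_ext. intros v Hv. rewrite Rmin_left in Hv by lra. apply E. lra.
Qed.

Lemma Re_neg_prim_diff u h : 0 < u -> posc h ->
  Re (neg_prim (u + 1 / 2) h) - Re (neg_prim u h) = - half_int (fun v => Re (h v)) u.
Proof.
  intros Hu Hh. apply (neg_primR_diff (fun v => Re (h v)) u (u + 1 / 2)); try lra. intros v Hv. now apply Hh.
Qed.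

Lemma Re_R_mult t z : Re (RtoC t * z) = t * Re z.
Proof. destruct z; simpl. ring. Qed.

Lemma half_diff_O_int M t t' u : t' = t + 1 -> 1 - INR (S M) < t -> 0 < u ->
  half_diff (S M) 0 t u = - (1 / 2) - t * half_int (reg_coefR M 0 t') u.
Proof.
  intros -> Ht Hu. rewrite S_INR in Ht. unfold half_diff, reg_coefR. simpl reg_coef.
  rewrite <- !RtoC_plus.
  assert (P : posc (reg_coef M 0 (RtoC (t + 1)))) by (apply reg_coef_posc; simpl; lra).
  pose proof (Re_neg_prim_diff u _ Hu P) as H.
  change (Re (RtoC (3 / 2 - (u + 1 / 2)) + RtoC t * neg_prim (u + 1 / 2) (reg_coef M 0 (RtoC (t + 1)))))
    with (3 / 2 - (u + 1 / 2) + Re (RtoC t * neg_prim (u + 1 / 2) (reg_coef M 0 (RtoC (t + 1))))).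
  change (Re (RtoC (3 / 2 - u) + RtoC t * neg_prim u (reg_coef M 0 (RtoC (t + 1)))))
    with (3 / 2 - u + Re (RtoC t * neg_prim u (reg_coef M 0 (RtoC (t + 1))))).
  rewrite !Re_R_mult. unfold reg_coefR in *. nra.
Qed.

Lemma half_diff_S_int M k t t' u : t' = t + 1 -> 1 - INR (S M) < t -> 0 < u ->
  half_diff (S M) (S k) t u = - t * half_int (reg_coefR M (S k) t') u - half_int (reg_coefR M k t') u.
Proof.
  intros -> Ht Hu. rewrite S_INR in Ht. unfold half_diff, reg_coefR. simpl reg_coef.
  rewrite <- !RtoC_plus.
  assert (P : forall k, posc (reg_coef M k (RtoC (t + 1)))) by (intros; apply reg_coef_posc; simpl; lra).
  pose proof (Re_neg_prim_diff u _ Hu (P k)) as H.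
  pose proof (Re_neg_prim_diff u _ Hu (P (S k))) as H'.
  change (Re (RtoC t * neg_prim (u + 1 / 2) (reg_coef M (S k) (RtoC (t + 1))) + neg_prim (u + 1 / 2) (reg_coef M k (RtoC (t + 1)))))
    with (Re (RtoC t * neg_prim (u + 1 / 2) (reg_coef M (S k) (RtoC (t + 1)))) + Re (neg_prim (u + 1 / 2) (reg_coef M k (RtoC (t + 1))))).
  change (Re (RtoC t * neg_prim u (reg_coef M (S k) (RtoC (t + 1))) + neg_prim u (reg_coef M k (RtoC (t + 1)))))
    with (Re (RtoC t * neg_prim u (reg_coef M (S k) (RtoC (t + 1)))) + Re (neg_prim u (reg_coef M k (RtoC (t + 1))))).
  rewrite !Re_R_mult. unfold reg_coefR in *. nra.
Qed.

(** The functional equation determines [half_diff] from its increment over half a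
    step, and the recursion makes that increment an average of the level below at
    [t + 1]. *)
Lemma half_diff_O_avg M t t' u : t' = t + 1 -> 1 - INR (S M) < t -> 0 < u ->
  2 * half_diff (S M) 0 t u = - pow_coefR 0 t u + t * half_int (half_diff M 0 t') u.
Proof.
  intros E Ht Hu. pose proof (half_diff_functional (S M) 0 t u Ht Hu) as H.
  rewrite (half_diff_O_int M t t' (u + 1 / 2)) in H by (auto; lra).
  pose proof (half_diff_O_int M t t' u E Ht Hu) as H1.
  assert (P : pcont (reg_coefR M 0 t')) by (apply reg_coefR_pcont; rewrite S_INR in Ht; lra).
  pose proof (half_int_diff _ u Hu P) as D. fold (half_diff M 0 t') in D.
  change (half_int (fun v => reg_coefR M 0 t' (v + 1 / 2) - reg_coefR M 0 t' v) u) with (half_int (half_diff M 0 t') u) in D.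
  nra.
Qed.

(** As [half_diff_O_avg]; the factor [t + w] of the recursion brings in the
    coefficient of order [k]. *)
Lemma half_diff_S_avg M k t t' u : t' = t + 1 -> 1 - INR (S M) < t -> 0 < u ->
  2 * half_diff (S M) (S k) t u = - pow_coefR (S k) t u + t * half_int (half_diff M (S k) t') u + half_int (half_diff M k t') u.
Proof.
  intros E Ht Hu. pose proof (half_diff_functional (S M) (S k) t u Ht Hu) as H.
  rewrite (half_diff_S_int M k t t' (u + 1 / 2)) in H by (auto; lra).
  pose proof (half_diff_S_int M k t t' u E Ht Hu) as H1.
  assert (P : forall k, pcont (reg_coefR M k t')) by (intros; apply reg_coefR_pcont; rewrite S_INR in Ht; lra).
  pose proof (half_int_diff _ u Hu (P k)) as D.
  change (half_int (fun v => reg_coefR M k t' (v + 1 / 2) - reg_coefR M k t' v) u) with (half_int (half_diff M k t') u) in D.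
  pose proof (half_int_diff _ u Hu (P (S k))) as D'.
  change (half_int (fun v => reg_coefR M (S k) t' (v + 1 / 2) - reg_coefR M (S k) t' v) u) with (half_int (half_diff M (S k) t') u) in D'.
  nra.
Qed.

(** * Asymptotics of the half-step difference *)

(** At [s = 2] and radius [1/4] the terms are at most [y^(-3/2)] up to a constant,
    and [y^(-3/2) <= u^(-1/4) (nu+1)^(-5/4)]. *)
Lemma series_coef_decay k u : 1 <= u ->
  Cmod (series_coef k (RtoC 2) u) <= exp (- (1 / 4) * ln u) *
     (2 / (1 / 4) ^ k * Series (fun n => exp (- (5 / 4) * ln (INR (S n))))).
Proof.
  intros Hu.
  set (K := 2 / (1 / 4) ^ k).
  assert (Hq : 0 < (1 / 4) ^ k) by (apply pow_lt; lra).
  assert (HK : 0 < K) by (apply Rdiv_lt_0_compat; lra).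
  assert (D : dominated (fun nu => pow_coef k (RtoC 2) (INR nu + u))
    (fun nu => exp (- (1 / 4) * ln u) * K * exp (- (5 / 4) * ln (INR (S nu))))).
  { split.
    - apply ex_series_scal_l with (c := exp (- (1 / 4) * ln u) * K) (a := fun nu => exp (- (5 / 4) * ln (INR (S nu)))).
      apply ex_series_zeta. lra.
    - intros nu. assert (Hnu := pos_INR nu).
      set (y := INR nu + u).
      pose proof (expands_coef (1 / 4) _ _ _ k ltac:(lra) (pow_coef_expands (1 / 4) (RtoC 2) y ltac:(lra))) as H.
      assert (Hy : 0 <= ln y) by (rewrite <- ln_1; apply ln_le_mono; unfold y; lra).
      rewrite Rabs_pos_eq in H by assumption. simpl Re in H.
      replace (- (2) * ln y + 2 * (1 / 4) * ln y) with (- (1 / 4) * ln y + - (5 / 4) * ln y) in H by field.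
      rewrite exp_plus in H.
      assert (H1 : exp (- (1 / 4) * ln y) <= exp (- (1 / 4) * ln u)).
      { apply exp_le_mono. pose proof (ln_le_mono u y ltac:(lra) ltac:(unfold y; lra)). lra. }
      assert (H2 : exp (- (5 / 4) * ln y) <= exp (- (5 / 4) * ln (INR (S nu)))).
      { apply exp_le_mono. pose proof (ln_le_mono (INR (S nu)) y ltac:(rewrite S_INR; lra) ltac:(unfold y; rewrite S_INR; lra)). lra. }
      assert (H3 : exp (- (1 / 4) * ln y) * exp (- (5 / 4) * ln y) <= exp (- (1 / 4) * ln u) * exp (- (5 / 4) * ln (INR (S nu)))).
      { apply Rmult_le_compat; try assumption; left; apply exp_pos. }
      apply Rle_trans with (K * (exp (- (1 / 4) * ln y) * exp (- (5 / 4) * ln y))).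
      + unfold K. replace (2 / (1 / 4) ^ k * (exp (- (1 / 4) * ln y) * exp (- (5 / 4) * ln y)))
          with (2 * (exp (- (1 / 4) * ln y) * exp (- (5 / 4) * ln y)) / (1 / 4) ^ k) by (field; lra).
        apply Rle_div_r; assumption.
      + replace (exp (- (1 / 4) * ln u) * K * exp (- (5 / 4) * ln (INR (S nu))))
          with (K * (exp (- (1 / 4) * ln u) * exp (- (5 / 4) * ln (INR (S nu))))) by ring.
        apply Rmult_le_compat_l; lra. }
  rewrite <- Rmult_assoc, <- Series_scal_l.
  eapply is_series_bound; [exact D|]. eapply dominated_series, D.
Qed.

Lemma vanish_exp_neg q : 0 < q -> vanish (fun u => exp (- q * ln u)).
Proof.
  intros Hq eps He. exists (exp (- ln eps / q)). split; [apply exp_pos|].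
  intros u Hu. rewrite Rabs_pos_eq by (left; apply exp_pos).
  rewrite <- (exp_ln eps) at 1 by assumption. apply exp_le_mono.
  assert (Hl : - ln eps / q < ln u).
  { rewrite <- (ln_exp (- ln eps / q)). apply ln_increasing; [apply exp_pos|assumption]. }
  apply Rlt_div_l in Hl; [|assumption]. lra.
Qed.

Lemma half_diff_2_vanish k : vanish (half_diff 0 k 2).
Proof.
  set (S0 := 2 / (1 / 4) ^ k * Series (fun n => exp (- (5 / 4) * ln (INR (S n))))).
  apply (vanish_le _ (fun u => S0 * exp (- (1 / 4) * ln (u + 1 / 2)) + S0 * exp (- (1 / 4) * ln u))).
  - intros u Hu.
    replace (half_diff 0 k 2 u) with (Re (series_coef k (RtoC 2) (u + 1 / 2)) + - Re (series_coef k (RtoC 2) u)).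
    2:{ unfold half_diff, reg_coefR. simpl reg_coef. unfold Cminus.
        change (Re (?a + ?b)%C) with (Re a + Re b).
        set (p := (- (RtoC (-1) ^ k / (RtoC 2 + - RtoC 1) ^ S k))%C).
        change (Re (series_coef k 2 (u + 1 / 2) + p)) with (Re (series_coef k 2 (u + 1 / 2)) + Re p).
        change (Re (series_coef k 2 u + p)) with (Re (series_coef k 2 u) + Re p). ring. }
    eapply Rle_trans; [apply Rabs_triang|]. rewrite Rabs_Ropp.
    apply Rplus_le_compat; (eapply Rle_trans; [apply re_le_Cmod|]);
      rewrite (Rmult_comm S0); apply series_coef_decay; lra.
  - apply vanish_plus.
    + apply (vanish_shift (fun u => S0 * exp (- (1 / 4) * ln u))).
      apply vanish_scal, vanish_exp_neg. lra.
    + apply vanish_scal, vanish_exp_neg. lra.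
Qed.

Lemma vanish_half_int0 f : pcont f -> vanish f -> vanish (half_int f).
Proof.
  intros Hc Hf.
  apply (vanish_ext (fun u => half_int f u - 1 / 2 * 0)); [intros; ring|].
  apply (vanish_half_int f (fun _ => 0)); [assumption| |apply slow_const].
  apply (vanish_ext f); [intros; ring|assumption].
Qed.

Lemma exp_ln_neg u : 0 < u -> exp (- (1) * ln u) = / u.
Proof.
  intros Hu. replace (- (1) * ln u) with (- ln u) by ring. now rewrite exp_Ropp, exp_ln.
Qed.

Lemma half_diff_1_0 : vanish (half_diff 1 0 1).
Proof.
  apply (vanish_ext (fun u => 1 / 2 * (-1 * / u + half_int (half_diff 0 0 2) u))).
  - intros u Hu. pose proof (half_diff_O_avg 0 1 2 u ltac:(lra) ltac:(simpl; lra) Hu) as H.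
    rewrite pow_coefR_eq, exp_ln_neg in H by assumption. simpl pow in H. simpl fact in H. simpl INR in H. lra.
  - apply vanish_scal, vanish_plus; [apply vanish_scal, vanish_inv|].
    apply vanish_half_int0; [apply half_diff_pcont; simpl; lra|apply half_diff_2_vanish].
Qed.

Lemma half_diff_1_1 : vanish (half_diff 1 1 1).
Proof.
  apply (vanish_ext (fun u => 1 / 2 * (ln u / u + (half_int (half_diff 0 1 2) u + half_int (half_diff 0 0 2) u)))).
  - intros u Hu. pose proof (half_diff_S_avg 0 0 1 2 u ltac:(lra) ltac:(simpl; lra) Hu) as H.
    rewrite pow_coefR_eq, exp_ln_neg in H by assumption. simpl pow in H. simpl fact in H. simpl INR in H.
    unfold Rdiv in *. lra.
  - apply vanish_scal, vanish_plus; [apply vanish_ln_div|].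
    apply vanish_plus; (apply vanish_half_int0; [apply half_diff_pcont; simpl; lra|apply half_diff_2_vanish]).
Qed.

Lemma exp_ln_0 u : exp (- 0 * ln u) = 1.
Proof. replace (- 0 * ln u) with 0 by ring. apply exp_0. Qed.

Lemma half_diff_0_0 u : 0 < u -> half_diff 2 0 0 u = - (1 / 2).
Proof.
  intros Hu. pose proof (half_diff_O_avg 1 0 1 u ltac:(lra) ltac:(simpl; lra) Hu) as H.
  rewrite pow_coefR_eq, exp_ln_0 in H. simpl pow in H. simpl fact in H. simpl INR in H. lra.
Qed.

Lemma half_diff_0_1 : vanish (fun u => half_diff 2 1 0 u - 1 / 2 * ln u).
Proof.
  apply (vanish_ext (fun u => 1 / 2 * half_int (half_diff 1 0 1) u)).
  - intros u Hu. pose proof (half_diff_S_avg 1 0 0 1 u ltac:(lra) ltac:(simpl; lra) Hu) as H.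
    rewrite pow_coefR_eq, exp_ln_0 in H. simpl pow in H. simpl fact in H. simpl INR in H. lra.
  - apply vanish_scal, vanish_half_int0; [apply half_diff_pcont; simpl; lra|apply half_diff_1_0].
Qed.

Lemma half_diff_0_2 : vanish (fun u => half_diff 2 2 0 u + 1 / 4 * ln u ^ 2).
Proof.
  apply (vanish_ext (fun u => 1 / 2 * half_int (half_diff 1 1 1) u)).
  - intros u Hu. pose proof (half_diff_S_avg 1 1 0 1 u ltac:(lra) ltac:(simpl; lra) Hu) as H.
    rewrite pow_coefR_eq, exp_ln_0 in H. simpl pow in *. simpl fact in H. simpl INR in H. lra.
  - apply vanish_scal, vanish_half_int0; [apply half_diff_pcont; simpl; lra|apply half_diff_1_1].
Qed.

Lemma exp_ln_m1 u : 0 < u -> exp (- -1 * ln u) = u.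
Proof. intros Hu. replace (- -1 * ln u) with (ln u) by ring. now apply exp_ln. Qed.

Lemma half_int_const a u : half_int (fun _ => a) u = 1 / 2 * a.
Proof.
  unfold half_int. rewrite RInt_const. unfold scal; simpl. unfold mult; simpl. field.
Qed.

Lemma half_diff_m1_0 u : 0 < u -> half_diff 3 0 (-1) u = 1 / 2 * (- u + 1 / 4).
Proof.
  intros Hu. pose proof (half_diff_O_avg 2 (-1) 0 u ltac:(lra) ltac:(simpl; lra) Hu) as H.
  rewrite pow_coefR_eq, exp_ln_m1 in H by assumption.
  rewrite (half_int_ext _ (fun _ => - (1 / 2)) u Hu half_diff_0_0), half_int_const in H.
  simpl pow in H. simpl fact in H. simpl INR in H. lra.
Qed.

Lemma half_diff_m1_1 : vanish (fun u => 2 * half_diff 3 1 (-1) u - (u * ln u - 1 / 4 * ln u - 1 / 4)).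
Proof.
  apply (vanish_ext (fun u => -1 * (half_int (half_diff 2 1 0) u - 1 / 2 * (1 / 2 * ln u)))).
  - intros u Hu. pose proof (half_diff_S_avg 2 0 (-1) 0 u ltac:(lra) ltac:(simpl; lra) Hu) as H.
    rewrite pow_coefR_eq, exp_ln_m1 in H by assumption.
    rewrite (half_int_ext (half_diff 2 0 0) (fun _ => - (1 / 2)) u Hu half_diff_0_0), half_int_const in H.
    simpl pow in H. simpl fact in H. simpl INR in H. lra.
  - apply vanish_scal, (vanish_half_int (half_diff 2 1 0) (fun u => 1 / 2 * ln u)).
    + apply half_diff_pcont; simpl; lra.
    + apply half_diff_0_1.
    + apply slow_scal, slow_ln.
Qed.

Lemma half_diff_m1_2 : vanish (fun u => 2 * half_diff 3 2 (-1) u - (- (1 / 2) * u * ln u ^ 2 + 1 / 8 * ln u ^ 2 + 1 / 4 * ln u)).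
Proof.
  apply (vanish_ext (fun u => -1 * (half_int (half_diff 2 2 0) u - 1 / 2 * (- (1 / 4) * ln u ^ 2)) +
     (half_int (half_diff 2 1 0) u - 1 / 2 * (1 / 2 * ln u)))).
  - intros u Hu. pose proof (half_diff_S_avg 2 1 (-1) 0 u ltac:(lra) ltac:(simpl; lra) Hu) as H.
    rewrite pow_coefR_eq, exp_ln_m1 in H by assumption.
    simpl pow in *. simpl fact in H. simpl INR in H. lra.
  - apply vanish_plus; [apply vanish_scal|].
    + apply (vanish_half_int (half_diff 2 2 0) (fun u => - (1 / 4) * ln u ^ 2)).
      * apply half_diff_pcont; simpl; lra.
      * apply (vanish_ext (fun u => half_diff 2 2 0 u + 1 / 4 * ln u ^ 2)); [intros; ring|apply half_diff_0_2].
      * apply slow_scal, slow_ln2.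
    + apply (vanish_half_int (half_diff 2 1 0) (fun u => 1 / 2 * ln u)).
      * apply half_diff_pcont; simpl; lra.
      * apply half_diff_0_1.
      * apply slow_scal, slow_ln.
Qed.

(** The regularised sum of the differences of [pair_log] over [u, u+1, ...]: in
    [pair_log], the function [y^j (ln y)^i] is replaced by [(-1)^i i!] times the
    coefficient of order [i] at [-j]. *)
Definition reg_log (x u : R) : R :=
  4 * half_diff 3 2 (-1) u - 4 * ln 2 * half_diff 3 1 (-1) u + 2 * ln 2 ^ 2 * half_diff 3 0 (-1) u
  - x * (2 * half_diff 2 2 0 u - 2 * ln 2 * half_diff 2 1 0 u + ln 2 ^ 2 * half_diff 2 0 0 u).

Definition pair_log (x y : R) : R := (2 * y - x) * (ln 2 + ln y) ^ 2.

Lemma reg_log_increment x u : 0 < u -> reg_log x u - reg_log x (u + 1) = pair_log x (u + 1 / 2) - pair_log x u.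
Proof.
  intros Hu.
  pose proof (half_diff_increment 3 2 (-1) u ltac:(simpl; lra) Hu) as H32.
  pose proof (half_diff_increment 3 1 (-1) u ltac:(simpl; lra) Hu) as H31.
  pose proof (half_diff_increment 3 0 (-1) u ltac:(simpl; lra) Hu) as H30.
  pose proof (half_diff_increment 2 2 0 u ltac:(simpl; lra) Hu) as H22.
  pose proof (half_diff_increment 2 1 0 u ltac:(simpl; lra) Hu) as H21.
  pose proof (half_diff_increment 2 0 0 u ltac:(simpl; lra) Hu) as H20.
  rewrite !pow_coefR_eq in *. rewrite !exp_ln_m1 in * by lra. rewrite !exp_ln_0 in *.
  simpl pow in *. simpl fact in *. simpl INR in *.
  set (L := ln u) in *. set (L' := ln (u + 1 / 2)) in *. set (l := ln 2) in *.
  unfold reg_log, pair_log. fold L L' l.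
  replace (_ - _) with
   (4 * (half_diff 3 2 (-1) u - half_diff 3 2 (-1) (u + 1)) - 4 * l * (half_diff 3 1 (-1) u - half_diff 3 1 (-1) (u + 1))
    + 2 * l ^ 2 * (half_diff 3 0 (-1) u - half_diff 3 0 (-1) (u + 1))
    - x * (2 * (half_diff 2 2 0 u - half_diff 2 2 0 (u + 1)) - 2 * l * (half_diff 2 1 0 u - half_diff 2 1 0 (u + 1)) + l ^ 2 * (half_diff 2 0 0 u - half_diff 2 0 0 (u + 1)))) by ring.
  rewrite H32, H31, H30, H22, H21, H20. field.
Qed.

Lemma reg_log_asymptotic x : vanish (fun u => reg_log x u - (- (u - 1 / 4 - x / 2) * (ln 2 + ln u) ^ 2 + 1 / 2 * (ln 2 + ln u))).
Proof.
  set (l := ln 2).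
  apply (vanish_ext (fun u =>
     2 * (2 * half_diff 3 2 (-1) u - (- (1 / 2) * u * ln u ^ 2 + 1 / 8 * ln u ^ 2 + 1 / 4 * ln u))
     + (- (2) * l * (2 * half_diff 3 1 (-1) u - (u * ln u - 1 / 4 * ln u - 1 / 4))
     + (- (2) * x * (half_diff 2 2 0 u + 1 / 4 * ln u ^ 2) + 2 * l * x * (half_diff 2 1 0 u - 1 / 2 * ln u))))).
  - intros u Hu. unfold reg_log. fold l. rewrite half_diff_m1_0, half_diff_0_0 by assumption. field.
  - repeat apply vanish_plus; apply vanish_scal; [apply half_diff_m1_2|apply half_diff_m1_1|apply half_diff_0_2|apply half_diff_0_1].
Qed.

(** * The Gamma function and Lerch's formula at a half step *)

Notation at0 := (at_right 0).
Notation atoo := (Rbar_locally p_infty).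

Lemma filter_prod_pos (P : R * R -> Prop) a0 b0 : 0 < a0 ->
  (forall a b, 0 < a < a0 -> b0 < b -> P (a, b)) -> filter_prod at0 atoo P.
Proof.
  intros Ha0 H.
  apply (Filter_prod at0 atoo P (fun a => 0 < a < a0) (fun b => b0 < b)).
  - exists (mkposreal a0 Ha0). intros a Hb Ha.
    change (Rabs (a - 0) < a0) in Hb. rewrite Rminus_0_r in Hb. apply Rabs_def2 in Hb. lra.
  - exists b0. auto.
  - exact H.
Qed.

(** The improper integral is the supremum of the integrals over compact intervals,
    which increase with the interval. *)
Lemma is_RInt_gen_sup (f : R -> R) (M : R) : pcont f -> (forall t, 0 < t -> 0 <= f t) ->
  (forall a b, 0 < a -> a <= b -> RInt f a b <= M) ->
  exists l, is_RInt_gen f at0 atoo l /\ forall a b, 0 < a -> a <= b -> RInt f a b <= l.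
Proof.
  intros Hc Hf HM.
  destruct (completeness (fun v => exists a b, 0 < a /\ a <= b /\ v = RInt f a b)) as [l [Hub Hlub]].
  - exists M. intros v [a [b [Ha [Hab ->]]]]. auto.
  - exists (RInt f 1 1). exists 1, 1. repeat split; lra.
  - exists l. assert (Hl : forall a b, 0 < a -> a <= b -> RInt f a b <= l).
    { intros a b Ha Hab. apply Hub. exists a, b. auto. }
    split; [|exact Hl].
    intros P [eps HP].
    assert (Hex : exists a0 b0, 0 < a0 /\ a0 <= b0 /\ l - eps < RInt f a0 b0).
    { apply NNPP. intros Hno. assert (l <= l - eps); [|pose proof (cond_pos eps); lra].
      apply Hlub. intros v [a [b [Ha [Hab ->]]]]. apply Rnot_lt_le. intros Hlt.
      apply Hno. exists a, b. auto. }
    destruct Hex as [a0 [b0 [Ha0 [Hab0 Hlt]]]].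
    apply (filter_prod_pos _ a0 b0 Ha0). intros a b Ha Hb. simpl.
    assert (Hex : forall x y, 0 < x -> 0 < y -> ex_RInt f x y) by (intros; apply ex_RInt_pos; auto).
    exists (RInt f a b). split; [apply (RInt_correct (V := R_CompleteNormedModule)), Hex; lra|].
    apply HP. change (Rabs (RInt f a b - l) < eps).
    assert (E : RInt f a b = RInt f a a0 + RInt f a0 b0 + RInt f b0 b).
    { rewrite <- (RInt_Chasles (V := R_CompleteNormedModule) f a b0 b) by (apply Hex; lra).
      rewrite <- (RInt_Chasles (V := R_CompleteNormedModule) f a a0 b0) by (apply Hex; lra). reflexivity. }
    assert (0 <= RInt f a a0) by (apply RInt_ge_0; [lra|apply Hex; lra|intros; apply Hf; lra]).
    assert (0 <= RInt f b0 b) by (apply RInt_ge_0; [lra|apply Hex; lra|intros; apply Hf; lra]).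
    pose proof (Hl a b ltac:(lra) ltac:(lra)). apply Rabs_def1; lra.
Qed.

Definition gamma_density (z t : R) : R := Rpower t (z - 1) * exp (- t).

Lemma gamma_density_pcont z : pcont (gamma_density z).
Proof.
  intros v Hv. apply (ex_derive_continuous (V := R_NormedModule)). unfold gamma_density, Rpower.
  auto_derive. assumption.
Qed.

Lemma gamma_density_pos z t : 0 < gamma_density z t.
Proof. apply Rmult_lt_0_compat; apply exp_pos. Qed.

Lemma Rpower_exp_bound p t : 0 < p -> 0 < t -> Rpower t p * exp (- t) <= exp (p * ln p - p).
Proof.
  intros Hp Ht. unfold Rpower. rewrite <- exp_plus. apply exp_le_mono.
  assert (Hq : 0 < t / p) by now apply Rdiv_lt_0_compat.
  pose proof (exp_ineq1_le (ln (t / p))) as H. rewrite exp_ln in H by assumption.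
  unfold Rdiv in H. rewrite ln_mult, ln_Rinv in H by (auto; now apply Rinv_0_lt_compat).
  assert (p * (1 + (ln t + - ln p)) <= p * (t * / p)) by (apply Rmult_le_compat_l; lra).
  replace (p * (t * / p)) with t in H0 by (field; lra). lra.
Qed.

(** The density is dominated by a multiple of the derivative of the bounded function
    [t^z / (1 + t^z)], because [(1 + t^z)^2 exp(-t)] is bounded. *)
Lemma gamma_density_bounded z : 0 < z -> exists M, forall a b, 0 < a -> a <= b -> RInt (gamma_density z) a b <= M.
Proof.
  intros Hz.
  set (K := exp (2 * z * ln (2 * z) - 2 * z)).
  assert (HK : 0 < K) by apply exp_pos.
  set (C0 := (2 + 2 * K) / z).
  assert (HC : 0 < C0) by (apply Rdiv_lt_0_compat; lra).
  exists C0. intros a b Ha Hab.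
  (* up to an additive constant, C0 t^z / (1 + t^z) *)
  set (H := fun t => - C0 / (1 + Rpower t z)).
  set (h := fun t => C0 * (z * Rpower t (z - 1)) / (1 + Rpower t z) ^ 2).
  assert (Hpos : forall t p, 0 < Rpower t p) by (intros; apply exp_pos).
  assert (HD : forall t, 0 < t -> is_derive H t (h t)).
  { intros t Ht. unfold H, h.
    assert (E : Rpower t (z - 1) = / t * Rpower t z).
    { unfold Rpower. replace ((z - 1) * ln t) with (- ln t + z * ln t) by ring.
      now rewrite exp_plus, exp_Ropp, exp_ln. }
    rewrite E. pose proof (Hpos t z). unfold Rpower in *. auto_derive; [split; [assumption|lra]|].
    field. lra. }
  assert (Hh : pcont h).
  { intros t Ht. apply (ex_derive_continuous (V := R_NormedModule)). unfold h, Rpower.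
    pose proof (exp_pos (z * ln t)).
    auto_derive. repeat split; auto. apply Rgt_not_eq. nra. }
  assert (Hle : forall t, 0 < t -> gamma_density z t <= h t).
  { intros t Ht. unfold gamma_density, h.
    pose proof (Hpos t (z - 1)) as P1. pose proof (Hpos t z) as P2.
    replace (C0 * (z * Rpower t (z - 1)) / (1 + Rpower t z) ^ 2) with
      (Rpower t (z - 1) * ((2 + 2 * K) / (1 + Rpower t z) ^ 2)) by (unfold C0; field; lra).
    apply Rmult_le_compat_l; [lra|]. apply Rle_div_r; [nra|].
    pose proof (Rpower_exp_bound (2 * z) t ltac:(lra) Ht) as B. fold K in B.
    replace (2 * z) with (z + z) in B by ring. rewrite Rpower_plus in B.
    assert (exp (- t) <= 1) by (rewrite <- exp_0; apply exp_le_mono; lra).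
    pose proof (exp_pos (- t)).
    assert ((1 + Rpower t z) ^ 2 <= 2 + 2 * (Rpower t z * Rpower t z))
      by (pose proof (pow2_ge_0 (Rpower t z - 1)); lra).
    apply Rle_trans with (exp (- t) * (2 + 2 * (Rpower t z * Rpower t z))); [apply Rmult_le_compat_l; lra|].
    lra. }
  assert (E : RInt h a b = H b - H a).
  { apply (is_RInt_unique (V := R_CompleteNormedModule)).
    apply (is_RInt_derive (V := R_CompleteNormedModule) H h); intros t Ht; rewrite Rmin_left in Ht by lra;
    [apply HD|apply Hh]; lra. }
  apply Rle_trans with (RInt h a b).
  - apply RInt_le; [lra|apply ex_RInt_pos; [lra|lra|apply gamma_density_pcont]|apply ex_RInt_pos; auto; lra|].
    intros; apply Hle; lra.
  - rewrite E. unfold H. pose proof (Hpos a z). pose proof (Hpos b z).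
    assert (0 < C0 / (1 + Rpower b z)) by (apply Rdiv_lt_0_compat; lra).
    assert (C0 / (1 + Rpower a z) <= C0) by (apply Rle_div_l; nra).
    unfold Rdiv in *. lra.
Qed.

Lemma Gamma_spec z : 0 < z -> is_RInt_gen (gamma_density z) at0 atoo (Gamma z) /\ 0 < Gamma z.
Proof.
  intros Hz. destruct (gamma_density_bounded z Hz) as [M HM].
  destruct (is_RInt_gen_sup (gamma_density z) M (gamma_density_pcont z)) as [l [Hl Hle]]; [|exact HM|].
  - intros; left; apply gamma_density_pos.
  - assert (E : Gamma z = l).
    { unfold Gamma. apply (is_RInt_gen_unique (V := R_CompleteNormedModule)). exact Hl. }
    rewrite E. split; [exact Hl|].
    apply Rlt_le_trans with (RInt (gamma_density z) 1 2); [|apply Hle; lra].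
    apply RInt_gt_0; [lra|intros; apply gamma_density_pos|intros; apply gamma_density_pcont; lra].
Qed.

Lemma gamma_density_succ z t : 0 < t -> gamma_density (z + 1) t = t * gamma_density z t.
Proof.
  intros Ht. unfold gamma_density. replace (z + 1 - 1) with (1 + (z - 1)) by ring.
  rewrite Rpower_plus, Rpower_1 by assumption. ring.
Qed.

Lemma gamma_density_half z t : 0 < t -> gamma_density (z + 1 / 2) t = sqrt t * gamma_density z t.
Proof.
  intros Ht. unfold gamma_density. replace (z + 1 / 2 - 1) with (/ 2 + (z - 1)) by field.
  rewrite Rpower_plus, Rpower_sqrt by assumption. ring.
Qed.

Lemma Gamma_succ z : 0 < z -> Gamma (z + 1) = z * Gamma z.
Proof.
  intros Hz.
  destruct (Gamma_spec z Hz) as [H1 _]. destruct (Gamma_spec (z + 1) ltac:(lra)) as [H2 _].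
  set (f := fun t => Rpower t z * exp (- t)).
  assert (Hder : forall t, 0 < t -> is_derive f t (z * gamma_density z t - gamma_density (z + 1) t)).
  { intros t Ht. rewrite gamma_density_succ by assumption. unfold f, gamma_density.
    replace (Rpower t (z - 1)) with (/ t * Rpower t z).
    - unfold Rpower. auto_derive; [assumption|]. field. lra.
    - unfold Rpower. replace ((z - 1) * ln t) with (- ln t + z * ln t) by ring.
      now rewrite exp_plus, exp_Ropp, exp_ln. }
  assert (HD : forall t, 0 < t -> Derive f t = z * gamma_density z t - gamma_density (z + 1) t).
  { intros t Ht. apply is_derive_unique. auto. }
  assert (Hf : forall t, 0 < f t) by (intros; apply Rmult_lt_0_compat; apply exp_pos).
  assert (I : is_RInt_gen (Derive f) at0 atoo (0 - 0)).
  { apply is_RInt_gen_Derive.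
    - apply (filter_prod_pos _ 1 1); [lra|]. intros a b Ha Hb t. simpl. rewrite Rmin_left by lra.
      intros Ht. eexists; apply Hder; lra.
    - apply (filter_prod_pos _ 1 1); [lra|]. intros a b Ha Hb t. simpl. rewrite Rmin_left by lra.
      intros Ht. apply continuous_ext_loc with (fun t => z * gamma_density z t - gamma_density (z + 1) t).
      + assert (Hp : 0 < t) by lra. exists (mkposreal t Hp). intros s Hs.
        change (Rabs (s - t) < t) in Hs. apply Rabs_def2 in Hs. symmetry. apply HD. lra.
      + apply (continuous_minus (V := R_NormedModule) (fun t => z * gamma_density z t) (gamma_density (z + 1))).
        * apply (continuous_scal_r (V := R_NormedModule) z (gamma_density z)). apply gamma_density_pcont. lra.
        * apply gamma_density_pcont. lra.
    - intros P [eps HP]. 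
      assert (Hp : 0 < exp (ln eps / z)) by apply exp_pos.
      exists (mkposreal _ Hp). intros t Hb Ht. apply HP.
      change (Rabs (t - 0) < exp (ln eps / z)) in Hb. change (Rabs (f t - 0) < eps).
      rewrite Rminus_0_r, Rabs_pos_eq in * by (auto; left; auto).
      apply Rle_lt_trans with (Rpower t z * 1).
      + apply Rmult_le_compat_l; [left; apply exp_pos|]. rewrite <- exp_0. apply exp_le_mono. lra.
      + rewrite Rmult_1_r. unfold Rpower. rewrite <- (exp_ln eps) by apply cond_pos.
        apply exp_increasing. apply ln_increasing in Hb; [|assumption]. rewrite ln_exp in Hb.
        apply Rlt_div_r in Hb; [|assumption]. lra.
    - set (K := exp ((z + 1) * ln (z + 1) - (z + 1))).
      assert (HK : 0 < K) by apply exp_pos.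
      intros P [eps HP]. exists (K / eps). intros t Ht. apply HP.
      assert (Hke : 0 < K / eps) by (apply Rdiv_lt_0_compat; [assumption|apply cond_pos]).
      change (Rabs (f t - 0) < eps). rewrite Rminus_0_r, Rabs_pos_eq by (left; auto).
      pose proof (Rpower_exp_bound (z + 1) t ltac:(lra) ltac:(lra)) as B. fold K in B.
      rewrite Rpower_plus, Rpower_1 in B by lra.
      assert (Ht0 : 0 < t) by lra.
      apply Rlt_div_l in Ht; [|apply cond_pos].
      unfold f. apply Rmult_lt_reg_l with t; [lra|]. lra. }
  assert (I' : is_RInt_gen (fun t => minus (z * gamma_density z t) (gamma_density (z + 1) t)) at0 atoo (0 - 0)).
  { refine (is_RInt_gen_ext _ _ _ _ I).
    apply (filter_prod_pos _ 1 1); [lra|]. intros a b Ha Hb t. simpl. rewrite Rmin_left by lra.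
    intros Ht. apply HD. lra. }
  pose proof (is_RInt_gen_minus _ _ _ _ (is_RInt_gen_scal _ z _ H1) H2) as I2.
  pose proof (is_RInt_gen_unique (V := R_CompleteNormedModule) _ _ I') as U1.
  pose proof (is_RInt_gen_unique (V := R_CompleteNormedModule) _ _ I2) as U2.
  assert (E : z * Gamma z + - Gamma (z + 1) = 0 - 0) by exact (eq_trans (eq_sym U2) U1).
  lra.
Qed.

(** Integrate [sqrt t <= (sqrt z + t / sqrt z) / 2] against the density of
    [Gamma z], and use [Gamma (z+1) = z Gamma z]. *)
Lemma Gamma_half_le z : 0 < z -> Gamma (z + 1 / 2) <= sqrt z * Gamma z.
Proof.
  intros Hz.
  destruct (Gamma_spec z Hz) as [H1 _]. destruct (Gamma_spec (z + 1) ltac:(lra)) as [H2 _].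
  destruct (Gamma_spec (z + 1 / 2) ltac:(lra)) as [H3 P3].
  assert (Hs : 0 < sqrt z) by now apply sqrt_lt_R0.
  assert (Hss : sqrt z * sqrt z = z) by (apply sqrt_sqrt; lra).
  pose proof (is_RInt_gen_plus _ _ _ _ (is_RInt_gen_scal _ (sqrt z / 2) _ H1) (is_RInt_gen_scal _ (/ (2 * sqrt z)) _ H2)) as I.
  assert (HN : norm (Gamma (z + 1 / 2)) <= plus (scal (sqrt z / 2) (Gamma z)) (scal (/ (2 * sqrt z)) (Gamma (z + 1)))).
  { refine (RInt_gen_norm _ _ _ _ _ _ H3 I).
    - apply (filter_prod_pos _ 1 1); [lra|]. intros a b Ha Hb. simpl. lra.
    - apply (filter_prod_pos _ 1 1); [lra|]. intros a b Ha Hb t Ht. simpl in Ht.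
      change (Rabs (gamma_density (z + 1 / 2) t) <= sqrt z / 2 * gamma_density z t + / (2 * sqrt z) * gamma_density (z + 1) t).
      rewrite Rabs_pos_eq by (left; apply gamma_density_pos).
      rewrite gamma_density_half, gamma_density_succ by lra.
      replace (sqrt z / 2 * gamma_density z t + / (2 * sqrt z) * (t * gamma_density z t)) with
        ((sqrt z / 2 + / (2 * sqrt z) * t) * gamma_density z t) by ring.
      apply Rmult_le_compat_r; [left; apply gamma_density_pos|].
      apply Rmult_le_reg_l with (2 * sqrt z); [lra|].
      replace (2 * sqrt z * (sqrt z / 2 + / (2 * sqrt z) * t)) with (sqrt z * sqrt z + t) by (field; lra).
      assert (Hst : sqrt t * sqrt t = t) by (apply sqrt_sqrt; lra).
      pose proof (pow2_ge_0 (sqrt z - sqrt t)). lra. }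
  change (Rabs (Gamma (z + 1 / 2)) <= sqrt z / 2 * Gamma z + / (2 * sqrt z) * Gamma (z + 1)) in HN.
  rewrite Rabs_pos_eq, Gamma_succ in HN by lra.
  replace (sqrt z / 2 * Gamma z + / (2 * sqrt z) * (z * Gamma z)) with (sqrt z * Gamma z) in HN; [exact HN|].
  replace (z * Gamma z) with (sqrt z * sqrt z * Gamma z) by now rewrite Hss.
  field. lra.
Qed.

Definition ln_gamma_ratio (u : R) : R := ln (Gamma (u + 1 / 2) / Gamma u).

Lemma ln_sqrt z : 0 < z -> ln (sqrt z) = 1 / 2 * ln z.
Proof.
  intros Hz. rewrite <- Rpower_sqrt by assumption. unfold Rpower. rewrite ln_exp. field.
Qed.

Lemma ln_gamma_ratio_bounds u : 0 < u -> ln u - 1 / 2 * ln (u + 1 / 2) <= ln_gamma_ratio u <= 1 / 2 * ln u.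
Proof.
  intros Hu. unfold ln_gamma_ratio.
  destruct (Gamma_spec u Hu) as [_ P1]. destruct (Gamma_spec (u + 1 / 2) ltac:(lra)) as [_ P2].
  pose proof (Gamma_half_le u Hu) as H1.
  pose proof (Gamma_half_le (u + 1 / 2) ltac:(lra)) as H2.
  replace (u + 1 / 2 + 1 / 2) with (u + 1) in H2 by field. rewrite Gamma_succ in H2 by assumption.
  assert (Hs : 0 < sqrt (u + 1 / 2)) by (apply sqrt_lt_R0; lra).
  split.
  - rewrite <- ln_sqrt by lra.
    replace (ln u - ln (sqrt (u + 1 / 2))) with (ln (u / sqrt (u + 1 / 2))).
    2:{ unfold Rdiv. rewrite ln_mult, ln_Rinv; [ring|assumption|assumption|now apply Rinv_0_lt_compat]. }
    apply ln_le_mono; [now apply Rdiv_lt_0_compat|].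
    apply Rle_div_l; [assumption|]. unfold Rdiv. rewrite Rmult_assoc, (Rmult_comm (/ _)), <- Rmult_assoc.
    apply Rle_div_r; [assumption|]. lra.
  - rewrite <- ln_sqrt by lra. apply ln_le_mono; [now apply Rdiv_lt_0_compat|].
    now apply Rle_div_l.
Qed.

Lemma ln_gamma_ratio_succ u : 0 < u -> ln_gamma_ratio (u + 1) = ln_gamma_ratio u + ln (u + 1 / 2) - ln u.
Proof.
  intros Hu. unfold ln_gamma_ratio.
  destruct (Gamma_spec u Hu) as [_ P1]. destruct (Gamma_spec (u + 1 / 2) ltac:(lra)) as [_ P2].
  replace (u + 1 + 1 / 2) with (u + 1 / 2 + 1) by ring.
  rewrite !Gamma_succ by lra.
  unfold Rdiv. rewrite !ln_mult, !ln_Rinv, !ln_mult; try lra;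
  try apply Rinv_0_lt_compat; try apply Rmult_lt_0_compat; lra.
Qed.

Lemma ln_gamma_ratio_vanish : vanish (fun u => ln_gamma_ratio u - 1 / 2 * ln u).
Proof.
  apply (vanish_le _ (fun u => / u)); [|apply vanish_inv].
  intros u Hu. pose proof (ln_gamma_ratio_bounds u ltac:(lra)) as [H1 H2].
  pose proof (ln_increment_half u (u + 1 / 2) Hu ltac:(lra)) as [H3 H4].
  assert (0 < / u) by (apply Rinv_0_lt_compat; lra).
  apply Rabs_le. lra.
Qed.

Lemma periodic_vanish f u : (forall u, 0 < u -> f (u + 1) = f u) -> vanish f -> 0 < u -> f u = 0.
Proof.
  intros Hp Hv Hu.
  assert (HN : forall n, f (u + INR n) = f u).
  { induction n as [|n IH]; [simpl; f_equal; ring|].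
    rewrite S_INR, <- IH, <- (Hp (u + INR n)) by (pose proof (pos_INR n); lra). f_equal. ring. }
  destruct (Req_dec (f u) 0) as [|Hne]; [assumption|exfalso].
  assert (He : 0 < Rabs (f u) / 2) by (pose proof (Rabs_pos_lt _ Hne); lra).
  destruct (Hv _ He) as [U [HU HfU]].
  destruct (INR_unbounded U) as [n Hn].
  specialize (HfU (u + INR n) ltac:(lra)). rewrite HN in HfU. lra.
Qed.

(** The difference of the two sides has period [1] and tends to [0]. *)
Lemma half_diff_ln_gamma_ratio u : 0 < u -> half_diff 2 1 0 u = ln_gamma_ratio u.
Proof.
  intros Hu. enough (half_diff 2 1 0 u - ln_gamma_ratio u = 0) by lra.
  apply (periodic_vanish (fun u => half_diff 2 1 0 u - ln_gamma_ratio u)); [| |assumption].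
  - intros v Hv. rewrite ln_gamma_ratio_succ by assumption.
    pose proof (half_diff_increment 2 1 0 v ltac:(simpl; lra) Hv) as H.
    rewrite !pow_coefR_eq, !exp_ln_0 in H. simpl pow in H. simpl fact in H. simpl INR in H. lra.
  - apply (vanish_ext (fun u => (half_diff 2 1 0 u - 1 / 2 * ln u) + -1 * (ln_gamma_ratio u - 1 / 2 * ln u)));
      [intros; ring|].
    apply vanish_plus; [apply half_diff_0_1|apply vanish_scal, ln_gamma_ratio_vanish].
Qed.

(** * The product and its limit *)

Lemma fold_right_Rmult_acc (l : list R) a : fold_right Rmult a l = fold_right Rmult 1 l * a.
Proof. induction l as [|h l IH]; simpl; [ring|]. rewrite IH. ring. Qed.

Lemma prod_range_S N f : prod_range 1 (S N) f = prod_range 1 N f * f (S N).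
Proof.
  unfold prod_range. replace (S (S N) - 1)%nat with (S N) by lia.
  replace (S N - 1)%nat with N by lia. rewrite seq_S, map_app, fold_right_app.
  rewrite fold_right_Rmult_acc. simpl. ring.
Qed.

Lemma prod_range_exp x n : -1 < x ->
  prod_range 1 (2 * n) (fun k => Rpower (INR k + x) ((-1) ^ k * INR k * ln (INR k + x)))
  = exp (reg_log x ((x + 1) / 2) - reg_log x ((x + 1) / 2 + INR n)).
Proof.
  intros Hx. induction n as [|n IH].
  - simpl INR. rewrite Rplus_0_r, Rminus_diag, exp_0. reflexivity.
  - replace (2 * S n)%nat with (S (S (2 * n))) by lia.
    rewrite !prod_range_S, IH. unfold Rpower.
    pose proof (pos_INR n) as Hn.
    set (y := (x + 1) / 2 + INR n). assert (Hy : 0 < y) by (unfold y; lra).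
    rewrite Rmult_assoc, <- !exp_plus. f_equal.
    replace ((x + 1) / 2 + INR (S n)) with (y + 1) by (unfold y; rewrite S_INR; ring).
    pose proof (reg_log_increment x y Hy) as HF.
    assert (E1 : INR (S (2 * n)) + x = 2 * y).
    { rewrite S_INR, mult_INR. unfold y. simpl INR. field. }
    assert (E2 : INR (S (S (2 * n))) + x = 2 * (y + 1 / 2)).
    { rewrite S_INR, Rplus_assoc, (Rplus_comm 1), <- Rplus_assoc, E1. field. }
    assert (E3 : INR (S (2 * n)) = 2 * y - x) by lra.
    assert (E4 : INR (S (S (2 * n))) = 2 * (y + 1 / 2) - x) by lra.
    rewrite E1, E2, E3, E4, !ln_mult by lra.
    change ((-1) ^ S (S (2 * n))) with (-1 * (-1 * (-1) ^ (2 * n))).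
    change ((-1) ^ S (2 * n)) with (-1 * (-1) ^ (2 * n)).
    rewrite pow_1_even. unfold pair_log in HF. fold y. lra.
Qed.

Lemma vanish_shift_by f a : 0 < a -> vanish f -> vanish (fun v => f (a + v)).
Proof.
  intros Ha H eps He. destruct (H eps He) as [U [HU HfU]]. exists U. split; [assumption|].
  intros u Hu. apply HfU. lra.
Qed.

Lemma vanish_seq f : vanish f -> is_lim_seq (fun n => f (INR n)) 0.
Proof.
  intros H. apply is_lim_seq_spec. intros eps.
  destruct (H (eps / 2)) as [U [HU HfU]]; [pose proof (cond_pos eps); lra|].
  destruct (INR_unbounded U) as [N HN]. exists N. intros n Hn.
  apply le_INR in Hn. specialize (HfU (INR n) ltac:(lra)). rewrite Rminus_0_r.
  pose proof (cond_pos eps). lra.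
Qed.

(** With [u = a + v] one has [u - 1/4 - x/2 = v + 1/4], so the quadratic terms in the
    logarithm differ only through [ln(2u) - ln(2v)], which is [a/v + O(1/v^2)]; since
    [2a = x + 1], the terms in [ln(2v)] cancel up to [O(ln v / v)]. *)
Lemma log_balance x : -1 < x -> vanish (fun v =>
  (- (1 / 2) - x - (v + 1 / 4) * ln (2 * v)) * ln (2 * v) - reg_log x ((x + 1) / 2 + v)).
Proof.
  intros Hx. set (a := (x + 1) / 2). assert (Ha : 0 < a) by (unfold a; lra).
  set (P := fun u => reg_log x u - (- (u - 1 / 4 - x / 2) * (ln 2 + ln u) ^ 2 + 1 / 2 * (ln 2 + ln u))).
  set (lam := fun v => ln 2 + ln v). set (del := fun v => ln (a + v) - ln v).
  apply (vanish_ext (fun v =>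
    (lam v * ((2 * v + 1 / 2) * del v - 2 * a) + ((v + 1 / 4) * del v ^ 2 - 1 / 2 * del v)) + -1 * P (a + v))).
  - intros v Hv. unfold P, lam, del. rewrite ln_mult by lra. unfold a. field.
  - apply vanish_plus.
    2:{ apply vanish_scal. apply (vanish_shift_by P a Ha). apply reg_log_asymptotic. }
    set (K := 2 * a ^ 2 + a). assert (HK : 0 < K) by (unfold K; nra).
    apply (vanish_le _ (fun v => K * (ln v / v) + (K * (ln 2 + 1)) * / v)).
    2:{ apply vanish_plus; apply vanish_scal; [apply vanish_ln_div|apply vanish_inv]. }
    intros v Hv.
    assert (Hiv : 0 < / v) by (apply Rinv_0_lt_compat; lra).
    assert (Hlam : 0 <= lam v).
    { unfold lam. pose proof (ln_le_mono 1 v ltac:(lra) Hv). rewrite ln_1 in H. pose proof ln_lt_2. lra. }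
    assert (Hdel : 0 <= del v <= a * / v).
    { unfold del. pose proof (ln_increment v (a + v) ltac:(lra) ltac:(lra)) as H.
      replace ((a + v - v) / v) with (a * / v) in H by (field; lra). exact H. }
    assert (Hdel2 : a / (a + v) <= del v).
    { unfold del. assert (Hq : 0 < v / (a + v)) by (apply Rdiv_lt_0_compat; lra).
      pose proof (exp_ineq1_le (ln (v / (a + v)))) as H. rewrite exp_ln in H by assumption.
      unfold Rdiv in H at 1. rewrite ln_mult, ln_Rinv in H by (try apply Rinv_0_lt_compat; lra).
      replace (v / (a + v)) with (1 - a / (a + v)) in H by (field; lra). lra. }
    assert (Hav : v * / v = 1) by (field; lra).
    assert (B1 : Rabs ((2 * v + 1 / 2) * del v - 2 * a) <= K * / v).
    { apply Rabs_le. split.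
      - assert (H1 : (2 * v + 1 / 2) * (a / (a + v)) <= (2 * v + 1 / 2) * del v) by (apply Rmult_le_compat_l; lra).
        assert (H2 : 2 * a - 2 * a ^ 2 * / v <= (2 * v + 1 / 2) * (a / (a + v))).
        { apply Rle_trans with (2 * a - 2 * a ^ 2 * / (a + v)).
          - assert (/ (a + v) <= / v) by (apply Rinv_le_contravar; lra). nra.
          - replace ((2 * v + 1 / 2) * (a / (a + v))) with (2 * a - 2 * a ^ 2 * / (a + v) + 1 / 2 * (a / (a + v))) by (field; lra).
            assert (0 < a / (a + v)) by (apply Rdiv_lt_0_compat; lra). lra. }
        unfold K. nra.
      - assert (H1 : (2 * v + 1 / 2) * del v <= (2 * v + 1 / 2) * (a * / v)) by (apply Rmult_le_compat_l; lra).
        replace ((2 * v + 1 / 2) * (a * / v)) with (2 * a * (v * / v) + 1 / 2 * a * / v) in H1 by ring.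
        rewrite Hav in H1. unfold K.
        assert (0 < a * / v) by (now apply Rmult_lt_0_compat).
        assert (0 <= 2 * a ^ 2 * / v) by (apply Rmult_le_pos; [nra|lra]). lra. }
    assert (B2 : Rabs ((v + 1 / 4) * del v ^ 2 - 1 / 2 * del v) <= K * / v).
    { assert (H1 : del v ^ 2 <= (a * / v) ^ 2) by (apply pow_incr; lra).
      assert (H2 : (v + 1 / 4) * del v ^ 2 <= 2 * v * (a * / v) ^ 2).
      { apply Rmult_le_compat; try lra. apply pow2_ge_0. }
      replace (2 * v * (a * / v) ^ 2) with (2 * a ^ 2 * / v * (v * / v)) in H2 by ring.
      rewrite Hav, Rmult_1_r in H2.
      assert (0 <= (v + 1 / 4) * del v ^ 2) by (apply Rmult_le_pos; [lra|apply pow2_ge_0]).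
      assert (0 < a * / v) by (now apply Rmult_lt_0_compat).
      assert (0 <= 2 * a ^ 2 * / v) by (apply Rmult_le_pos; [nra|lra]).
      unfold K. apply Rabs_le. lra. }
    eapply Rle_trans; [apply Rabs_triang|].
    rewrite Rabs_mult, (Rabs_pos_eq (lam v)) by assumption.
    assert (lam v * Rabs ((2 * v + 1 / 2) * del v - 2 * a) <= lam v * (K * / v)) by (apply Rmult_le_compat_l; assumption).
    unfold lam in *. unfold Rdiv. lra.
Qed.

Lemma RCpow_R y r : RCpow y (RtoC r) = RtoC (exp (r * ln y)).
Proof. unfold RCpow. rewrite <- RtoC_mult. apply Cexp_R. Qed.

Lemma Zeta_coef_diff M k t u : 
  Re (Zeta_coef M k (RtoC t) (u + 1 / 2)) - Re (Zeta_coef M k (RtoC t) u) = half_diff M k t u.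
Proof.
  unfold Zeta_coef, half_diff, reg_coefR. set (p := (RtoC (-1) ^ k / (RtoC t - 1) ^ S k)%C).
  change (Re p + Re (reg_coef M k (RtoC t) (u + 1 / 2)) - (Re p + Re (reg_coef M k (RtoC t) u)) =
    Re (reg_coef M k (RtoC t) (u + 1 / 2)) - Re (reg_coef M k (RtoC t) u)). ring.
Qed.

Lemma limit_value x : -1 < x ->
  (RCpow 2
          (- RtoC (1 / 4 * ln 2)
           + 4 * hurwitz_zeta' (-1) ((x + 1) / 2)
           - 4 * hurwitz_zeta' (-1) (x / 2 + 1))
        * RtoC (Rpower (Gamma ((x + 1) / 2) / Gamma (x / 2 + 1))
                  (- 2 * x * ln 2))
        * Cexp
            (2 * hurwitz_zeta'' (-1) (x / 2 + 1)
             - 2 * hurwitz_zeta'' (-1) ((x + 1) / 2)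
             + RtoC x * (hurwitz_zeta'' 0 ((x + 1) / 2)
                         - hurwitz_zeta'' 0 (x / 2 + 1))))%C
  = RtoC (exp (reg_log x ((x + 1) / 2))).
Proof.
  intros Hx. set (a := (x + 1) / 2). assert (Ha : 0 < a) by (unfold a; lra).
  replace (x / 2 + 1) with (a + 1 / 2) by (unfold a; field).
  destruct (hurwitz_derivs 3 (-1) a) as [P1 P2]; [simpl; lra|lra|lra|].
  destruct (hurwitz_derivs 3 (-1) (a + 1 / 2)) as [Q1 Q2]; [simpl; lra|lra|lra|].
  destruct (hurwitz_derivs 2 0 a) as [_ P3]; [simpl; lra|lra|lra|].
  destruct (hurwitz_derivs 2 0 (a + 1 / 2)) as [_ Q3]; [simpl; lra|lra|lra|].
  pose proof (Zeta_coef_diff 3 1 (-1) a) as D1. pose proof (Zeta_coef_diff 3 2 (-1) a) as D2.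
  pose proof (Zeta_coef_diff 2 2 0 a) as D3.
  rewrite P1, P2, Q1, Q2, P3, Q3.
  set (p1 := Re (Zeta_coef 3 1 (RtoC (-1)) a)) in *. set (q1 := Re (Zeta_coef 3 1 (RtoC (-1)) (a + 1 / 2))) in *.
  set (p2 := Re (Zeta_coef 3 2 (RtoC (-1)) a)) in *. set (q2 := Re (Zeta_coef 3 2 (RtoC (-1)) (a + 1 / 2))) in *.
  set (p3 := Re (Zeta_coef 2 2 (RtoC 0) a)) in *. set (q3 := Re (Zeta_coef 2 2 (RtoC 0) (a + 1 / 2))) in *.
  rewrite <- RtoC_opp, <- !RtoC_mult, <- RtoC_plus, <- !RtoC_minus, <- RtoC_mult, <- RtoC_plus.
  rewrite RCpow_R, Cexp_R, <- !RtoC_mult. f_equal.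
  unfold Rpower. rewrite <- !exp_plus. f_equal.
  pose proof (half_diff_ln_gamma_ratio a Ha) as HL. unfold ln_gamma_ratio in HL.
  destruct (Gamma_spec a Ha) as [_ G1]. destruct (Gamma_spec (a + 1 / 2) ltac:(lra)) as [_ G2].
  assert (EL : ln (Gamma a / Gamma (a + 1 / 2)) = - half_diff 2 1 0 a).
  { rewrite HL. unfold Rdiv. rewrite !ln_mult, !ln_Rinv by (try apply Rinv_0_lt_compat; assumption). ring. }
  rewrite EL. unfold reg_log. rewrite half_diff_m1_0, half_diff_0_0, <- D1, <- D2, <- D3 by assumption.
  assert (Ex : x = 2 * a - 1) by (unfold a; field). clearbody a. rewrite Ex. field.
Qed.

Theorem mainTheorem3 (x : R) (hx : -1 < x) :
  filterlim
    (fun n : nat =>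
       RtoC
         (Rpower (2 * INR n)
            (- (1 / 2) - x - (INR n + 1 / 4) * ln (2 * INR n)) *
          prod_range 1 (2 * n) (fun k : nat =>
            Rpower (INR k + x) ((-1) ^ k * INR k * ln (INR k + x)))))
    eventually
    (@locally C_UniformSpace
       (RCpow 2
          (- RtoC (1 / 4 * ln 2)
           + 4 * hurwitz_zeta' (-1) ((x + 1) / 2)
           - 4 * hurwitz_zeta' (-1) (x / 2 + 1))
        * RtoC (Rpower (Gamma ((x + 1) / 2) / Gamma (x / 2 + 1))
                  (- 2 * x * ln 2))
        * Cexp
            (2 * hurwitz_zeta'' (-1) (x / 2 + 1)
             - 2 * hurwitz_zeta'' (-1) ((x + 1) / 2)
             + RtoC x * (hurwitz_zeta'' 0 ((x + 1) / 2)
                         - hurwitz_zeta'' 0 (x / 2 + 1))))%C).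
Proof.
  rewrite (limit_value x hx).
  set (f := fun v => (- (1 / 2) - x - (v + 1 / 4) * ln (2 * v)) * ln (2 * v) - reg_log x ((x + 1) / 2 + v)).
  assert (L : is_lim_seq (fun n => exp (f (INR n) + reg_log x ((x + 1) / 2))) (exp (reg_log x ((x + 1) / 2)))).
  { apply is_lim_seq_continuous; [apply derivable_continuous_pt, derivable_pt_exp|].
    replace (Finite (reg_log x ((x + 1) / 2))) with (Rbar_plus 0 (reg_log x ((x + 1) / 2))) by (simpl; f_equal; ring).
    apply is_lim_seq_plus'; [apply (vanish_seq f), log_balance, hx|apply is_lim_seq_const]. }
  apply filterlim_Cmod; [apply eventually_filter|]. intros eps He.
  apply is_lim_seq_spec in L. destruct (L (mkposreal eps He)) as [N HN].
  exists N. intros n Hn. specialize (HN n Hn). simpl in HN.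
  rewrite <- RtoC_minus, Cmod_R, prod_range_exp by assumption.
  unfold Rpower. rewrite <- exp_plus. unfold f in HN.
  replace ((- (1 / 2) - x - (INR n + 1 / 4) * ln (2 * INR n)) * ln (2 * INR n) +
    (reg_log x ((x + 1) / 2) - reg_log x ((x + 1) / 2 + INR n))) with
   ((- (1 / 2) - x - (INR n + 1 / 4) * ln (2 * INR n)) * ln (2 * INR n) -
    reg_log x ((x + 1) / 2 + INR n) + reg_log x ((x + 1) / 2)) by ring.
  exact HN.
Qed.
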